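(* For all $x\in\mathbb{R}$, $$\lim_{m\wedge n\to\infty}\mathbb{P}\big(R_{m,n}\le x\big)=\Phi(x).$$
   Context: Setting. Write $\mathbb{N}$ for the natural numbers, $m\wedge n=\min\{m,n\}$, $\ln^+x=\max\{\ln x,0\}$, and $\Phi$ for the standard normal distribution function. Let $((\xi_{1,n},\xi_{2,n})^T)_{n\ge0}$ be a sequence of i.i.d. random vectors in $\mathbb{R}^2$ (the environments; for fixed $n$, $\xi_{1,n}$ and $\xi_{2,n}$ may be dependent). For $l=1,2$, each realization of $\xi_{l,n}$ determines a probability law $p(\xi_{l,n})=\{p_k(\xi_{l,n}):k\in\mathbb{N}\}$ on the nonnegative integers. The two branching processes in random environment are $$Z_{l,0}=1,\qquad Z_{l,n+1}=\sum_{i=1}^{Z_{l,n}}X_{l,n,i},\quad n\ge0,\ l=1,2,$$ where, given the environment, the variables $X_{1,n,i},X_{2,n,i}$ ($n\ge 0$, $i\ge1$) are independent, $X_{l,n,i}$ has law $p(\xi_{l,n})$, and those of generation $n$ are independent of $\{Z_{1,k},Z_{2,k}:0\le k\le n\}$. $\mathbb{P}$ and $\mathbb{E}$ denote the annealed (total) probability and expectation. For $l=1,2$ put $$m_{l,n}=\sum_{k=0}^\infty k\,p_k(\xi_{l,n}),\quad M_{l,n}=\ln m_{l,n},\quad \mu_l=\mathbb{E}M_{l,0},\quad \sigma_l^2=\mathrm{Var}(M_{l,0}),\quad \rho=\frac{\mathrm{Cov}(M_{1,0},M_{2,0})}{\sigma_1\sigma_2}.$$ Standing assumptions: $0<\sigma_1,\sigma_2<\infty$;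 $$\mathbb{E}\Big[\tfrac{Z_{1,1}}{m_{1,0}}\ln^+Z_{1,1}+\tfrac{Z_{2,1}}{m_{2,0}}\ln^+Z_{2,1}\Big]<\infty;$$ $p_0(\xi_{1,0})=p_0(\xi_{2,0})=0$ a.s.; and either $\rho\in[-1,1)$, or $\rho=1$ and $\sigma_1\ne\sigma_2$. Define for integers $m,n\ge1$ $$V_{m,n,\rho}=\sqrt{\tfrac1n\sigma_1^2+\tfrac1m\sigma_2^2-2\rho\sigma_1\sigma_2\tfrac{m\wedge n}{mn}},\qquad R_{m,n}=\frac{\frac1n\ln Z_{1,n}-\frac1m\ln Z_{2,m}-(\mu_1-\mu_2)}{V_{m,n,\rho}}.$$ *)

(* Defs.v *)
From HB Require Import structures.
From mathcomp Require Import all_boot all_order all_algebra finmap.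
From mathcomp Require Import all_classical all_reals all_analysis.

Set Implicit Arguments.
Unset Strict Implicit.
Unset Printing Implicit Defensive.

Import Order.TTheory GRing.Theory Num.Theory.
Import numFieldNormedType.Exports.

Local Open Scope classical_set_scope.
Local Open Scope ring_scope.

Section Probability.
Context {d : measure_display} {T : measurableType d} {R : realType}.
Variable P : probability T R.

Section RandomSequences.
Context {d' : measure_display} {T' : measurableType d'}.
Variable xi : nat -> {RV P >-> T'}.

Definition mutually_independent : Prop :=
  forall (J : {fset nat}) (B : nat -> set T'),
    (forall n, measurable (B n)) ->
    P (\bigcap_(n in [set` J]) (xi n @^-1` B n)) =
    (\prod_(n <- J) P (xi n @^-1` B n))%E.

Definition identically_distributed : Prop :=
  forall (n : nat) (B : set T'), measurable B ->
    P (xi n @^-1` B) = P (xi 0 @^-1` B).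

Definition iid : Prop := mutually_independent /\ identically_distributed.

Definition generated_sigma : set (set T) :=
  <<s [set A | exists n (B : set T'), measurable B /\ A = xi n @^-1` B] >>.

End RandomSequences.

(* [f] is a version of the conditional probability P(E | G). *)
Definition is_cond_prob (G : set (set T)) (E : set T) (f : T -> R) : Prop :=
  (forall B : set R, measurable B -> G (f @^-1` B)) /\
  (forall A : set T, G A -> P (A `&` E) = (\int[P]_(w in A) (f w)%:E)%E).

End Probability.

(* The two processes l = 1, 2 are indexed by ['I_2]. *)
Definition proc1 : 'I_2 := ord0.
Definition proc2 : 'I_2 := ord_max.

Definition component (U : Type) (l : 'I_2) (v : U * U) : U :=
  if l == proc1 then v.1 else v.2.

Section BPRE.
Context {d : measure_display} {T : measurableType d} {R : realType}.
Variable P : probability T R.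
Variable xi : nat -> {RV P >-> (R * R)%type}.
Variable p : R.-pker R ~> nat.
(* [X l n i] is the (i+1)-st offspring variable of generation n in process l:
   the index i starts at 0. *)
Variable X : 'I_2 -> nat -> nat -> {RV P >-> nat}.

Definition env (l : 'I_2) (n : nat) (w : T) : R := component l (xi n w).

(* Given the environment (i.e. the sigma-algebra generated by all the
   [xi n]), the variables X_{l,n,i} are independent, with laws
   p(xi_{l,n}).  The triple [j] stands for (l, n, i). *)
Definition quenched_offspring : Prop :=
  forall (J : {fset 'I_2 * nat * nat}) (B : 'I_2 * nat * nat -> set nat),
    is_cond_prob P (generated_sigma xi)
      (\bigcap_(j in [set` J]) (X j.1.1 j.1.2 j.2 @^-1` B j))
      (fun w => \prod_(j <- J) fine (p (env j.1.1 j.1.2 w) (B j))).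

Fixpoint Z (l : 'I_2) (n : nat) (w : T) : nat :=
  if n is n'.+1 then (\sum_(i < Z l n' w) X l n' i w)%N else 1%N.

(* A series of nonnegative terms: its value may be +oo. *)
Definition emean (l : 'I_2) (n : nat) (w : T) : \bar R :=
  (\sum_(0 <= k <oo) k%:R%:E * p (env l n w) [set k])%E.

(* Meaningful where [emean] is finite. *)
Definition mean (l : 'I_2) (n : nat) (w : T) : R := fine (emean l n w).

Definition M (l : 'I_2) (n : nat) (w : T) : R := ln (mean l n w).

Definition mu (l : 'I_2) : R := fine 'E_P[M l 0].

Definition sigma (l : 'I_2) : R := Num.sqrt (fine 'V_P[M l 0]).

Definition rho : R :=
  fine (covariance P (M proc1 0) (M proc2 0)) / (sigma proc1 * sigma proc2).

Definition lnplus (x : R) : R := Num.max (ln x) 0.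

Definition V (m n : nat) : R :=
  Num.sqrt (sigma proc1 ^+ 2 / n%:R + sigma proc2 ^+ 2 / m%:R
            - 2 * rho * sigma proc1 * sigma proc2
              * ((minn m n)%:R / (m%:R * n%:R))).

Definition Rstat (m n : nat) (w : T) : R :=
  (ln (Z proc1 n w)%:R / n%:R - ln (Z proc2 m w)%:R / m%:R
   - (mu proc1 - mu proc2)) / V m n.

End BPRE.

(* The filter on pairs (m, n) expressing min(m, n) -> oo. *)
Definition min_infty : set_system (nat * nat) :=
  filter_from [set: nat] (fun N => [set mn | (N <= minn mn.1 mn.2)%N]).

#[global] Instance min_infty_filter : ProperFilter min_infty.
Proof.
apply: filter_from_proper; last by move=> N _; exists (N, N); rewrite /= minnn.
apply: filter_from_filter; first by exists 0%N.
move=> N1 N2 _ _; exists (maxn N1 N2) => // mn /=.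
by rewrite geq_max => /andP[].
Qed.

(* Main.v *)
From HB Require Import structures.
Require Import Defs.
From mathcomp Require Import all_boot all_order all_algebra finmap.
From mathcomp Require Import all_classical all_reals all_analysis.
From mathcomp Require Import measurable_realfun.
From mathcomp Require Import ring lra.
Import Order.TTheory GRing.Theory Num.Theory.
Import numFieldNormedType.Exports.

Set Implicit Arguments.
Unset Strict Implicit.
Unset Printing Implicit Defensive.

Local Open Scope classical_set_scope.
Local Open Scope ring_scope.

(** The logarithm of a supercritical branching process in random environment
    that never dies out is the random walk of its log-means, up to an error
    that stays bounded in probability:
      [ln Z_n = M_0 + ... + M_(n-1) + O_P(1)]    (lemma [log_Z_tight]).
    The normalisation of [Rstat] multiplies such an error by a quantity that
    tends to zero, so [Rstat] has the same limit as the statistic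
    [walk_stat], in which the two random walks replace [ln Z]; and
    [walk_stat] is a sum of independent centred variables
    [a_k * (M_(1,k) - mu_1) - b_k * (M_(2,k) - mu_2)] of total variance one,
    for which a central limit theorem holds (lemma [walk_clt]).

    Central limit theorem. Lindeberg's replacement is carried out against
    test functions that have a Taylor expansion with remainder of order
    [min (h^2, |h|^3)]. Averaging against a Gaussian preserves this class,
    with the same constants, so the Gaussians that have been substituted are
    absorbed in the test function, and no Gaussian variable has to be adjoined
    to the probability space. A cubic spline serves as smooth step, which
    gives a bound on the distance of distribution functions
    ([lindeberg_cdf]). The standing assumption on the correlation says exactly
    that the variance of the row is at least a multiple of [1/n + 1/m]
    ([row_variance_ge]), so all the coefficients are uniformly small.

    Upper tail of the error. The mean of [Z_n] divided by the product of the
    environment means is one, and Markov's inequality applies.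

    Lower tail of the error. Only a [Z log Z] moment is available, so second
    moments are recovered by truncation: from a generation [k] on, litters are
    cut at sizes [a_i] growing geometrically, at a rate [b] so small that
    [b * r < 1], where [r < 1] is the expected inverse of the conditional
    mean of a litter cut at two. The truncated process divided by its conditional
    mean given the environments has variance of order [E (1 / Z_k)], uniformly
    in time ([Ztrunc_small]), and this is small for large [k] because the
    population grows ([integral_inv_Z_small]). The truncation
    multiplies the product of the means by at least one minus the total loss,
    whose expectation is at most a multiple of
    [E (X / m) (1 + ln X) 1{X > A}]: this is where the [Z log Z] moment enters
    ([total_loss_small]).

    All the moments are computed with the same two tools: distinct generations
    are independent under the annealed law ([past_present_integralM]), and
    inside one generation the quenched law turns functions of the offspring
    variables into functions of the environment ([quenched_mean]). *)

(** * Independence of sub-sigma-algebras *)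

Section SubSigmaAlgebras.
Context {d : measure_display} {T : measurableType d} {R : realType}.
Variable P : probability T R.

(** Measurability for the sub-sigma-algebra generated by [G], through the type
    that carries it. *)
Definition mfun_of (G : set (set T)) {d'} {S : measurableType d'} (f : T -> S) :=
  measurable_fun (setT : set (g_sigma_algebraType G)) (f : g_sigma_algebraType G -> S).

Lemma mfun_of_measurable (G : set (set T)) d' (S : measurableType d') (f : T -> S) :
  G `<=` measurable -> mfun_of G f -> measurable_fun setT f.
Proof.
move=> Gm mf _ B mB; have := mf measurableT B mB; rewrite !setTI /measurable/=.
by apply: smallest_sub => //; exact: sigma_algebra_measurable.
Qed.

Lemma mfun_of_le (G H : set (set T)) d' (S : measurableType d') (f : T -> S) :
  G `<=` <<s H >> -> mfun_of G f -> mfun_of H f.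
Proof.
move=> GH mf _ B mB; have := mf measurableT B mB; rewrite !setTI /measurable/=.
apply: smallest_sub => //; exact: smallest_sigma_algebra.
Qed.

Section Independence.
Variables A C : set (set T).
Hypotheses (AI : setI_closed A) (CI : setI_closed C).
Hypotheses (AT : A setT) (CT : C setT).
Hypotheses (Am : A `<=` measurable) (Cm : C `<=` measurable).
Hypothesis indep : forall a c, A a -> C c -> (P (a `&` c) = P a * P c)%E.

Let one_side (G : set (set T)) (GI : setI_closed G) (GT : G setT)
    (Gm : G `<=` measurable) (c : set T) (mc : measurable c) :
  (forall a, G a -> (P (a `&` c) = P a * P c)%E) ->
  forall a, <<s G >> a -> (P (a `&` c) = P a * P c)%E.
Proof.
move=> h a sa.
pose k : {nonneg R} := NngNum (fine_ge0 (measure_ge0 P c)).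
have E b : mscale k P b = (P b * P c)%E.
  by rewrite /mscale/= muleC fineK// fin_num_measure.
rewrite -E; apply: (@g_sigma_algebra_measure_unique _ _ _ G Gm (fun=> setT) _ _
  (mrestr P mc) (mscale k P)) => //.
- by rewrite bigcup_const//; exists 0%N.
- by move=> b Gb /=; rewrite E -h.
- move=> _ /=; rewrite /mrestr setTI.
  by rewrite (le_lt_trans (probability_le1 _ _))// ltry.
Qed.

Lemma indep_sigma a c : <<s A >> a -> <<s C >> c -> (P (a `&` c) = P a * P c)%E.
Proof.
have sm (G : set (set T)) : G `<=` measurable -> <<s G >> `<=` measurable.
  by move=> Gm; apply: smallest_sub => //; exact: sigma_algebra_measurable.
move=> sa; move: a sa c => a sa c sc.
rewrite setIC muleC; move: c sc; apply: one_side => //; first exact: (sm _ Am).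
move=> c Cc; rewrite setIC muleC; move: a sa; apply: one_side => //.
  exact: Cm.
by move=> a Aa; exact: indep.
Qed.

Let TA : measurableType _ := g_sigma_algebraType A.
Let TC : measurableType _ := g_sigma_algebraType C.
Let idA : T -> TA := id.
Let idC : T -> TC := id.
Let id_meas (G : set (set T)) (Gm : G `<=` measurable) :
  measurable_fun setT (id : T -> g_sigma_algebraType G).
Proof.
move=> _ B mB; rewrite setTI /=; move: B mB; apply: smallest_sub => //.
exact: sigma_algebra_measurable.
Qed.

(** The joint law of the identity maps to the two sub-sigma-algebras is a
    product measure, so Tonelli's theorem splits the integral. *)
Lemma indep_integralM (Y H : T -> R) :
  mfun_of A Y -> mfun_of C H -> (forall w, 0 <= Y w) -> (forall w, 0 <= H w) ->
  (\int[P]_w (Y w * H w)%:E = \int[P]_w (Y w)%:E * \int[P]_w (H w)%:E)%E.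
Proof.
move=> mY mH Y0 H0.
have mA : measurable_fun setT idA := id_meas Am.
have mC : measurable_fun setT idC := id_meas Cm.
pose PA : {RV P >-> TA} := HB.pack idA (isMeasurableFun.Build _ _ _ _ idA mA).
pose PC : {RV P >-> TC} := HB.pack idC (isMeasurableFun.Build _ _ _ _ idC mC).
pose J := fun w => (PA w, PC w).
have mJ : measurable_fun setT J by apply: measurable_fun_pair.
pose PJ : {RV P >-> (TA * TC)%type} :=
  HB.pack J (isMeasurableFun.Build _ _ _ _ J mJ).
have prodE X : measurable X -> (distribution P PA \x distribution P PC)%E X = distribution P PJ X.
  apply: product_measure_unique => U V mU mV.
  by rewrite /distribution /pushforward /= -indep_sigma.
pose F (z : (TA * TC)%type) := (Y z.1 * H z.2)%:E.
have mF : measurable_fun setT F.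
  apply/measurable_EFinP; apply: measurable_funM.
    exact: (measurableT_comp mY measurable_fst).
  exact: (measurableT_comp mH measurable_snd).
have F0 z : (0 <= F z)%E by rewrite lee_fin mulr_ge0.
transitivity (\int[distribution P PJ]_z F z)%E.
  by rewrite ge0_integral_distribution.
transitivity (\int[distribution P PA \x distribution P PC]_z F z)%E.
  by apply: eq_measure_integral => X mX _; exact/esym/prodE.
rewrite fubini_tonelli1//= /fubini_F /F /=.
transitivity (\int[distribution P PA]_x ((Y x)%:E * \int[P]_w (H w)%:E))%E.
  apply: eq_integral => x _; under eq_integral do rewrite EFinM.
  rewrite ge0_integralZl//; last by rewrite lee_fin.
  - congr (_ * _)%E; rewrite (@ge0_integral_distribution _ _ _ _ _ P PC (fun y => (H y)%:E))//.
    exact/measurable_EFinP.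
  - exact/measurable_EFinP.
  - by move=> y _; rewrite lee_fin.
rewrite ge0_integralZr//.
- congr (_ * _)%E; rewrite (@ge0_integral_distribution _ _ _ _ _ P PA (fun y => (Y y)%:E))//.
  exact/measurable_EFinP.
- exact/measurable_EFinP.
- by move=> y _; rewrite lee_fin.
- by apply: integral_ge0 => w _; rewrite lee_fin.
Qed.

End Independence.
End SubSigmaAlgebras.

Section WeightedIntegrals.
Context {d d' : measure_display} {T : measurableType d} {S : measurableType d'}
  {R : realType}.
Variable mu : {measure set T -> \bar R}.
Import HBNNSimple.

(** A conditional expectation is given by its integrals over events; simple
    functions extend it to integrals against weights. *)
Lemma ge0_integral_weight (phi : T -> S) (f1 f2 : T -> \bar R) (g : S -> \bar R) :
  measurable_fun setT phi -> measurable_fun setT f1 -> measurable_fun setT f2 ->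
  measurable_fun setT g ->
  (forall w, 0 <= f1 w)%E -> (forall w, 0 <= f2 w)%E -> (forall x, 0 <= g x)%E ->
  (forall B, measurable B ->
    \int[mu]_(w in phi @^-1` B) f1 w = \int[mu]_(w in phi @^-1` B) f2 w)%E ->
  (\int[mu]_w (g (phi w) * f1 w) = \int[mu]_w (g (phi w) * f2 w))%E.
Proof.
move=> mphi mf1 mf2 mg f10 f20 g0 f12.
pose g_ := nnsfun_approx measurableT mg.
have mg_ n f : measurable_fun setT f ->
    measurable_fun setT (fun w => (g_ n (phi w))%:E * f w)%E.
  move=> mf; apply: emeasurable_funM => //.
  apply/measurable_EFinP; exact: (measurableT_comp (measurable_funP (g_ n)) mphi).
have lim f : measurable_fun setT f -> (forall w, 0 <= f w)%E ->
  (\int[mu]_w (g (phi w) * f w) =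
    limn (fun n => \int[mu]_w ((g_ n (phi w))%:E * f w)))%E.
  move=> mf f0; rewrite -monotone_convergence//.
  - apply: eq_integral => x _.
    have gx : (g_ n (phi x))%:E @[n --> \oo] --> g (phi x).
      exact: cvg_nnsfun_approx.
    have nd : nondecreasing_seq (fun n => (g_ n (phi x))%:E * f x)%E.
      move=> a b ab; rewrite lee_wpmul2r// lee_fin.
      exact/lefP/nd_nnsfun_approx.
    apply/esym/cvg_lim => //.
    have [f_fin|] := boolP (f x \is a fin_num).
      by apply: cvgeZr.
    rewrite ge0_fin_numE// -leNgt leye_eq => /eqP ->.
    have [g0x|g0x] := eqVneq (g (phi x)) 0%E.
      rewrite g0x mul0e; apply: cvg_near_cst; apply: nearW => n.
      have : ((g_ n (phi x))%:E <= 0)%E.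
        rewrite -g0x nnsfun_approxE; exact: le_approx.
      rewrite lee_fin => h; have -> : g_ n (phi x) = 0.
        by apply/eqP; rewrite eq_le h fun_ge0.
      by rewrite mul0e.
    have gp : (0 < g (phi x))%E by rewrite lt_neqAle eq_sym g0x g0.
    rewrite gt0_muley//.
    apply: cvg_near_cst.
    have : \forall n \near \oo, (0 < (g_ n (phi x))%:E)%E.
      have := gx [set y | (0 < y)%E]; apply; apply: open_nbhs_nbhs; split => //.
      exact: open_ereal_gt_ereal.
    apply: filterS => n gn; by rewrite gt0_muley.
  - by move=> n; exact: mg_.
  - by move=> n w _; rewrite mule_ge0// lee_fin.
  - move=> w _ a b ab; rewrite lee_wpmul2r// lee_fin.
    exact/lefP/nd_nnsfun_approx.
have step n f : measurable_fun setT f -> (forall w, 0 <= f w)%E ->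
  (\int[mu]_w ((g_ n (phi w))%:E * f w) = \sum_(r \in range (g_ n))
    (r%:E * \int[mu]_(w in phi @^-1` (g_ n @^-1` [set r])) f w))%E.
  move=> mf f0.
  have mpre r : measurable (phi @^-1` (g_ n @^-1` [set r])).
    rewrite -[X in measurable X]setTI; apply: mphi => //.
  transitivity (\int[mu]_w (\sum_(r \in range (g_ n))
      (r%:E * (f \_ (phi @^-1` (g_ n @^-1` [set r]))) w)))%E.
    apply: eq_integral => w _.
    rewrite (fsbigD1 (g_ n (phi w)))//=; last by exists (phi w).
    rewrite patchE/= mem_set//= fsbig1 ?adde0//.
    move=> r [_ /= nr]; rewrite patchE memNset ?mule0//=.
    by move=> h; apply: nr; rewrite -h.
  rewrite ge0_integral_fsum//.
  - apply: eq_fsbigr => r; rewrite inE => -[x _ <-].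
    rewrite ge0_integralZl//; first by rewrite -integral_mkcond.
    + apply/(measurable_restrictT f (mpre _)).1; exact: measurable_funTS.
    + by move=> w _; exact: erestrict_ge0.
    + by rewrite lee_fin.
  - move=> r; apply: emeasurable_funM => //.
    apply/(measurable_restrictT f (mpre r)).1; exact: measurable_funTS.
  - move=> r w _; have [r0|r0] := leP 0 r.
      rewrite mule_ge0//; exact: erestrict_ge0.
    rewrite patchE memNset ?mule0//= => h.
    have : 0 <= g_ n (phi w) by exact: fun_ge0.
    by rewrite h leNgt r0.
rewrite !lim//; congr (limn _); apply/funext => n; rewrite !step//.
by apply: eq_fsbigr => r _; rewrite f12.
Qed.
End WeightedIntegrals.

(** * Gaussian moments and convolution *)

Section GaussianMoments.
Context {R : realType}.
Notation mu := (@lebesgue_measure R).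
Variable s : R.
Hypothesis s_gt0 : 0 < s.

Let s_neq0 : s != 0. Proof. by rewrite gt_eqF. Qed.
Notation phi := (normal_pdf 0 s).

Lemma normal_pdf_tilt (t y : R) :
  expR (t * y) * phi y = expR (t ^+ 2 * s ^+ 2 / 2) * normal_pdf (t * s ^+ 2) s y.
Proof.
rewrite !normal_pdfE//= /normal_fun !(mulrCA _ (normal_peak s)) -!expRD.
congr (_ * expR _).
by field.
Qed.

Lemma normal_pdf0N (y : R) : phi (- y) = phi y.
Proof. by rewrite !normal_pdfE//= /normal_fun !subr0 sqrrN. Qed.

Let tilt_integral (t : R) :
  (\int[mu]_y (expR (t * y) * phi y)%:E = (expR (t ^+ 2 * s ^+ 2 / 2))%:E)%E.
Proof.
under eq_integral do rewrite normal_pdf_tilt EFinM.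
rewrite ge0_integralZl//.
- by rewrite integral_normal_pdf mule1.
- by apply/measurable_EFinP; exact: measurable_normal_pdf.
- by move=> x _; rewrite lee_fin normal_pdf_ge0.
Qed.

Lemma cube_le_exp (z : R) : `|z| ^+ 3 <= 6 * (expR z + expR (- z)).
Proof.
have h (x : R) : 0 <= x -> x ^+ 3 <= 6 * expR x.
  by move=> /(expR_ge1Dxn 2); rewrite (_ : 3`!%:R = 6 :> R)//; lra.
have [z0|z0] := leP 0 z.
  by rewrite ger0_norm// (le_trans (h _ z0))// ler_pM2l// lerDl expR_ge0.
rewrite ltr0_norm//; apply: (le_trans (h (- z) _)); first by rewrite oppr_ge0 ltW.
by rewrite ler_pM2l// lerDr expR_ge0.
Qed.

(** Exponential tilting at [1 / s] and [- 1 / s] turns the third absolute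
    moment into the total masses of two shifted Gaussians, hence this constant
    rather than the exact one. *)
Definition normal_cube_bound : R := 12 * expR (1 / 2).

Let measurable_abs3 : measurable_fun setT (fun y : R => `|y| ^+ 3).
Proof. by apply: measurable_funX; exact: normr_measurable. Qed.

Let measurable_phi : measurable_fun setT phi.
Proof. exact: measurable_normal_pdf. Qed.

Lemma normal_abs3 :
  (\int[mu]_y (`|y| ^+ 3 * phi y)%:E <= (normal_cube_bound * s ^+ 3)%:E)%E.
Proof.
pose c := 6 * s ^+ 3.
have c0 : 0 <= c by rewrite mulr_ge0// exprn_ge0// ltW.
have mexp (t : R) : measurable_fun setT (fun y => (expR (t * y) * phi y)%:E).
  apply/measurable_EFinP; apply: measurable_funM; last exact: measurable_normal_pdf.
  by apply: measurableT_comp => //; exact: measurable_funM.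
have m2 : measurable_fun [set: R] (fun y =>
    ((expR (s^-1 * y) * phi y)%:E + (expR (- s^-1 * y) * phi y)%:E)%E).
  exact: emeasurable_funD.
have m3 : measurable_fun [set: R] (fun y => (c%:E * ((expR (s^-1 * y) * phi y)%:E
                   + (expR (- s^-1 * y) * phi y)%:E))%E).
  exact: measurable_funeM.
have e0 (t y : R) : 0 <= expR (t * y) * phi y.
  by rewrite mulr_ge0 ?expR_ge0 ?normal_pdf_ge0.
apply: (@le_trans _ _ (\int[mu]_y (c%:E * ((expR (s^-1 * y) * phi y)%:E
                   + (expR (- s^-1 * y) * phi y)%:E)))%E).
  apply: ge0_le_integral => //.
  - by move=> y _; rewrite lee_fin mulr_ge0 ?exprn_ge0 ?normal_pdf_ge0.
  - apply/measurable_EFinP; exact: measurable_funM.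
  - move=> y _; rewrite -EFinD -EFinM lee_fin -mulrDl mulrA ler_wpM2r ?normal_pdf_ge0//.
    have := cube_le_exp (s^-1 * y).
    rewrite normrM exprMn mulNr gtr0_norm ?invr_gt0// => h.
    rewrite /c; have -> : `|y| ^+ 3 = s ^+ 3 * (s^-1 ^+ 3 * `|y| ^+ 3) by field.
    by rewrite (mulrC 6 (s ^+ 3)) -[leRHS]mulrA ler_pM2l ?exprn_gt0.
rewrite ge0_integralZl//=.
- rewrite ge0_integralD//=; [|by move=> y _; rewrite lee_fin|exact: mexp
    |by move=> y _; rewrite lee_fin|exact: mexp].
  rewrite !tilt_integral -EFinD -EFinM lee_fin /c /normal_cube_bound.
  rewrite sqrrN exprVn mulVf ?expf_neq0//; lra.
- by move=> y _; rewrite adde_ge0 ?lee_fin.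
Qed.

Lemma integrable_poly_normal (f : R -> R) (c : R) : measurable_fun setT f ->
  (forall y, `|f y| <= c * (1 + `|y| ^+ 3)) ->
  mu.-integrable setT (fun y => (f y * phi y)%:E).
Proof.
move=> mf fc.
have mphi : measurable_fun setT phi := @measurable_normal_pdf _ _ _.
have i1 : mu.-integrable setT (fun y => (phi y)%:E) by exact: integrable_normal_pdf.
have i3 : mu.-integrable setT (fun y => (`|y| ^+ 3 * phi y)%:E).
  apply/integrableP; split.
    apply/measurable_EFinP; apply: measurable_funM => //.
  rewrite (le_lt_trans _ (ltry (normal_cube_bound * s ^+ 3)))//.
  rewrite (le_trans _ normal_abs3)//; apply: ge0_le_integral => //.
  - apply: measurableT_comp => //; apply/measurable_EFinP; apply: measurable_funM => //.
  - apply/measurable_EFinP; apply: measurable_funM => //.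
  - by move=> y _; rewrite /= ger0_norm// mulr_ge0 ?exprn_ge0 ?normal_pdf_ge0.
have ig := integrableZl measurableT c (integrableD measurableT i1 i3).
apply: (le_integrable measurableT _ _ ig).
- by apply/measurable_EFinP; apply: measurable_funM.
- move=> y _; rewrite -EFinD -EFinM lee_fin.
  rewrite [leLHS]normrM (ger0_norm (normal_pdf_ge0 0 s y)).
  have -> : c * (phi y + `|y| ^+ 3 * phi y) = c * (1 + `|y| ^+ 3) * phi y by ring.
  rewrite (le_trans _ (ler_norm _))// ler_wpM2r ?normal_pdf_ge0//.
Qed.

End GaussianMoments.

Section GaussianConvolution.
Context {R : realType}.
Notation mu := (@lebesgue_measure R).

Lemma lebesgue_integral_shift (h : R -> R) (a : R) :
  continuous h -> (forall y, 0 <= h y) ->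
  (\int[mu]_y (h (y + a))%:E = \int[mu]_y (h y)%:E)%E.
Proof.
move=> ch h0.
have dF (x : R) : is_derive x (1:R) (fun y : R => y + a) 1.
  by apply: is_derive_eq; rewrite addr0.
have F' : derive1 (fun y : R => y + a) = cst 1.
  by apply/funext => x; rewrite derive1E derive_val.
rewrite (@increasing_ge0_integration_by_substitutionT _ (fun y => y + a) h)//.
- by apply: eq_integral => x _; rewrite F' /= mulr1.
- by move=> x y; rewrite ltrD2r.
- by rewrite F' => x; exact: cvg_cst.
- by rewrite F'; exact: is_cvg_cst.
- by rewrite F'; exact: is_cvg_cst.
- exact: cvg_addrr_Ny.
- exact: cvg_addrr.
Qed.

Section FixedScale.
Variable s : R.
Hypothesis s_gt0 : 0 < s.
Let s_neq0 : s != 0. Proof. by rewrite gt_eqF. Qed.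
Notation phi := (normal_pdf 0 s).

Let measurable_phi : measurable_fun setT phi.
Proof. exact: measurable_normal_pdf. Qed.

Lemma normal_mean1 : \int[mu]_y (y * phi y) = 0.
Proof.
have i1 : mu.-integrable setT (fun y => (y * phi y)%:E).
  apply: (@integrable_poly_normal _ s s_gt0 id 1) => // y; rewrite mul1r.
  have [h|h] := leP `|y| 1; first by rewrite (le_trans h)// lerDl exprn_ge0.
  have := @ler_eXnr _ `|y| 3 isT (ltW h); lra.
have mN : measurable_fun setT (-%R : R -> R) by exact: oppr_measurable.
have : (\int[mu]_y (y * phi y)%:E = \int[mu]_y ((- y) * phi y)%:E)%E.
  transitivity (\int[pushforward mu (-%R : R -> measurableTypeR R)]_y (y * phi y)%:E)%E.
    by apply: eq_measure_integral => A mA _; exact/esym/lebesgue_measureN.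
  rewrite integral_pushforward.
  - by apply: eq_integral => y _; rewrite /= normal_pdf0N.
  - exact: mN.
  - exact: measurable_int i1.
  - rewrite preimage_setT /comp/=; under eq_fun do rewrite normal_pdf0N// mulNr EFinN.
    exact: (integrableN i1).
  - exact: measurableT.
under [RHS]eq_integral do rewrite mulNr -mulN1r EFinM.
rewrite integralZl// /Rintegral.
have /fineK <- := integrable_fin_num measurableT i1.
rewrite -EFinM => -[]; lra.
Qed.

Let phiE (y : R) : phi y = normal_peak s * expR (- y ^+ 2 / (s ^+ 2 *+ 2)).
Proof. by rewrite normal_pdfE//= /normal_fun subr0. Qed.

Let H (y : R) : R := s ^+ 2 * (y * phi y).
Let h (y : R) : R := (s ^+ 2 - y ^+ 2) * phi y.

Let dH (y : R) : is_derive y (1:R) H (h y).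
Proof.
have d1 : is_derive y (1:R) (fun y : R => y ^+ 2) (2 * y).
  apply: (@is_derive_eq _ _ _ (fun y : R => y ^+ 2)).
  by rewrite /GRing.scale/= mulr1; ring.
pose k := - (s ^+ 2 *+ 2)^-1.
have d2 : is_derive y (1:R) (fun y : R => k * y ^+ 2) (k * (2 * y)).
  exact: (@is_deriveZ _ _ _ (fun y : R => y ^+ 2) k y 1 _ d1).
have d3 := @is_derive1_comp _ expR (fun y => k * y ^+ 2) y _ _
  (is_derive_expR _) d2.
have d4 := @is_deriveM _ _ _ _ _ _ _ _ (is_derive_id y 1) d3.
have d5 := @is_deriveZ _ _ _ _ (s ^+ 2 * normal_peak s) _ _ _ d4.
have -> : H = (s ^+ 2 * normal_peak s) \*: (id * (expR \o (fun y => k * y ^+ 2))).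
  apply/funext => z; rewrite /H phiE /= /k /GRing.scale/=.
  rewrite -[RHS]mulrA; congr (_ * _).
  rewrite [RHS]mulrCA; congr (_ * (_ * expR _)).
  by rewrite mulrC mulNr mulrN.
apply: (is_derive_eq d5).
rewrite /h phiE /GRing.scale/= /k.
have -> : - (s ^+ 2 *+ 2)^-1 * y ^+ 2 = - y ^+ 2 / (s ^+ 2 *+ 2).
  by rewrite mulNr mulNr mulrC.
by field.
Qed.

Let cphi : continuous phi. Proof. exact: continuous_normal_pdf. Qed.

Let cy2 : continuous (fun y : R => y ^+ 2).
Proof. by move=> y; exact: exprn_continuous. Qed.

Let ch : continuous h.
Proof.
move=> y; apply: cvgM; last exact: cphi.
by apply: cvgB; [exact: cvg_cst|exact: cy2].
Qed.

Let cH : continuous H.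
Proof.
move=> y; apply: cvgM; first exact: cvg_cst.
by apply: cvgM; [exact: cvg_id|exact: cphi].
Qed.

Let vanish : H y @[y --> +oo] --> (0 : R).
Proof.
apply/cvgrPdist_le => e e0.
pose K := s ^+ 2 * normal_peak s * (s ^+ 2 *+ 2).
have K0 : 0 <= K.
  have p0 := normal_peak_ge0 s; have q0 := sqr_ge0 s.
  by apply: mulr_ge0; [exact: mulr_ge0|rewrite mulrn_wge0].
have Ke : K / e \is Num.real by exact: num_real.
near=> y.
have y0 : 0 < y by near: y; apply: nbhs_pinfty_gt; exact: num_real.
have yK : K / e < y by near: y; exact: nbhs_pinfty_gt.
rewrite sub0r normrN ger0_norm; last first.
  by rewrite /H !mulr_ge0 ?sqr_ge0 ?normal_pdf_ge0// ltW.
pose z := y ^+ 2 / (s ^+ 2 *+ 2).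
have z0 : 0 < z by rewrite divr_gt0 ?exprn_gt0// mulrn_wgt0// exprn_gt0.
have ez : expR (- z) <= z^-1.
  rewrite expRN lef_pV2 ?posrE ?expR_gt0//.
  by rewrite (le_trans _ (expR_ge1Dx z))// lerDr.
have -> : H y = s ^+ 2 * normal_peak s * (y * expR (- z)).
  by rewrite /H phiE /z mulNr; ring.
apply: (@le_trans _ _ (s ^+ 2 * normal_peak s * (y * z^-1))).
  apply: ler_wpM2l; last by rewrite ler_pM2l.
  by apply: mulr_ge0; [exact: sqr_ge0|exact: normal_peak_ge0].
have -> : s ^+ 2 * normal_peak s * (y * z^-1) = K / y.
  by rewrite /z /K; field; rewrite s_neq0 gt_eqF.
by rewrite ler_pdivrMr// mulrC -ler_pdivrMr// ltW.
Unshelve. all: by end_near. Qed.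

Let y2bound (y : R) : y ^+ 2 <= 1 + `|y| ^+ 3.
Proof.
rewrite -real_normK ?num_real//.
have [y1|y1] := leP `|y| 1.
  have : `|y| ^+ 2 <= 1 by rewrite exprn_ile1.
  have : 0 <= `|y| ^+ 3 by rewrite exprn_ge0.
  lra.
have : `|y| ^+ 2 <= `|y| ^+ 3 by rewrite ler_eXn2l ?ltW.
lra.
Qed.

Let i2 : mu.-integrable setT (fun y => (y ^+ 2 * phi y)%:E).
Proof.
apply: (@integrable_poly_normal _ s s_gt0 (fun y => y ^+ 2) 1).
  exact: measurable_funX.
by move=> y; rewrite mul1r ger0_norm ?sqr_ge0.
Qed.

Let i0 : mu.-integrable setT (fun y => (phi y)%:E).
Proof. exact: integrable_normal_pdf. Qed.

(** On the half line the antiderivative [H] vanishes at both ends. The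
    integrand changes sign at [s], and the fundamental theorem on an unbounded
    interval asks for a constant sign, so the interval is cut there. *)
Let half_line : \int[mu]_(y in `[0, +oo[) h y = 0.
Proof.
have Hd y : derivable H y 1 by have [] := dH y.
have H' y : derive1 H y = h y by rewrite derive1E; have [] := dH y.
have ih : mu.-integrable setT (EFin \o h).
  have := integrableB measurableT (integrableZl measurableT (s ^+ 2) i0) i2.
  apply: eq_integrable => // y _ /=; rewrite -EFinM -EFinB /h.
  by congr EFin; ring.
have ihS A : measurable A -> mu.-integrable A (EFin \o h).
  by move=> mA; apply: integrableS ih.
have seg : (\int[mu]_(y in `[0%R, s]) (h y)%:E = (H s)%:E - (H 0)%:E)%E.
  apply: continuous_FTC2 => //.
  - exact: continuous_subspaceT.
  - split => [y _//||].
      by apply: cvg_at_right_filter; exact: cH.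
    by apply: cvg_at_left_filter; exact: cH.
have tail : (\int[mu]_(y in `[s, +oo[) (h y)%:E = 0%:E - (H s)%:E)%E.
  apply: le0_continuous_FTC2y => //.
  - move=> y sy; rewrite /h mulr_le0_ge0 ?normal_pdf_ge0// subr_le0.
    by rewrite lerXn2r ?nnegrE// ?(le_trans (ltW s_gt0))// ltW.
  - exact: continuous_subspaceT.
  - by apply: cvg_at_right_filter; exact: cH.
have mh := measurable_int mu (ihS `]s, +oo[%classic (measurable_itv _)).
have -> : `[0, +oo[%classic = `[0, s] `|` `]s, +oo[ :> set R.
  by apply: itv_bndbnd_setU => //=; rewrite bnd_simp ltW.
rewrite Rintegral_setU//.
- rewrite /Rintegral seg integral_itv_obnd_cbnd ?tail /H ?mul0r ?mulr0 /=.
    by ring.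
  exact: mh.
- exact/ihS/measurableU.
- apply/disj_setPS => y [/=]; rewrite !in_itv/= andbT => /andP[_ ys] sy.
  by move: (le_lt_trans ys sy); rewrite ltxx.
Qed.

Lemma normal_mean2 : \int[mu]_y (y ^+ 2 * phi y) = s ^+ 2.
Proof.
have m0 : measurable `[0 : R, +oo[%classic by exact: measurable_itv.
have i0' : mu.-integrable `[0 : R, +oo[ (fun y => (phi y)%:E).
  by apply: integrableS i0.
have i2' : mu.-integrable `[0 : R, +oo[ (fun y => (y ^+ 2 * phi y)%:E).
  by apply: integrableS i2.
pose A := \int[mu]_(y in `[0, +oo[) (y ^+ 2 * phi y).
pose B := \int[mu]_(y in `[0, +oo[) phi y.
have : \int[mu]_(y in `[0, +oo[) h y = s ^+ 2 * B - A.
  rewrite -RintegralZl// -RintegralB//.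
    by apply: eq_Rintegral => y _; rewrite /h; ring.
  by apply: (integrableZl _ (s ^+ 2) i0').
rewrite half_line => AB.
have setE : [set x : R | 0 <= x] = `[0 : R, +oo[%classic by rewrite set_itvcy.
have : (1 = 2%:E * B%:E)%E.
  rewrite -[LHS](@integral_normal_pdf R 0 s) ge0_symfun_integralT//.
  - by rewrite setE /B /Rintegral fineK// (integrable_fin_num _ i0').
  - by move=> y; exact: normal_pdf_ge0.
  - by move=> y /=; rewrite normal_pdf0N.
rewrite -EFinM => -[B2].
rewrite /Rintegral ge0_symfun_integralT//.
- rewrite setE; have -> : (\int[mu]_(x in `[0%R, +oo[) (x ^+ 2 * phi x)%:E = A%:E)%E.
    by rewrite /A /Rintegral fineK// (integrable_fin_num _ i2').
  rewrite -EFinM /=; nra.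
- by move=> y; rewrite mulr_ge0 ?sqr_ge0 ?normal_pdf_ge0.
- by move=> y; apply: cvgM; [exact: cy2|exact: cphi].
- by move=> y /=; rewrite normal_pdf0N// sqrrN.
Qed.

End FixedScale.

(** Completing the square: the Gaussian kernel of a sum factors into its
    marginal and a Gaussian conditional density. *)
Lemma normal_pdf_conv (s t r w y : R) : 0 < s -> 0 < t -> 0 < r ->
  r ^+ 2 = s ^+ 2 + t ^+ 2 ->
  normal_pdf 0 t (w - y) * normal_pdf 0 s y =
  normal_pdf 0 r w * normal_pdf (w * (s ^+ 2 / r ^+ 2)) (s * t / r) y.
Proof.
move=> s0 t0 r0 rst.
have u0 : 0 < s * t / r by rewrite divr_gt0// mulr_gt0.
have peakE (a : R) : 0 < a -> normal_peak a = (a * Num.sqrt (pi *+ 2))^-1.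
  by move=> a0; rewrite /normal_peak -mulrnAr sqrtrM ?sqr_ge0// sqrtr_sqr gtr0_norm.
rewrite !normal_pdfE ?gt_eqF//= /normal_fun.
rewrite mulrACA [RHS]mulrACA -!expRD !peakE//; congr (_ * expR _).
  rewrite -!invfM; congr (_^-1).
  by field; rewrite gt_eqF.
have rne : r != 0 by rewrite gt_eqF.
have tr : t ^+ 2 = r ^+ 2 - s ^+ 2 by rewrite rst; ring.
have tne : r ^+ 2 - s ^+ 2 != 0 by rewrite -tr expf_neq0// gt_eqF.
rewrite !exprMn exprVn !tr.
by field; rewrite rne tne gt_eqF.
Qed.

(** By Tonelli, one integrates out the conditional density of
    [normal_pdf_conv], which has mass one. *)
Lemma normal_conv (s t r x : R) (f : R -> R) : 0 < s -> 0 < t -> 0 < r ->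
  r ^+ 2 = s ^+ 2 + t ^+ 2 -> continuous f -> (forall y, 0 <= f y) ->
  (\int[mu]_y \int[mu]_z (f (x + y + z) * normal_pdf 0 t z * normal_pdf 0 s y)%:E
    = \int[mu]_w (f (x + w) * normal_pdf 0 r w)%:E)%E.
Proof.
move=> s0 t0 r0 rst cf f0.
have cp (a m : R) : 0 < a -> continuous (normal_pdf m a).
  by move=> a0; apply: continuous_normal_pdf; rewrite gt_eqF.
transitivity (\int[mu]_y \int[mu]_w
   (f (x + w) * (normal_pdf 0 t (w - y) * normal_pdf 0 s y))%:E)%E.
  apply: eq_integral => y _.
  rewrite -[RHS](@lebesgue_integral_shift _ y).
  - apply: eq_integral => z _; rewrite addrK -mulrA; congr (f _ * _)%:E; ring.
  - move=> z; apply: cvgM.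
      apply: (@continuous_comp _ _ _ (fun z => x + z) f); last exact: cf.
      by apply: cvgD; [exact: cvg_cst|exact: cvg_id].
    apply: cvgM; last exact: cvg_cst.
    apply: (@continuous_comp _ _ _ (fun z => z - y) (normal_pdf 0 t)); last exact: cp.
    by apply: cvgB; [exact: cvg_id|exact: cvg_cst].
  - by move=> z; rewrite !mulr_ge0// normal_pdf_ge0.
pose F (z : R * R) := (f (x + z.2) * (normal_pdf 0 t (z.2 - z.1) * normal_pdf 0 s z.1))%:E.
have mF : measurable_fun setT F.
  apply/measurable_EFinP; apply: measurable_funM.
    apply: measurableT_comp; first exact: continuous_measurable_fun.
    by apply: measurable_funD => //.
  apply: measurable_funM; apply: measurableT_comp => //; try exact: measurable_normal_pdf.
  exact: measurable_funB.
transitivity (\int[mu]_y \int[mu]_w F (y, w))%E; first by [].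
rewrite fubini_tonelli//; last first.
  by move=> z; rewrite lee_fin !mulr_ge0// normal_pdf_ge0.
apply: eq_integral => w _; rewrite /F/=.
under eq_integral do rewrite (normal_pdf_conv _ _ s0 t0 r0 rst) (mulrA (f (x + w))) EFinM.
rewrite ge0_integralZl//.
- by rewrite integral_normal_pdf mule1.
- by apply/measurable_EFinP; exact: measurable_normal_pdf.
- by move=> y _; rewrite lee_fin normal_pdf_ge0.
- by rewrite lee_fin mulr_ge0// normal_pdf_ge0.
Qed.

End GaussianConvolution.

(** * Gaussian averaging of test functions *)

Section GaussianAveraging.
Context {R : realType}.
Notation mu := (@lebesgue_measure R).

(** The density [normal_pdf 0 0] is not the Dirac mass that the degenerate
    case calls for. Steps of variance zero do occur: the two walks have
    different lengths. *)
Definition gint (s : R) (g : R -> R) : R :=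
  if s == 0 then g 0 else \int[mu]_y (g y * normal_pdf 0 s y).

Definition cubic_growth (g : R -> R) : Prop :=
  measurable_fun setT g /\ exists c, forall y, `|g y| <= c * (1 + `|y| ^+ 3).

Definition gauss_avg (s : R) (f : R -> R) (x : R) : R :=
  gint s (fun y => f (x + y)).

Lemma cubic_growthD (f g : R -> R) :
  cubic_growth f -> cubic_growth g -> cubic_growth (fun y => f y + g y).
Proof.
move=> [mf [c fc]] [mg [c' gc]]; split; first exact: measurable_funD.
by exists (c + c') => y; rewrite mulrDl (le_trans (ler_normD _ _))// lerD.
Qed.

Lemma cubic_growthZ (a : R) (f : R -> R) :
  cubic_growth f -> cubic_growth (fun y => a * f y).
Proof.
move=> [mf [c fc]]; split; first exact: measurable_funM.
by exists (`|a| * c) => y; rewrite normrM -mulrA ler_wpM2l.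
Qed.

Lemma cubic_growth_abs (f : R -> R) :
  cubic_growth f -> cubic_growth (fun y => `|f y|).
Proof.
move=> [mf [c fc]]; split.
  by apply: measurableT_comp => //; exact: normr_measurable.
by exists c => y; rewrite normr_id.
Qed.

Lemma cubic_growth_bounded (f : R -> R) (b : R) :
  measurable_fun setT f -> (forall y, `|f y| <= b) -> cubic_growth f.
Proof.
move=> mf fb; split => //; exists b => y; rewrite (le_trans (fb y))// ler_peMr//.
  by rewrite (le_trans _ (fb 0)).
by rewrite lerDl exprn_ge0.
Qed.

Lemma cubic_growthX (n : nat) : (n <= 3)%N -> cubic_growth (fun y => y ^+ n).
Proof.
move=> n3; split; first exact: measurable_funX.
exists 1 => y; rewrite mul1r normrX.
have [y1|y1] := leP `|y| 1.
  by rewrite (le_trans (exprn_ile1 n (normr_ge0 y) y1))// lerDl exprn_ge0.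
by rewrite (le_trans (ler_weXn2l (ltW y1) n3))// lerDr.
Qed.

Lemma cubic_growth_cst (c : R) : cubic_growth (fun=> c).
Proof. exact: (@cubic_growth_bounded _ `|c|). Qed.

Section FixedScale.
Variable s : R.
Hypothesis s_ge0 : 0 <= s.

Let s_gt0 : s != 0 -> 0 < s.
Proof. by move=> s0; rewrite lt_neqAle eq_sym s0. Qed.

Let ok_int (g : R -> R) : s != 0 -> cubic_growth g ->
  mu.-integrable setT (fun y => (g y * normal_pdf 0 s y)%:E).
Proof.
by move=> s0 [mg [c gc]]; apply: (integrable_poly_normal (s_gt0 s0) mg gc).
Qed.

Lemma gintD (f g : R -> R) : cubic_growth f -> cubic_growth g ->
  gint s (fun y => f y + g y) = gint s f + gint s g.
Proof.
rewrite /gint; case: eqVneq => // s0 of_ og.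
rewrite -RintegralD//; [|exact: ok_int|exact: ok_int].
by apply: eq_Rintegral => y _; rewrite mulrDl.
Qed.

Lemma gintZ (a : R) (f : R -> R) : cubic_growth f ->
  gint s (fun y => a * f y) = a * gint s f.
Proof.
rewrite /gint; case: eqVneq => // s0 of_.
rewrite -RintegralZl//; last exact: ok_int.
by apply: eq_Rintegral => y _; rewrite mulrA.
Qed.

Lemma le_gint (f g : R -> R) : cubic_growth f -> cubic_growth g ->
  (forall y, f y <= g y) -> gint s f <= gint s g.
Proof.
rewrite /gint; case: eqVneq => // s0 of_ og fg.
apply: le_Rintegral => //; [exact: ok_int|exact: ok_int|].
by move=> y _; rewrite ler_wpM2r// normal_pdf_ge0.
Qed.

Lemma gint_cst (c : R) : gint s (fun=> c) = c.
Proof.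
rewrite /gint; case: eqVneq => // s0.
rewrite RintegralZl//; last exact: integrable_normal_pdf.
by rewrite /Rintegral integral_normal_pdf mulr1.
Qed.

Lemma gint1 : gint s id = 0.
Proof. by rewrite /gint; case: eqVneq => // s0; rewrite normal_mean1// s_gt0. Qed.

Lemma gint2 : gint s (fun y => y ^+ 2) = s ^+ 2.
Proof.
rewrite /gint; case: eqVneq => [->|s0]; first by [].
by rewrite normal_mean2// s_gt0.
Qed.

Lemma gint3 : gint s (fun y => `|y| ^+ 3) <= normal_cube_bound * s ^+ 3.
Proof.
rewrite /gint; case: eqVneq => [->|s0].
  by rewrite normr0 !expr0n/= mulr0.
have s1 := s_gt0 s0; have h := normal_abs3 s1.
rewrite -lee_fin /Rintegral fineK//.
rewrite ge0_fin_numE; first by rewrite (le_lt_trans h)// ltry.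
by apply: integral_ge0 => y _; rewrite lee_fin mulr_ge0 ?exprn_ge0 ?normal_pdf_ge0.
Qed.

Lemma gint_norm (f g : R -> R) : cubic_growth f -> cubic_growth g ->
  (forall y, `|f y| <= g y) -> `|gint s f| <= gint s g.
Proof.
move=> of_ og fg; rewrite ler_norml; apply/andP; split; last first.
  by apply: le_gint => // y; rewrite (le_trans (ler_norm _)).
rewrite -mulN1r -gintZ//; apply: le_gint => //; first exact: cubic_growthZ.
by move=> y; rewrite mulN1r lerNl (le_trans _ (fg y))// -normrN ler_norm.
Qed.

End FixedScale.

Definition lipschitz_by (L : R) (f : R -> R) : Prop :=
  forall x y, `|f x - f y| <= L * `|x - y|.

Lemma lipschitz_continuous (L : R) (f : R -> R) : lipschitz_by L f -> continuous f.
Proof.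
move=> fL x; apply/cvgrPdist_le => e e0.
have d0 : 0 < e / (`|L| + 1) by rewrite divr_gt0// ltr_wpDl.
near=> y; rewrite (le_trans (fL _ _))//.
have xy : `|x - y| <= e / (`|L| + 1).
  by near: y; apply: cvgr_dist_le.
have {xy} : `|x - y| * (`|L| + 1) <= e by rewrite -ler_pdivlMr// ltr_wpDl.
have := ler_norm L; have := normr_ge0 (x - y); nra.
Unshelve. all: by end_near. Qed.

(** Test functions for the replacement argument. The functions [f1] and [f2]
    play the role of the first two derivatives; only these inequalities
    matter, and averaging preserves each of them. *)
Record smooth (C L : R) (f f1 f2 : R -> R) : Prop := Smooth {
  smooth_ge0 : forall x, 0 <= f x;
  smooth_le : forall x, f x <= L;
  smooth1_le : forall x, `|f1 x| <= L;
  smooth2_le : forall x, `|f2 x| <= L;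
  smooth_lip : lipschitz_by L f;
  smooth1_lip : lipschitz_by L f1;
  smooth2_lip : lipschitz_by L f2;
  smooth_taylor : forall x h,
    `|f (x + h) - f x - h * f1 x - h ^+ 2 / 2 * f2 x|
      <= C * Num.min (h ^+ 2) (`|h| ^+ 3) }.

Lemma lipschitz_measurable (L : R) (f : R -> R) :
  lipschitz_by L f -> measurable_fun setT f.
Proof. by move=> /lipschitz_continuous; exact: continuous_measurable_fun. Qed.

Let shift_growth (L : R) (f : R -> R) (x : R) : lipschitz_by L f ->
  (forall y, `|f y| <= L) -> cubic_growth (fun y => f (x + y)).
Proof.
move=> fL fb; apply: (@cubic_growth_bounded _ L) => //.
apply: measurableT_comp; first exact: (lipschitz_measurable fL).
by apply: measurable_funD.
Qed.

Lemma gauss_avg_lip (s L : R) (f : R -> R) : 0 <= s -> lipschitz_by L f ->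
  (forall y, `|f y| <= L) -> lipschitz_by L (gauss_avg s f).
Proof.
move=> s0 fL fb x x'; rewrite /gauss_avg.
have oN := cubic_growthZ (-1) (shift_growth x' fL fb).
rewrite -mulN1r -gintZ//; last exact: shift_growth fL fb.
rewrite -gintD//; last exact: shift_growth fL fb.
rewrite -[leRHS](gint_cst s); apply: gint_norm => //.
- by apply: cubic_growthD => //; exact: shift_growth fL fb.
- exact: cubic_growth_cst.
- move=> y; rewrite mulN1r (le_trans (fL _ _))//.
  by rewrite opprD addrACA subrr addr0.
Qed.

Lemma gauss_avg_norm (s L : R) (f : R -> R) : 0 <= s -> lipschitz_by L f ->
  (forall y, `|f y| <= L) -> forall x, `|gauss_avg s f x| <= L.
Proof.
move=> s0 fL fb x; rewrite -[leRHS](gint_cst s); apply: gint_norm => //.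
- exact: shift_growth fL fb.
- exact: cubic_growth_cst.
Qed.

Lemma smooth_norm C L f f1 f2 : smooth C L f f1 f2 -> forall x, `|f x| <= L.
Proof. by case=> f0 fL *; rewrite ger0_norm. Qed.

(** The constraints are convex and invariant under translation, so averaging
    over translations preserves them. *)
Lemma smooth_gauss_avg (s C L : R) (f f1 f2 : R -> R) : 0 <= s ->
  smooth C L f f1 f2 ->
  smooth C L (gauss_avg s f) (gauss_avg s f1) (gauss_avg s f2).
Proof.
move=> s0 sf; have fN := smooth_norm sf; case: sf => f0 fL f1L f2L lf lf1 lf2 ft.
split; try exact: gauss_avg_lip; try exact: gauss_avg_norm.
- move=> x; rewrite -(gint_cst s 0); apply: le_gint => //.
    exact: cubic_growth_cst.
  exact: shift_growth lf fN.
- by move=> x; rewrite (le_trans (ler_norm _))// gauss_avg_norm.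
- move=> x h; rewrite /gauss_avg.
  have o0 := shift_growth (x + h) lf fN.
  have o1 := cubic_growthZ (-1) (shift_growth x lf fN).
  have o2 := cubic_growthZ (- h) (shift_growth x lf1 f1L).
  have o3 := cubic_growthZ (- (h ^+ 2 / 2)) (shift_growth x lf2 f2L).
  have -> : gint s (fun y => f (x + h + y)) - gint s (fun y => f (x + y))
      - h * gint s (fun y => f1 (x + y)) - h ^+ 2 / 2 * gint s (fun y => f2 (x + y))
      = gint s (fun y => f (x + h + y) + -1 * f (x + y) + - h * f1 (x + y)
          + - (h ^+ 2 / 2) * f2 (x + y)).
    rewrite !gintD//; do ?[by do ?apply: cubic_growthD].
    rewrite (gintZ s0 _ (shift_growth x lf fN)) (gintZ s0 _ (shift_growth x lf1 f1L)).
    by rewrite (gintZ s0 _ (shift_growth x lf2 f2L)); ring.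
  rewrite -[leRHS](gint_cst s); apply: gint_norm => //.
    + by do 3! apply: cubic_growthD => //.
    + exact: cubic_growth_cst.
    + move=> y; have := ft (x + y) h; rewrite (addrAC x y h) mulN1r !mulNr.
      by [].
Qed.

(** The first-order term averages to zero, the second-order term to the
    variance, and the third absolute moment bounds the remainder. *)
Lemma gauss_avg_taylor (s C L : R) (f f1 f2 : R -> R) : 0 <= s -> 0 <= C ->
  smooth C L f f1 f2 -> forall x,
  `|gauss_avg s f x - f x - s ^+ 2 / 2 * f2 x| <= C * (normal_cube_bound * s ^+ 3).
Proof.
move=> s0 C0 sf x; have fN := smooth_norm sf.
have [_ _ _ _ lf _ _ ft] := sf.
have o0 := shift_growth x lf fN.
have oc := cubic_growth_cst.
have o1 := cubic_growthZ (- f1 x) (cubic_growthX (n := 1) isT).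
have o2 := cubic_growthZ (- (f2 x / 2)) (cubic_growthX (n := 2) isT).
have o3 : cubic_growth (fun y => `|y| ^+ 3).
  have := cubic_growth_abs (cubic_growthX (n := 3) isT).
  by under eq_fun do rewrite normrX.
have -> : gauss_avg s f x - f x - s ^+ 2 / 2 * f2 x =
    gint s (fun y => f (x + y) + - f x + - f1 x * y ^+ 1 + - (f2 x / 2) * y ^+ 2).
  rewrite !gintD//; do ?[by do ?apply: cubic_growthD].
  rewrite gint_cst// !gintZ//; do ?exact: cubic_growthX.
  by rewrite gint2// /= gint1// /gauss_avg; field.
apply: (@le_trans _ _ (gint s (fun y => C * `|y| ^+ 3))).
  apply: gint_norm => //; [by do 3! apply: cubic_growthD => //|exact: cubic_growthZ|].
  move=> y; apply: le_trans (_ : C * Num.min (y ^+ 2) (`|y| ^+ 3) <= _).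
    apply: le_trans (ft x y); rewrite le_eqVlt; apply/orP; left; apply/eqP; congr `|_|.
    by field.
  by rewrite ler_wpM2l// ge_min lexx orbT.
by rewrite gintZ// ler_wpM2l// gint3.
Qed.

(** Sums of independent Gaussians are Gaussian. *)
Lemma gauss_avg_comp (s t L : R) (f : R -> R) : 0 <= s -> 0 <= t ->
  lipschitz_by L f -> (forall x, 0 <= f x <= L) ->
  gauss_avg s (gauss_avg t f) = gauss_avg (Num.sqrt (s ^+ 2 + t ^+ 2)) f.
Proof.
move=> s0 t0 fL fb; apply/funext => x.
have [->|sn0] := eqVneq s 0.
  rewrite expr0n/= add0r sqrtr_sqr (ger0_norm t0).
  by rewrite {1}/gauss_avg {1}/gint eqxx addr0.
have [->|tn0] := eqVneq t 0.
  rewrite expr0n/= addr0 sqrtr_sqr ger0_norm// /gauss_avg; congr gint.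
  by apply/funext => y; rewrite /gint eqxx addr0.
have sp : 0 < s by rewrite lt_neqAle eq_sym sn0.
have tp : 0 < t by rewrite lt_neqAle eq_sym tn0.
set r := Num.sqrt _.
have rp : 0 < r by rewrite sqrtr_gt0 addr_gt0// exprn_gt0.
have rE : r ^+ 2 = s ^+ 2 + t ^+ 2 by rewrite sqr_sqrtr// addr_ge0// sqr_ge0.
have fL' y : `|f y| <= L by have /andP[? ?] := fb y; rewrite ger0_norm.
rewrite /gauss_avg /gint (gt_eqF sp) (gt_eqF tp) (gt_eqF rp).
congr fine; rewrite -(normal_conv x sp tp rp rE); last 2 first.
- exact: (lipschitz_continuous fL).
- by move=> y; have /andP[] := fb y.
apply: eq_integral => y _.
have i : mu.-integrable setT (fun z => (f (x + y + z) * normal_pdf 0 t z)%:E).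
  have [mg [c gc]] := shift_growth (x + y) fL fL'.
  exact: (integrable_poly_normal tp mg gc).
rewrite EFinM /Rintegral fineK; last exact: (integrable_fin_num _ i).
rewrite muleC -integralZl//.
by apply: eq_integral => z _; rewrite EFinM muleC.
Qed.

End GaussianAveraging.

(** * A cubic spline as smooth step *)

Section CubicSpline.
Context {R : realType}.
Implicit Types t u v h x y : R.

Definition pos_part t : R := Num.max t 0.

Lemma pos_part_ge0 t : 0 <= pos_part t.
Proof. by rewrite /pos_part le_max lexx orbT. Qed.

Lemma pos_part_id t : 0 <= t -> pos_part t = t.
Proof. by move=> t0; apply/max_idPl. Qed.

Lemma pos_part_0 t : t <= 0 -> pos_part t = 0.
Proof. by move=> t0; apply/max_idPr. Qed.

Lemma pos_part_lip t u : `|pos_part t - pos_part u| <= `|t - u|.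
Proof.
have [t0|/ltW t0] := leP 0 t; have [u0|/ltW u0] := leP 0 u;
  rewrite ?(pos_part_id t0) ?(pos_part_0 t0) ?(pos_part_id u0) ?(pos_part_0 u0) //.
- by rewrite subr0 (ger0_norm t0) ger0_norm; lra.
- by rewrite sub0r normrN (ger0_norm u0) ler0_norm; lra.
- by rewrite subrr normr0.
Qed.

(** The third derivative of the cube of the positive part is bounded by six,
    although it jumps at zero. *)
Lemma pos_part_taylor t h :
  `|pos_part (t + h) ^+ 3 - pos_part t ^+ 3 - h * (3 * pos_part t ^+ 2)
    - h ^+ 2 / 2 * (6 * pos_part t)| <= `|h| ^+ 3.
Proof.
have [t0|/ltW t0] := leP 0 t; have [u0|/ltW u0] := leP 0 (t + h);
  rewrite ?(pos_part_id t0) ?(pos_part_0 t0) ?(pos_part_id u0) ?(pos_part_0 u0).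
- rewrite -normrX le_eqVlt; apply/orP; left; apply/eqP; congr `|_|; by field.
- have h0 : h <= 0 by lra.
  rewrite (ler0_norm h0).
  have -> : 0 ^+ 3 - t ^+ 3 - h * (3 * t ^+ 2) - h ^+ 2 / 2 * (6 * t) =
      (- (t + h)) ^+ 3 - (- h) ^+ 3.
    by field.
  have : (- (t + h)) ^+ 3 <= (- h) ^+ 3 by rewrite lerXn2r ?nnegrE; lra.
  have : 0 <= (- (t + h)) ^+ 3 by rewrite exprn_ge0; lra.
  by rewrite ler_norml; lra.
- have h0 : 0 <= h by lra.
  have -> : (t + h) ^+ 3 - 0 ^+ 3 - h * (3 * 0 ^+ 2) - h ^+ 2 / 2 * (6 * 0) =
      (t + h) ^+ 3 by ring.
  rewrite (ger0_norm h0) ger0_norm ?exprn_ge0//.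
  by rewrite lerXn2r ?nnegrE//; lra.
- have -> : 0 ^+ 3 - 0 ^+ 3 - h * (3 * 0 ^+ 2) - h ^+ 2 / 2 * (6 * 0) = 0 by ring.
  by rewrite normr0 exprn_ge0.
Qed.

Definition third_difference (g : R -> R) t : R :=
  g t - 3 * g (t - 1) + 3 * g (t - 2) - g (t - 3).

Definition spline t := third_difference (fun u => pos_part u ^+ 3) t / 6.
Definition spline1 t := third_difference (fun u => pos_part u ^+ 2) t / 2.
Definition spline2 t := third_difference pos_part t.

(** The spline is constant outside [[0, 3]], so bounds that are polynomial in
    the argument only have to be checked after clamping. *)
Definition clamp t : R := Num.min (pos_part t) 3.

Lemma clamp_lip t u : `|clamp t - clamp u| <= `|t - u|.
Proof.
apply: le_trans (pos_part_lip t u); rewrite /clamp.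
move: (pos_part t) (pos_part u) => {}t {}u.
have [t3|/ltW t3] := leP t 3; have [u3|/ltW u3] := leP u 3 => //.
- by rewrite !ler0_norm; lra.
- by rewrite !ger0_norm; lra.
- by rewrite subrr normr0.
Qed.

Lemma clamp_itv t : 0 <= clamp t <= 3.
Proof.
rewrite /clamp; have := pos_part_ge0 t; case: (leP (pos_part t) 3); lra.
Qed.

Lemma spline_left t : t <= 0 ->
  [/\ spline t = 0, spline1 t = 0 & spline2 t = 0].
Proof.
move=> t0; rewrite /spline /spline1 /spline2 /third_difference.
by rewrite !pos_part_0; [split; field|lra..].
Qed.

Lemma spline_right t : 3 <= t ->
  [/\ spline t = 1, spline1 t = 0 & spline2 t = 0].
Proof.
move=> t0; rewrite /spline /spline1 /spline2 /third_difference.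
by rewrite !pos_part_id; [split; field|lra..].
Qed.

Lemma spline_clamp t : [/\ spline t = spline (clamp t),
  spline1 t = spline1 (clamp t) & spline2 t = spline2 (clamp t)].
Proof.
have [t0|t0] := leP t 0.
  have -> : clamp t = 0 by rewrite /clamp pos_part_0//; apply/min_idPl; lra.
  by have [-> -> ->] := spline_left t0; have [-> -> ->] := spline_left (lexx 0).
have [t3|t3] := leP 3 t.
  have -> : clamp t = 3 by rewrite /clamp pos_part_id ?ltW//; apply/min_idPr.
  by have [-> -> ->] := spline_right t3; have [-> -> ->] := spline_right (lexx 3).
by have -> : clamp t = t by rewrite /clamp pos_part_id ?ltW//; apply/min_idPl; lra.
Qed.

Lemma spline_itv t : 0 <= spline t <= 1.
Proof.
have [t0|t0] := leP t 0; first by have [-> _ _] := spline_left t0; lra.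
have [t3|t3] := leP 3 t; first by have [-> _ _] := spline_right t3; lra.
rewrite /spline /third_difference.
have [t1|t1] := leP t 1.
  by rewrite (pos_part_id (ltW t0)) !pos_part_0; [nra|lra..].
have [t2|t2] := leP t 2.
  rewrite (pos_part_id (ltW t0)) (@pos_part_id (t - 1)) ?(@pos_part_0 (t - 2)) ?(@pos_part_0 (t - 3)); [|lra..].
  pose z := t - 1.
  have -> : (t ^+ 3 - 3 * (t - 1) ^+ 3 + 3 * 0 ^+ 3 - 0 ^+ 3) / 6
     = (1 + 3 * z + 3 * z ^+ 2 - 2 * z ^+ 3) / 6 by rewrite /z; field.
  have z0 : 0 <= z <= 1 by rewrite /z; lra.
  by nra.
rewrite (pos_part_id (ltW t0)) (@pos_part_id (t - 1)) ?(@pos_part_id (t - 2)) ?(@pos_part_0 (t - 3)); [|lra..].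
pose z := 3 - t.
have -> : (t ^+ 3 - 3 * (t - 1) ^+ 3 + 3 * (t - 2) ^+ 3 - 0 ^+ 3) / 6
     = 1 - z ^+ 3 / 6 by rewrite /z; field.
have z0 : 0 <= z <= 1 by rewrite /z; lra.
by nra.
Qed.

Lemma third_difference_lip (g : R -> R) (c : R) :
  (forall t u, t <= 3 -> u <= 3 -> `|g t - g u| <= c * `|t - u|) ->
  forall t u, t <= 3 -> u <= 3 ->
  `|third_difference g t - third_difference g u| <= 8 * c * `|t - u|.
Proof.
move=> gc t u t3 u3; rewrite /third_difference.
have h (k : R) : 0 <= k -> `|g (t - k) - g (u - k)| <= c * `|t - u|.
  move=> k0; have -> : t - u = t - k - (u - k) by ring.
  by apply: gc; lra.
have := h 1 ler01; have := h 2 ltac:(lra); have := h 3 ltac:(lra); have := gc t u t3 u3.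
by rewrite !ler_norml; lra.
Qed.

Lemma third_difference_norm (g : R -> R) (c : R) :
  (forall t, t <= 3 -> `|g t| <= c) ->
  forall t, t <= 3 -> `|third_difference g t| <= 8 * c.
Proof.
move=> gc t t3; rewrite /third_difference.
have h (k : R) : 0 <= k -> `|g (t - k)| <= c by move=> k0; apply: gc; lra.
have := h 1 ler01; have := h 2 ltac:(lra); have := h 3 ltac:(lra); have := gc t t3.
by rewrite !ler_norml; lra.
Qed.

Let pos_part_le3 t : t <= 3 -> pos_part t <= 3.
Proof. by move=> t3; rewrite /pos_part ge_max t3/=. Qed.

Let pos_part_lipX (n : nat) (c : R) :
  (forall u v, 0 <= u <= 3 -> 0 <= v <= 3 -> `|u ^+ n - v ^+ n| <= c * `|u - v|) ->
  0 <= c -> forall t u, t <= 3 -> u <= 3 ->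
  `|pos_part t ^+ n - pos_part u ^+ n| <= c * `|t - u|.
Proof.
move=> h c0 t u t3 u3.
apply: (@le_trans _ _ (c * `|pos_part t - pos_part u|)).
  by apply: h; rewrite pos_part_ge0 pos_part_le3.
by rewrite ler_wpM2l// pos_part_lip.
Qed.

Let lip_clamp (g : R -> R) (c : R) : (forall t, g t = g (clamp t)) -> 0 <= c ->
  (forall t u, t <= 3 -> u <= 3 -> `|g t - g u| <= c * `|t - u|) ->
  lipschitz_by c g.
Proof.
move=> gE c0 gc t u; rewrite gE (gE u).
have /andP[_ t3] := clamp_itv t; have /andP[_ u3] := clamp_itv u.
by rewrite (le_trans (gc _ _ t3 u3))// ler_wpM2l// clamp_lip.
Qed.

Let cube_lip u v : 0 <= u <= 3 -> 0 <= v <= 3 ->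
  `|u ^+ 3 - v ^+ 3| <= 27 * `|u - v|.
Proof.
move=> /andP[u0 u3] /andP[v0 v3].
have -> : u ^+ 3 - v ^+ 3 = (u ^+ 2 + u * v + v ^+ 2) * (u - v) by ring.
by rewrite normrM ler_wpM2r// ger0_norm; nra.
Qed.

Let sqr_lip u v : 0 <= u <= 3 -> 0 <= v <= 3 ->
  `|u ^+ 2 - v ^+ 2| <= 6 * `|u - v|.
Proof.
move=> /andP[u0 u3] /andP[v0 v3]; rewrite subr_sqr mulrC normrM ler_wpM2r//.
by rewrite ger0_norm; lra.
Qed.

Let ge0_nat (n : nat) : 0 <= n%:R :> R. Proof. exact: ler0n. Qed.

Lemma spline_lip : lipschitz_by 36 spline.
Proof.
apply: lip_clamp => //; first by move=> t; have [] := spline_clamp t.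
move=> t u t3 u3; rewrite /spline -mulrBl normrM (@ger0_norm _ 6^-1) ?invr_ge0//.
have := third_difference_lip (pos_part_lipX cube_lip (ge0_nat 27)) t3 u3; lra.
Qed.

Lemma spline1_lip : lipschitz_by 24 spline1.
Proof.
apply: lip_clamp => //; first by move=> t; have [] := spline_clamp t.
move=> t u t3 u3; rewrite /spline1 -mulrBl normrM (@ger0_norm _ 2^-1) ?invr_ge0//.
have := third_difference_lip (pos_part_lipX sqr_lip (ge0_nat 6)) t3 u3; lra.
Qed.

Lemma spline2_lip : lipschitz_by 8 spline2.
Proof.
apply: lip_clamp => //; first by move=> t; have [] := spline_clamp t.
move=> t u t3 u3; rewrite /spline2.
have := @third_difference_lip pos_part 1 _ t u t3 u3.
rewrite mulr1; apply => x y _ _; rewrite mul1r; exact: pos_part_lip.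
Qed.

Let pos_part_norm (n : nat) t : t <= 3 -> `|pos_part t ^+ n| <= 3 ^+ n.
Proof.
move=> t3; rewrite ger0_norm ?exprn_ge0 ?pos_part_ge0//.
by rewrite lerXn2r ?nnegrE ?pos_part_ge0 ?pos_part_le3.
Qed.

Lemma spline1_norm t : `|spline1 t| <= 36.
Proof.
have [_ -> _] := spline_clamp t; have /andP[_ t3] := clamp_itv t.
rewrite /spline1 normrM (@ger0_norm _ 2^-1) ?invr_ge0//.
have := third_difference_norm (@pos_part_norm 2) t3; lra.
Qed.

Lemma spline2_norm t : `|spline2 t| <= 24.
Proof.
have [_ _ ->] := spline_clamp t; have /andP[_ t3] := clamp_itv t.
have := third_difference_norm (@pos_part_norm 1) t3.
rewrite -/(spline2 (clamp t)) expr1; lra.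
Qed.

Lemma spline_taylor t h :
  `|spline (t + h) - spline t - h * spline1 t - h ^+ 2 / 2 * spline2 t|
    <= 49 * Num.min (h ^+ 2) (`|h| ^+ 3).
Proof.
have [h1|h1] := leP `|h| 1.
  have -> : Num.min (h ^+ 2) (`|h| ^+ 3) = `|h| ^+ 3.
    by apply/min_idPr; rewrite -(real_normK (num_real h)) ler_wiXn2l.
  have := pos_part_taylor t h; have := pos_part_taylor (t - 1) h.
  have := pos_part_taylor (t - 2) h; have := pos_part_taylor (t - 3) h.
  rewrite /spline /spline1 /spline2 /third_difference !(addrAC t h).
  move: (exprn_ge0 3 (normr_ge0 h)); move: (`|h| ^+ 3) => H H0.
  by rewrite !ler_norml; lra.
have -> : Num.min (h ^+ 2) (`|h| ^+ 3) = h ^+ 2.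
  by apply/min_idPl; rewrite -(real_normK (num_real h)) ler_eXn2l.
(* For a large increment the three terms are bounded one by one, relative to
   [h ^+ 2], by 1, 36 and 12: hence the constant 49. *)
have := spline_itv t; have := spline_itv (t + h).
have := spline1_norm t; have := spline2_norm t.
have hh : `|h| <= h ^+ 2 by rewrite -(real_normK (num_real h)) ler_eXnr// ltW.
have h2 : 1 <= h ^+ 2 by lra.
rewrite !ler_norml => /andP[a1 a2] /andP[b1 b2] /andP[c1 c2] /andP[d1 d2].
have e1 : `|h * spline1 t| <= h ^+ 2 * 36.
  rewrite normrM; apply: ler_pM => //; exact: spline1_norm.
have : `|h ^+ 2 / 2 * spline2 t| <= 12 * h ^+ 2.
  rewrite normrM ger0_norm ?divr_ge0 ?sqr_ge0//.
  have := spline2_norm t; have := sqr_ge0 h; nra.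
by move: e1; rewrite !ler_norml; lra.
Qed.

Section Step.
Variables (a e : R).
Hypotheses (e0 : 0 < e) (e1 : e <= 1).

Definition smooth_step x := 1 - spline ((x - a) / e).

Lemma smooth_step_left x : x <= a -> smooth_step x = 1.
Proof.
move=> xa; have t0 : (x - a) / e <= 0.
  by rewrite ler_pdivrMr// mul0r; lra.
by rewrite /smooth_step; have [-> _ _] := spline_left t0; rewrite subr0.
Qed.

Lemma smooth_step_right x : a + 3 * e <= x -> smooth_step x = 0.
Proof.
move=> xa; have t0 : 3 <= (x - a) / e.
  by rewrite ler_pdivlMr//; lra.
by rewrite /smooth_step; have [-> _ _] := spline_right t0; rewrite subrr.
Qed.

Lemma smooth_step_itv x : 0 <= smooth_step x <= 1.
Proof. by rewrite /smooth_step; have := spline_itv ((x - a) / e); lra. Qed.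

(** Rescaling by [e] costs at most three powers of [1 / e], one per
    derivative. *)
Lemma smooth_smooth_step : smooth (49 / e ^+ 3) (36 / e ^+ 3) smooth_step
  (fun x => - e^-1 * spline1 ((x - a) / e))
  (fun x => - (e^-1 ^+ 2) * spline2 ((x - a) / e)).
Proof.
pose k := e^-1; have k1 : 1 <= k by rewrite invf_ge1.
have k0 : 0 < k by rewrite invr_gt0.
have kk : k <= k ^+ 3 by rewrite ler_eXnr.
have kk2 : k ^+ 2 <= k ^+ 3 by apply: ler_weXn2l.
have k3 : 1 <= k ^+ 3 by lra.
have kE (c : R) : c / e ^+ 3 = c * k ^+ 3 by rewrite exprVn.
have dist x y : `|(x - a) / e - (y - a) / e| = k * `|x - y|.
  rewrite -mulrBl normrM (gtr0_norm k0) mulrC; congr (_ * `|_|); ring.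
rewrite !kE; split; rewrite -/k.
- by move=> x; have /andP[] := smooth_step_itv x.
- by move=> x; have := smooth_step_itv x; lra.
- move=> x; rewrite normrM normrN (gtr0_norm k0).
  by have := spline1_norm ((x - a) / e); nra.
- move=> x; rewrite normrM normrN (gtr0_norm (exprn_gt0 _ k0)).
  have := spline2_norm ((x - a) / e); have := exprn_gt0 2 k0; nra.
- move=> x y; have -> : smooth_step x - smooth_step y =
      - (spline ((x - a) / e) - spline ((y - a) / e)) by rewrite /smooth_step; ring.
  rewrite normrN (le_trans (spline_lip _ _))// dist.
  by rewrite mulrA ler_wpM2r//; lra.
- move=> x y; rewrite -mulrBr normrM normrN (gtr0_norm k0).
  apply: (@le_trans _ _ (k * (24 * (k * `|x - y|)))).
    by rewrite ler_pM2l// -dist; exact: spline1_lip.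
  by rewrite !mulrA ler_wpM2r//; nra.
- move=> x y; rewrite -mulrBr normrM normrN (gtr0_norm (exprn_gt0 _ k0)).
  apply: (@le_trans _ _ (k ^+ 2 * (8 * (k * `|x - y|)))).
    by rewrite ler_pM2l ?exprn_gt0// -dist; exact: spline2_lip.
  by rewrite !mulrA ler_wpM2r//; nra.
- move=> x h; have := spline_taylor ((x - a) / e) (k * h).
  have -> : (x - a) / e + k * h = (x + h - a) / e by rewrite /k; ring.
  rewrite /smooth_step -/k.
  move: (spline _) (spline _) (spline1 _) (spline2 _) => s s' s1 s2 H.
  apply: le_trans (_ : 49 * Num.min ((k * h) ^+ 2) (`|k * h| ^+ 3) <= _).
    apply: le_trans H; rewrite -normrN le_eqVlt; apply/orP; left; apply/eqP; congr `|_|.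
    by field.
  rewrite -mulrA ler_pM2l//.
  have m1 : 0 <= Num.min (h ^+ 2) (`|h| ^+ 3).
    by rewrite le_min sqr_ge0 exprn_ge0.
  rewrite normrM (gtr0_norm k0) !exprMn.
  have [hh|/ltW hh] := leP (h ^+ 2) (`|h| ^+ 3).
    by rewrite ge_min; apply/orP; left; rewrite ler_wpM2r ?sqr_ge0.
  by rewrite ge_min lexx orbT.
Qed.

End Step.
End CubicSpline.

(** * Lindeberg replacement *)

Section Lindeberg.
Context {d : measure_display} {T : measurableType d} {R : realType}.
Variable P : probability T R.
Implicit Types f g X Y : T -> R.

Definition Pintegrable f := P.-integrable setT (EFin \o f).

Lemma PintegrableD f g : Pintegrable f -> Pintegrable g ->
  Pintegrable (fun w => f w + g w).
Proof. by move=> fi gi; have := integrableD measurableT fi gi. Qed.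

Lemma PintegrableZ (c : R) f : Pintegrable f -> Pintegrable (fun w => c * f w).
Proof. by move=> fi; have := integrableZl measurableT c fi. Qed.

Lemma Pintegrable_le f g : measurable_fun setT f -> Pintegrable g ->
  (forall w, `|f w| <= g w) -> Pintegrable f.
Proof.
move=> mf gi fg; apply: (le_integrable measurableT _ _ gi).
  exact/measurable_EFinP.
by move=> w _; rewrite /= lee_fin (le_trans (fg w))// ler_norm.
Qed.

Lemma Pintegrable_cst (c : R) : Pintegrable (fun=> c).
Proof. exact: finite_measure_integrable_cst. Qed.

Lemma Pintegrable_bounded f (c : R) : measurable_fun setT f ->
  (forall w, `|f w| <= c) -> Pintegrable f.
Proof. by move=> mf fc; exact: (Pintegrable_le mf (Pintegrable_cst c)). Qed.

Lemma PintegrableM f g (c : R) : measurable_fun setT f ->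
  (forall w, `|f w| <= c) -> Pintegrable g -> Pintegrable (fun w => f w * g w).
Proof.
move=> mf fc gi.
have mg : measurable_fun setT g by apply/measurable_EFinP; exact: (measurable_int P gi).
have gi' := integrable_norm gi.
apply: (Pintegrable_le _ (PintegrableZ c gi')); first exact: measurable_funM.
by move=> w; rewrite normrM ler_wpM2r.
Qed.

Lemma PintegralD f g : Pintegrable f -> Pintegrable g ->
  \int[P]_w (f w + g w) = \int[P]_w f w + \int[P]_w g w.
Proof. by move=> fi gi; rewrite RintegralD. Qed.

Lemma PintegralZ (c : R) f : Pintegrable f ->
  \int[P]_w (c * f w) = c * \int[P]_w f w.
Proof. by move=> fi; rewrite RintegralZl. Qed.

Lemma Pintegral_cst (c : R) : \int[P]_w c = c.
Proof. by rewrite Rintegral_cst//= probability_setT mulr1. Qed.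

Lemma le_Pintegral f g : Pintegrable f -> Pintegrable g ->
  (forall w, f w <= g w) -> \int[P]_w f w <= \int[P]_w g w.
Proof. by move=> fi gi fg; apply: le_Rintegral. Qed.

Lemma Pintegral_norm f g : Pintegrable f -> Pintegrable g ->
  (forall w, `|f w| <= g w) -> `|\int[P]_w f w| <= \int[P]_w g w.
Proof.
move=> fi gi fg; rewrite (le_trans (le_normr_Rintegral _ fi))//.
apply: le_Pintegral => //; exact: integrable_norm.
Qed.

(** The Taylor remainder: cubic for small values, quadratic for large ones, so
    that only second moments have to exist. *)
Definition lindeberg_min X (w : T) : R := Num.min (X w ^+ 2) (`|X w| ^+ 3).

Lemma measurable_lindeberg_min X : measurable_fun setT X ->
  measurable_fun setT (lindeberg_min X).
Proof.
move=> mX; apply: measurable_minr; first exact: measurable_funX.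
apply: measurable_funX; apply: measurableT_comp mX; exact: normr_measurable.
Qed.

Lemma lindeberg_min_ge0 X w : 0 <= lindeberg_min X w.
Proof. by rewrite /lindeberg_min le_min sqr_ge0 exprn_ge0. Qed.

Lemma Pintegrable_lindeberg_min X : measurable_fun setT X ->
  Pintegrable (fun w => X w ^+ 2) -> Pintegrable (lindeberg_min X).
Proof.
move=> mX X2; apply: (Pintegrable_le _ X2); first exact: measurable_lindeberg_min.
by move=> w; rewrite ger0_norm ?lindeberg_min_ge0// /lindeberg_min ge_min lexx.
Qed.

(** What the replacement argument uses of a variable [X] that is independent
    of [S], centred, and of variance [s ^+ 2]. *)
Definition matches (s : R) (S X : T -> R) : Prop := forall (L : R) (g : R -> R),
  lipschitz_by L g -> (forall x, `|g x| <= L) ->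
  \int[P]_w (g (S w) * X w) = 0 /\
  \int[P]_w (g (S w) * X w ^+ 2) = s ^+ 2 * \int[P]_w g (S w).

(** Adding [X] or a Gaussian of the same variance changes a test function by
    the same terms up to second order; only the two remainders are left. *)
Lemma lindeberg_step (C L s : R) (f f1 f2 : R -> R) (S X : T -> R) :
  0 <= C -> 0 <= s -> smooth C L f f1 f2 ->
  measurable_fun setT S -> measurable_fun setT X ->
  Pintegrable (fun w => X w ^+ 2) -> matches s S X ->
  `|\int[P]_w f (S w + X w) - \int[P]_w gauss_avg s f (S w)| <=
  C * (\int[P]_w lindeberg_min X w + normal_cube_bound * s ^+ 3).
Proof.
move=> C0 s0 sf mS mX X2 SX.
have fN := smooth_norm sf; have sg := smooth_gauss_avg s0 sf.
have [_ _ f1N f2N lf lf1 lf2 ft] := sf.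
have gN := smooth_norm sg; have lg := smooth_lip sg.
have mc (g : R -> R) : lipschitz_by L g -> measurable_fun setT (fun w => g (S w)).
  by move=> /lipschitz_measurable mg; exact: measurableT_comp.
have ic (g : R -> R) : lipschitz_by L g -> (forall x, `|g x| <= L) ->
    Pintegrable (fun w => g (S w)).
  by move=> lg' gL; apply: Pintegrable_bounded => //; exact: mc.
have iX : Pintegrable X.
  apply: (Pintegrable_le mX (PintegrableD (Pintegrable_cst 1) X2)) => w.
  by rewrite ler_norml; nra.
have iSX : Pintegrable (fun w => f (S w + X w)).
  apply: (@Pintegrable_bounded _ L) => //.
  apply: measurableT_comp; first exact: lipschitz_measurable lf.
  exact: measurable_funD.
have i1 := PintegrableM (mc _ lf1) (fun w => f1N (S w)) iX.
have i2 := PintegrableM (mc _ lf2) (fun w => f2N (S w)) X2.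
have [e1 _] := SX L f1 lf1 f1N; have [_ e2] := SX L f2 lf2 f2N.
pose A w := f (S w + X w) + -1 * f (S w) + -1 * (f1 (S w) * X w) + - 2^-1 * (f2 (S w) * X w ^+ 2).
pose B w := gauss_avg s f (S w) + -1 * f (S w) + - (s ^+ 2 / 2) * f2 (S w).
have iA : Pintegrable A.
  by repeat apply: PintegrableD => //; apply: PintegrableZ => //; exact: ic.
have iB : Pintegrable B.
  repeat apply: PintegrableD; try apply: PintegrableZ; exact: ic.
have EfSX : \int[P]_w f (S w + X w) =
    \int[P]_w A w + \int[P]_w f (S w) + s ^+ 2 / 2 * \int[P]_w f2 (S w).
  transitivity (\int[P]_w (A w + f (S w) + f1 (S w) * X w + 2^-1 * (f2 (S w) * X w ^+ 2))).
    by apply: eq_Rintegral => w _; rewrite /A; ring.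
  have iZ := PintegrableZ 2^-1 i2; have if0 := ic _ lf fN.
  have iAf := PintegrableD iA if0.
  rewrite (PintegralD (PintegrableD iAf i1) iZ) (PintegralD iAf i1) (PintegralD iA if0).
  by rewrite (PintegralZ _ i2) e1 e2; field.
have EG : \int[P]_w gauss_avg s f (S w) =
    \int[P]_w B w + \int[P]_w f (S w) + s ^+ 2 / 2 * \int[P]_w f2 (S w).
  transitivity (\int[P]_w (B w + f (S w) + s ^+ 2 / 2 * f2 (S w))).
    by apply: eq_Rintegral => w _; rewrite /B; ring.
  have if0 := ic _ lf fN; have if2 := ic _ lf2 f2N.
  have iBf := PintegrableD iB if0.
  by rewrite (PintegralD iBf (PintegrableZ _ if2)) (PintegralD iB if0) (PintegralZ _ if2).
have -> : \int[P]_w f (S w + X w) - \int[P]_w gauss_avg s f (S w)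
    = \int[P]_w A w - \int[P]_w B w by rewrite EfSX EG; ring.
have im := Pintegrable_lindeberg_min mX X2.
have nA : `|\int[P]_w A w| <= C * \int[P]_w lindeberg_min X w.
  rewrite -PintegralZ//; apply: Pintegral_norm => //; first exact: PintegrableZ.
  move=> w; apply: le_trans (ft (S w) (X w)); rewrite le_eqVlt; apply/orP; left.
  by apply/eqP; congr `|_|; rewrite /A; field.
have nB : `|\int[P]_w B w| <= C * (normal_cube_bound * s ^+ 3).
  rewrite -[leRHS]Pintegral_cst; apply: Pintegral_norm => //; first exact: Pintegrable_cst.
  move=> w; apply: le_trans (gauss_avg_taylor s0 C0 sf (S w)); rewrite le_eqVlt; apply/orP; left.
  by apply/eqP; congr `|_|; rewrite /B; field.
by rewrite mulrDr (le_trans (ler_normB _ _))// lerD.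
Qed.

Section Row.
Variables (X : nat -> T -> R) (s : nat -> R).

Definition row_sum (n : nat) (w : T) : R := \sum_(k < n) X k w.

Lemma measurable_row_sum n : (forall k, measurable_fun setT (X k)) ->
  measurable_fun setT (row_sum n).
Proof. by move=> mX; apply: measurable_sum. Qed.

(** The last summand is replaced first. Its Gaussian is absorbed in the test
    function, which stays in the same class, so induction applies to it. *)
Lemma lindeberg_swap (C L : R) (n : nat) : 0 <= C ->
  (forall k, 0 <= s k) -> (forall k, measurable_fun setT (X k)) ->
  (forall k, Pintegrable (fun w => X k w ^+ 2)) ->
  (forall k, matches (s k) (row_sum k) (X k)) ->
  forall f f1 f2 : R -> R, smooth C L f f1 f2 ->
  `|\int[P]_w f (row_sum n w) - gauss_avg (Num.sqrt (\sum_(k < n) s k ^+ 2)) f 0| <=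
  C * \sum_(k < n) (\int[P]_w lindeberg_min (X k) w + normal_cube_bound * s k ^+ 3).
Proof.
move=> C0 s0 mX X2 XM; elim: n => [|n IHn] f f1 f2 sf.
  rewrite !big_ord0 mulr0 sqrtr0 /gauss_avg /gint eqxx addr0.
  have -> : \int[P]_w f (row_sum 0 w) = f 0.
    rewrite -[RHS]Pintegral_cst; apply: eq_Rintegral => w _.
    by rewrite /row_sum big_ord0.
  by rewrite subrr normr0.
rewrite !big_ord_recr/=.
have sg := smooth_gauss_avg (s0 n) sf.
have := IHn _ _ _ sg.
have fN x : 0 <= f x <= L by rewrite (smooth_ge0 sf) (smooth_le sf).
rewrite (gauss_avg_comp (sqrtr_ge0 _) (s0 n) (smooth_lip sf) fN).
rewrite sqr_sqrtr; last by apply: sumr_ge0 => i _; exact: sqr_ge0.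
have := lindeberg_step C0 (s0 n) sf (measurable_row_sum n mX) (mX n) (X2 n) (XM n).
have -> : \int[P]_w f (row_sum n.+1 w) = \int[P]_w f (row_sum n w + X n w).
  by apply: eq_Rintegral => w _; rewrite /row_sum big_ord_recr.
rewrite !mulrDr => h1 h2.
rewrite (le_trans (ler_distD (\int[P]_w gauss_avg (s n) f (row_sum n w)) _ _))//.
by rewrite [leRHS]addrC; exact: lerD.
Qed.

Lemma prob_le_smooth_step (S : T -> R) (a e : R) : measurable_fun setT S ->
  0 < e -> e <= 1 ->
  fine (P [set w | S w <= a]) <= \int[P]_w smooth_step a e (S w)
    <= fine (P [set w | S w <= a + 3 * e]).
Proof.
move=> mS e0 e1.
have mle b : measurable [set w | S w <= b].
  by rewrite -[X in measurable X]setTI; apply: measurable_fun_le => //.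
have PE b : fine (P [set w | S w <= b]) = \int[P]_w \1_[set w | S w <= b] w.
  by rewrite /Rintegral integral_indic// setIT.
have ii b : Pintegrable (\1_[set w | S w <= b] : T -> R).
  apply: (@Pintegrable_bounded _ 1); first exact: measurable_indic.
  by move=> w; rewrite indicE; case: (_ \in _); rewrite ?normr1 ?normr0.
have iS : Pintegrable (fun w => smooth_step a e (S w)).
  apply: (@Pintegrable_bounded _ 1).
    apply: measurableT_comp mS.
    exact: (lipschitz_measurable (smooth_lip (smooth_smooth_step a e0 e1))).
  by move=> w; have /andP[h0 h1] := smooth_step_itv a e (S w); rewrite ger0_norm.
rewrite !PE; apply/andP; split; apply: le_Pintegral => // w; rewrite indicE.
  have [/set_mem/= h|_] := boolP (w \in _); first by rewrite smooth_step_left.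
  by have /andP[] := smooth_step_itv a e (S w).
have [_|/negP h] := boolP (w \in _); first by have /andP[] := smooth_step_itv a e (S w).
by rewrite smooth_step_right// leNgt; apply/negP => h'; apply: h; rewrite inE/= ltW.
Qed.

End Row.
End Lindeberg.

Section NormalCdf.
Context {R : realType}.
Notation mu := (@lebesgue_measure R).

Definition Phi (a : R) : R := fine (normal_prob 0 1 `]-oo, a]).

Lemma PhiE (a : R) : Phi a = \int[mu]_y (\1_`]-oo, a] y * normal_pdf 0 1 y).
Proof.
rewrite /Phi /normal_prob /Rintegral [in LHS]integral_mkcond; congr fine.
apply: eq_integral => y _; rewrite patchE indicE; case: (y \in _).
  by rewrite mul1r.
by rewrite mul0r.
Qed.

Let int_ok (g : R -> R) : measurable_fun setT g -> (forall y, `|g y| <= 1) ->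
  mu.-integrable setT (EFin \o (fun y => g y * normal_pdf 0 1 y)).
Proof.
move=> mg g1; apply: (@integrable_poly_normal _ 1 ltr01 g 1) => // y.
by rewrite mul1r (le_trans (g1 y))// lerDl exprn_ge0.
Qed.

Let int_ind (a : R) : mu.-integrable setT
  (EFin \o (fun y => \1_`]-oo, a]%classic y * normal_pdf 0 1 y)).
Proof.
apply: int_ok => [|y]; first exact: measurable_indic.
by rewrite indicE; case: (_ \in _); rewrite ?normr1 ?normr0.
Qed.

Lemma Phi_smooth_step (a e : R) : 0 < e -> e <= 1 ->
  Phi a <= gauss_avg 1 (smooth_step a e) 0 <= Phi (a + 3 * e).
Proof.
move=> e0 e1.
have -> : gauss_avg 1 (smooth_step a e) 0 =
    \int[mu]_y (smooth_step a e y * normal_pdf 0 1 y).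
  rewrite /gauss_avg /gint oner_eq0; apply: eq_Rintegral => y _.
  by rewrite add0r.
have iS : mu.-integrable setT (EFin \o (fun y => smooth_step a e y * normal_pdf 0 1 y)).
  apply: int_ok.
    exact: (lipschitz_measurable (smooth_lip (smooth_smooth_step a e0 e1))).
  by move=> y; have /andP[h0 h1] := smooth_step_itv a e y; rewrite ger0_norm.
rewrite !PhiE; apply/andP; split; apply: le_Rintegral => // y _;
  rewrite ler_wpM2r ?normal_pdf_ge0// indicE.
  have [/set_mem/=|_] := boolP (y \in _).
    by rewrite in_itv/= => h; rewrite smooth_step_left.
  by have /andP[] := smooth_step_itv a e y.
have [_|/negP h] := boolP (y \in _); first by have /andP[] := smooth_step_itv a e y.
rewrite smooth_step_right// leNgt; apply/negP => h'; apply: h.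
by rewrite inE/= in_itv/= ltW.
Qed.

(** The density is at most its peak. *)
Lemma Phi_lip (a b : R) : a <= b -> Phi b - Phi a <= normal_peak 1 * (b - a).
Proof.
move=> ab; rewrite !PhiE -RintegralB//.
have iab : mu.-integrable setT (EFin \o (\1_`]a, b]%classic : R -> R)).
  exact: integrable_indic_itv.
have -> : normal_peak 1 * (b - a) = \int[mu]_y (normal_peak 1 * \1_`]a, b]%classic y).
  have mab : mu `]a, b]%classic = (b - a)%:E.
    rewrite lebesgue_measure_itv/= lte_fin.
    by case: ltgtP ab => // -> _; rewrite subrr.
  rewrite RintegralZl// /Rintegral integral_indic//; congr (_ * _).
  by transitivity (fine (mu `]a, b]%classic)); [rewrite mab|rewrite setIT].
apply: le_Rintegral => //.
- exact: (integrableB measurableT (int_ind b) (int_ind a)).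
- exact: (integrableZl measurableT (normal_peak 1) iab).
move=> y _; rewrite -mulrBl mulrC; apply: ler_pM; rewrite ?normal_pdf_ge0//.
- by rewrite !indicE !mem_setE !in_itv/= subr_ge0; case: (leP y a) => // h; rewrite (le_trans h).
- by apply: normal_pdf_ub; rewrite oner_eq0.
- rewrite !indicE !mem_setE !in_itv/=; case: (leP y a) => h /=; last by rewrite subr0.
  by rewrite (le_trans h)// subrr.
Qed.

End NormalCdf.

Section LindebergCdf.
Context {d : measure_display} {T : measurableType d} {R : realType}.
Variable P : probability T R.

(** The smooth step from [a] to [a + 3 e] and the one from [a - 3 e] to [a]
    bracket the indicator of the half line. *)
Lemma lindeberg_cdf (X : nat -> T -> R) (s : nat -> R) (n : nat) (a e : R) :
  (forall k, 0 <= s k) -> (forall k, measurable_fun setT (X k)) ->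
  (forall k, Pintegrable P (fun w => X k w ^+ 2)) ->
  (forall k, matches P (s k) (row_sum X k) (X k)) ->
  \sum_(k < n) s k ^+ 2 = 1 -> 0 < e -> e <= 1 ->
  `|fine (P [set w | row_sum X n w <= a]) - Phi a| <= 3 * normal_peak 1 * e +
  49 / e ^+ 3 * \sum_(k < n) (\int[P]_w lindeberg_min (X k) w + normal_cube_bound * s k ^+ 3).
Proof.
move=> s0 mX X2 XM s1 e0 e1; set err := _ * \sum_(k < n) _.
have swap b : `|\int[P]_w smooth_step b e (row_sum X n w)
    - gauss_avg 1 (smooth_step b e) 0| <= err.
  have C0 : 0 <= 49 / e ^+ 3 by rewrite divr_ge0// exprn_ge0// ltW.
  have := lindeberg_swap n C0 s0 mX X2 XM (smooth_smooth_step b e0 e1).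
  by rewrite s1 sqrtr1.
have mS := measurable_row_sum n mX.
have [/andP[p1 p2] /andP[p3 p4]] := (prob_le_smooth_step P a mS e0 e1,
  prob_le_smooth_step P (a - 3 * e) mS e0 e1).
have [/andP[q1 q2] /andP[q3 q4]] := (Phi_smooth_step a e0 e1,
  Phi_smooth_step (a - 3 * e) e0 e1).
have := swap a; have := swap (a - 3 * e).
have l1 : a <= a + 3 * e by lra.
have l2 : a - 3 * e <= a by lra.
have := Phi_lip l1; have := Phi_lip l2.
rewrite subrK in p4 q4.
rewrite !ler_norml; lra.
Qed.

End LindebergCdf.

(** * Environments, generations and their independence *)

Section Environments.
Context {d : measure_display} {T : measurableType d} {R : realType}.
Variable P : probability T R.
Variable xi : nat -> {RV P >-> (R * R)%type}.
Variable p : R.-pker R ~> nat.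
Variable X : 'I_2 -> nat -> nat -> {RV P >-> nat}.
Hypothesis xi_iid : iid xi.
Hypothesis X_law : quenched_offspring xi p X.

Implicit Types (D : pred nat) (j : 'I_2 * nat * nat).

Notation Xj j := (X j.1.1 j.1.2 j.2).

Definition env_event D (B : nat -> set (R * R)) : set T :=
  [set w | forall i, D i -> B i (xi i w)].

Definition env_events D : set (set T) :=
  [set A | exists2 B, (forall i, measurable (B i)) & A = env_event D B].

Definition offspring_event D (B : 'I_2 * nat * nat -> set nat) : set T :=
  [set w | forall j, D j.1.2 -> B j (Xj j w)].

(** A pi-system that generates the sigma-algebra of the generations in [D].
    The list [L] makes the constraints on the offspring variables finite in
    number: the quenched law is only prescribed on finite families. *)
Definition cylinders D : set (set T) :=
  [set A | exists B B' (L : seq ('I_2 * nat * nat)),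
    [/\ forall i, measurable (B i), forall j, j \notin L -> B' j = setT &
        A = env_event D B `&` offspring_event D B'] ].

Definition past (n : nat) := cylinders (fun i => (i < n)%N).
Definition present (n : nat) := cylinders (fun i => i == n).

Lemma measurable_env_event D B : (forall i, measurable (B i)) ->
  measurable (env_event D B).
Proof.
move=> mB; have -> : env_event D B = \bigcap_(i in [set i | D i]) (xi i @^-1` B i).
  by apply/seteqP; split => w h i; apply: h.
by apply: bigcap_measurableType => i _; exact: measurable_funPTI.
Qed.

Lemma env_event_sigma D B : (forall i, measurable (B i)) ->
  generated_sigma xi (env_event D B).
Proof.
move=> mB; have -> : env_event D B = \bigcap_i (if D i then xi i @^-1` B i else setT).
  apply/seteqP; split => w h i; first by move=> _; case: ifPn => // Di; exact: h.
  by move=> Di; have := h i I; rewrite Di.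
pose G : measurableType _ := g_sigma_algebraType
  [set A | exists n (B : set (R * R)), measurable B /\ A = xi n @^-1` B].
apply: (@bigcap_measurableType _ G) => i _.
case: ifPn => Di; last exact: measurableT.
by apply: sub_gen_smallest; exists i, (B i).
Qed.

Lemma offspring_eventE D B (L : seq ('I_2 * nat * nat)) :
  (forall j, j \notin L -> B j = setT) ->
  offspring_event D B = \bigcap_(j in [set j | j \in undup [seq j <- L | D j.1.2]]) (Xj j @^-1` B j).
Proof.
move=> BL; apply/seteqP; split => w h j.
  by rewrite /= mem_undup mem_filter => /andP[Dj _]; exact: h.
move=> Dj; have [jL|/BL -> //] := boolP (j \in L).
by apply: h; rewrite /= mem_undup mem_filter Dj.
Qed.

Lemma cylinders_measurable D : cylinders D `<=` measurable.
Proof.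
move=> _ [B [B' [L [mB BL ->]]]]; apply: measurableI; first exact: measurable_env_event.
rewrite (offspring_eventE D BL); apply: fin_bigcap_measurable => [|j _].
  exact: finite_seq.
exact: measurable_funPTI.
Qed.

Lemma cylindersT D : cylinders D setT.
Proof.
exists (fun=> setT), (fun=> setT), [::]; split => //.
by apply/seteqP; split.
Qed.

Lemma cylinders_setI D : setI_closed (cylinders D).
Proof.
move=> _ _ [B [B' [L [mB BL ->]]]] [C [C' [L' [mC CL ->]]]].
exists (fun i => B i `&` C i), (fun j => B' j `&` C' j), (L ++ L'); split.
- by move=> i; exact: measurableI.
- by move=> j; rewrite mem_cat negb_or => /andP[/BL -> /CL ->]; rewrite setTI.
- apply/seteqP; split=> w.
    by move=> [[h1 h2] [h3 h4]]; split => i Di; split; move: i Di.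
  by move=> [h1 h2]; split; split => i Di; [have [] := h1 i Di|have [] := h2 i Di
    |have [] := h1 i Di|have [] := h2 i Di].
Qed.

Lemma cylinders_sub D D' : (forall i, D i -> D' i) -> cylinders D `<=` cylinders D'.
Proof.
move=> DD' _ [B [B' [L [mB BL ->]]]].
exists (fun i => if D i then B i else setT), (fun j => if D j.1.2 then B' j else setT), L; split.
- by move=> i; case: ifPn.
- by move=> j /BL; case: ifPn.
- apply/seteqP; split=> w [h1 h2]; split.
  + by move=> i _; case: ifPn => // Di; exact: h1.
  + by move=> j _; case: ifPn => // Dj; exact: h2.
  + by move=> i Di; have := h1 i (DD' _ Di); rewrite Di.
  + by move=> j Dj; have := h2 j (DD' _ Dj); rewrite Dj.
Qed.

Lemma mfun_xi D i : D i -> mfun_of (cylinders D) (xi i).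
Proof.
move=> Di _ B mB; rewrite setTI; apply: sub_gen_smallest.
exists (fun k => if k == i then B else setT), (fun=> setT), [::]; split => //.
- by move=> k; case: ifPn.
- apply/seteqP; split => w.
    by move=> wB; split => // k _; case: eqVneq => // ->.
  by move=> [/(_ i Di)]; rewrite eqxx.
Qed.

Lemma mfun_X D l i k : D i -> mfun_of (cylinders D) (X l i k).
Proof.
move=> Di _ B mB; rewrite setTI; apply: sub_gen_smallest.
exists (fun=> setT), (fun j => if j == (l, i, k) then B else setT), [:: (l, i, k)]; split => //.
- by move=> j; rewrite inE => /negbTE ->.
- apply/seteqP; split => w.
    by move=> wB; split => // j _; case: eqVneq => // ->.
  by move=> [_ /(_ (l, i, k) Di)]; rewrite eqxx.
Qed.

Definition env_law l i (B : set nat) (w : T) : R := fine (p (env xi l i w) B).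

Lemma env_law_ge0 l i B w : 0 <= env_law l i B w.
Proof. exact: fine_ge0. Qed.

Lemma mfun_env_law (G : set (set T)) l i B :
  mfun_of G (xi i) -> mfun_of G (env_law l i B).
Proof.
move=> mxi; apply: measurableT_comp => //.
apply: (@measurableT_comp _ _ _ _ _ _ (fun e => p e B)).
  exact: measurable_kernel.
rewrite /env /component; case: (l == proc1).
  exact: (measurableT_comp measurable_fst mxi).
exact: (measurableT_comp measurable_snd mxi).
Qed.

Lemma quenched_seq (A : set T) (s : seq ('I_2 * nat * nat)) (B : 'I_2 * nat * nat -> set nat) :
  uniq s -> generated_sigma xi A ->
  P (A `&` \bigcap_(j in [set j | j \in s]) (Xj j @^-1` B j)) =
  (\int[P]_(w in A) (\prod_(j <- s) env_law j.1.1 j.1.2 (B j) w)%:E)%E.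
Proof.
move=> us GA; have [_ /(_ A GA)] := X_law (seq_fset tt s) B.
have -> : [set` seq_fset tt s] = [set j | j \in s].
  by apply: eq_set => j; rewrite seq_fsetE.
move=> ->; apply: eq_integral => w _; congr EFin.
by rewrite (perm_big _ (seq_fset_perm tt s)) undup_id.
Qed.

Lemma env_independent_seq (s : seq nat) (B : nat -> set (R * R)) :
  uniq s -> (forall i, measurable (B i)) ->
  P [set w | forall i, i \in s -> B i (xi i w)] = (\prod_(i <- s) P (xi i @^-1` B i))%E.
Proof.
move=> us mB; have := xi_iid.1 (seq_fset tt s) B mB.
rewrite (perm_big _ (seq_fset_perm tt s)) undup_id// => <-.
have -> : [set` seq_fset tt s] = [set i | i \in s].
  by apply: eq_set => i; rewrite seq_fsetE.
by [].
Qed.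

Lemma env_eventsI D : setI_closed (env_events D).
Proof.
move=> _ _ [B mB ->] [C mC ->]; exists (fun i => B i `&` C i).
  by move=> i; exact: measurableI.
apply/seteqP; split => w; first by move=> [h1 h2] i Di; split; [exact: h1|exact: h2].
by move=> h; split => i Di; have [] := h i Di.
Qed.

Lemma env_eventsT D : env_events D setT.
Proof. by exists (fun=> setT) => //; apply/seteqP; split. Qed.

Lemma env_events_measurable D : env_events D `<=` measurable.
Proof. by move=> _ [B mB ->]; exact: measurable_env_event. Qed.

Lemma env_mfun_xi D i : D i -> mfun_of (env_events D) (xi i).
Proof.
move=> Di _ B mB; rewrite setTI; apply: sub_gen_smallest.
exists (fun k => if k == i then B else setT); first by move=> k; case: ifPn.
apply/seteqP; split => w; first by move=> wB k _; case: eqVneq => // ->.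
by move=> /(_ i Di); rewrite eqxx.
Qed.

Notation before n := (fun i => (i < n)%N).
Notation at_ n := (fun i => i == n).

Lemma env_indep_events n A C : env_events (before n) A -> env_events (at_ n) C ->
  (P (A `&` C) = P A * P C)%E.
Proof.
move=> [B mB ->] [B' mB' ->].
have EA : env_event (before n) B = [set w | forall i, i \in iota 0 n -> B i (xi i w)].
  by apply/seteqP; split => w h i; have := h i; rewrite mem_iota.
have EC : env_event (at_ n) B' = [set w | forall i, i \in [:: n] -> B' i (xi i w)].
  by apply/seteqP; split => w h i; have := h i; rewrite inE.
pose BB i := if (i < n)%N then B i else B' i.
have EAC : env_event (before n) B `&` env_event (at_ n) B' =
    [set w | forall i, i \in iota 0 n ++ [:: n] -> BB i (xi i w)].
  apply/seteqP; split => w.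
    move=> [h1 h2] i; rewrite mem_cat inE mem_iota/= add0n /BB => /orP[i_n|/eqP ->].
      by rewrite i_n; exact: h1.
    by rewrite ltnn; exact: h2.
  move=> h; split => i i_n; have := h i; rewrite mem_cat inE mem_iota/= add0n /BB.
    by rewrite i_n; exact.
  by rewrite (eqP i_n) eqxx orbT ltnn; exact.
rewrite EAC EA EC !env_independent_seq//.
- rewrite big_cat/=; congr (_ * _)%E.
    by apply: eq_big_seq => i; rewrite mem_iota/= add0n /BB => ->.
  by rewrite !big_seq1 /BB ltnn.
- exact: iota_uniq.
- by rewrite cat_uniq iota_uniq/= orbF andbT mem_iota/= add0n ltnn.
- by move=> i; rewrite /BB; case: ifPn.
Qed.

(** Given all the environments, the probability of a set of offspring
    constraints is a product of functions of the environments of the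
    generations involved; those of distinct generations are independent. *)
Lemma cylinder_indep_events n A C : past n A -> present n C ->
  (P (A `&` C) = P A * P C)%E.
Proof.
move=> [B [B' [L [mB BL ->]]]] [C1 [C' [L' [mC CL ->]]]].
pose s := undup [seq j <- L | (j.1.2 < n)%N].
pose s' := undup [seq j <- L' | j.1.2 == n].
pose BB j := if (j.1.2 < n)%N then B' j else C' j.
have sP j : j \in s -> (j.1.2 < n)%N by rewrite mem_undup mem_filter => /andP[].
have s'P j : j \in s' -> (j.1.2 < n)%N = false.
  by rewrite mem_undup mem_filter => /andP[/eqP -> _]; rewrite ltnn.
set A1 := env_event (before n) B; set A2 := env_event (at_ n) C1.
have EBB : offspring_event (before n) B' `&` offspring_event (at_ n) C' =
    \bigcap_(j in [set j | j \in s ++ s']) (Xj j @^-1` BB j).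
  rewrite (offspring_eventE _ BL) (offspring_eventE _ CL) -/s -/s'.
  apply/seteqP; split => w.
    move=> [h1 h2] j /=; rewrite mem_cat /BB => /orP[js|js].
      by rewrite sP//; exact: h1.
    by rewrite s'P//; exact: h2.
  move=> h; split => j js; have := h j; rewrite /= mem_cat js ?orbT /BB => /(_ isT).
    by rewrite sP.
  by rewrite s'P.
have us : uniq (s ++ s').
  rewrite cat_uniq !undup_uniq/= andbT; apply/hasPn => j /s'P jn.
  by apply/negP => /sP; rewrite jn.
have gA1 : generated_sigma xi A1 by exact: env_event_sigma.
have gA2 : generated_sigma xi A2 by exact: env_event_sigma.
have gA12 : generated_sigma xi (A1 `&` A2).
  pose G : measurableType _ := g_sigma_algebraType
    [set A | exists n (B : set (R * R)), measurable B /\ A = xi n @^-1` B].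
  exact: (@measurableI _ G).
have -> : A1 `&` offspring_event (before n) B' `&` (A2 `&` offspring_event (at_ n) C') =
    (A1 `&` A2) `&` \bigcap_(j in [set j | j \in s ++ s']) (Xj j @^-1` BB j).
  by rewrite -EBB setIACA.
rewrite (quenched_seq _ us gA12).
rewrite (offspring_eventE _ BL) (offspring_eventE _ CL) -/s -/s'.
rewrite (quenched_seq _ (undup_uniq _) gA1) (quenched_seq _ (undup_uniq _) gA2).
pose Y w : R := \1_A1 w * \prod_(j <- s) env_law j.1.1 j.1.2 (B' j) w.
pose H w : R := \1_A2 w * \prod_(j <- s') env_law j.1.1 j.1.2 (C' j) w.
have indE (D : set T) (f : T -> R) : (\int[P]_(w in D) (f w)%:E = \int[P]_w (\1_D w * f w)%:E)%E.
  rewrite integral_mkcond; apply: eq_integral => w _; rewrite patchE indicE.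
  by case: (w \in D); rewrite ?mul1r ?mul0r.
rewrite (indE (A1 `&` A2)) (indE A1) (indE A2).
transitivity (\int[P]_w (Y w * H w)%:E)%E.
  apply: eq_integral => w _; congr EFin; rewrite /Y /H mulrACA.
  congr (_ * _); first by rewrite !indicE in_setI; case: (_ \in _); case: (_ \in _); rewrite ?mulr1 ?mulr0.
  rewrite big_cat/=; congr (_ * _); apply: eq_big_seq => j js; rewrite /BB.
    by rewrite sP.
  by rewrite s'P.
apply: (@indep_integralM _ _ _ P (env_events (before n)) (env_events (at_ n))).
- exact: env_eventsI.
- exact: env_eventsI.
- exact: env_eventsT.
- exact: env_eventsT.
- exact: env_events_measurable.
- exact: env_events_measurable.
- exact: env_indep_events.
- apply: measurable_funM; first by apply: measurable_indic; apply: sub_gen_smallest; exists B.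
  apply: measurable_prod => j js; apply: mfun_env_law; apply: env_mfun_xi; exact: sP.
- apply: measurable_funM; first by apply: measurable_indic; apply: sub_gen_smallest; exists C1.
  apply: measurable_prod => j js; apply: mfun_env_law; apply: env_mfun_xi.
  by move: js; rewrite mem_undup mem_filter => /andP[].
- by move=> w; rewrite mulr_ge0// prodr_ge0// => j _; exact: env_law_ge0.
- by move=> w; rewrite mulr_ge0// prodr_ge0// => j _; exact: env_law_ge0.
Qed.

Lemma past_present_integralM n (Y H : T -> R) :
  mfun_of (past n) Y -> mfun_of (present n) H ->
  (forall w, 0 <= Y w) -> (forall w, 0 <= H w) ->
  (\int[P]_w (Y w * H w)%:E = \int[P]_w (Y w)%:E * \int[P]_w (H w)%:E)%E.
Proof.
apply: indep_integralM; [exact: cylinders_setI|exact: cylinders_setI|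
  exact: cylindersT|exact: cylindersT|exact: cylinders_measurable|
  exact: cylinders_measurable|exact: cylinder_indep_events].
Qed.

End Environments.

(** * Random sums and conditional means *)

Section NatValued.
Context {d : measure_display} {S : measurableType d} {R : realType}.

Lemma measurable_nat_preimage (Z : S -> nat) (B : set nat) :
  measurable_fun setT Z -> measurable (Z @^-1` B).
Proof. by move=> mZ; rewrite -[X in measurable X]setTI; exact: mZ. Qed.

Lemma measurable_to_nat (Z : S -> nat) :
  (forall z, measurable (Z @^-1` [set z])) -> measurable_fun setT Z.
Proof.
move=> mZ _ B _; rewrite setTI.
have -> : Z @^-1` B = \bigcup_(z in B) (Z @^-1` [set z]).
  apply/seteqP; split => w; first by move=> Bw; exists (Z w).
  by move=> [z Bz /= ->].
by apply: bigcup_measurable => z _.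
Qed.

Lemma measurable_random_sum (Z : S -> nat) (h : nat -> S -> nat) :
  measurable_fun setT Z -> (forall i, measurable_fun setT (h i)) ->
  measurable_fun setT (fun w => (\sum_(i < Z w) h i w)%N).
Proof.
move=> mZ mh.
have mh' z : measurable_fun setT (fun w => (\sum_(i < z) h i w)%N).
  elim: z => [|z IH].
    by under eq_fun do rewrite big_ord0; exact: measurable_cst.
  under eq_fun do rewrite big_ord_recr/=.
  apply: measurable_to_nat => y.
  have -> : (fun w => (\sum_(i < z) h i w + h z w)%N) @^-1` [set y] =
      \bigcup_u (((fun w => (\sum_(i < z) h i w)%N) @^-1` [set u]) `&`
                 (h z @^-1` [set v | (u + v)%N = y])).
    apply/seteqP; split => w; first by move=> /= <-; exists (\sum_(i < z) h i w)%N.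
    by move=> [u _ [/= -> ]].
  apply: bigcupT_measurable => u; apply: measurableI; exact: measurable_nat_preimage.
apply: measurable_to_nat => y.
have -> : (fun w => (\sum_(i < Z w) h i w)%N) @^-1` [set y] =
    \bigcup_z ((Z @^-1` [set z]) `&` ((fun w => (\sum_(i < z) h i w)%N) @^-1` [set y])).
  apply/seteqP; split => w; first by move=> /= <-; exists (Z w).
  by move=> [z _ [/= -> ]].
by apply: bigcupT_measurable => z; apply: measurableI; exact: measurable_nat_preimage.
Qed.

(** Splitting along the values of an integer variable reduces random sums to
    sums of a fixed length. *)
Lemma ge0_integral_partition (mu : {measure set S -> \bar R}) (Z : S -> nat) (F : S -> R) :
  measurable_fun setT Z -> measurable_fun setT F -> (forall w, 0 <= F w) ->
  (\int[mu]_w (F w)%:E = \sum_(0 <= z <oo) \int[mu]_w ((Z w == z)%:R * F w)%:E)%E.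
Proof.
move=> mZ mF F0.
rewrite -integral_nneseries//; last 2 first.
- move=> z; apply/measurable_EFinP; apply: measurable_funM => //.
  exact: (@measurableT_comp _ _ _ _ _ _ (fun u : nat => ((u == z)%:R : R)) _ Z).
- by move=> z w _; rewrite lee_fin mulr_ge0.
apply: eq_integral => w _.
rewrite (@nneseriesD1 _ _ (Z w) xpredT)//; last by move=> z _; rewrite lee_fin mulr_ge0.
rewrite eqxx mul1r eseries0 ?adde0// => z _ /= /negbTE zZ.
by rewrite eq_sym zZ mul0r.
Qed.

End NatValued.

Section LawMean.
Context {R : realType}.
Variable p : R.-pker R ~> nat.

Definition law_mean (f : nat -> R) (e : R) : \bar R :=
  (\sum_(0 <= k <oo) (f k * fine (p e [set k]))%:E)%E.

Lemma law_fin (e : R) (B : set nat) : p e B \is a fin_num.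
Proof.
rewrite ge0_fin_numE//; apply: (@le_lt_trans _ _ (p e setT)).
  by apply: le_measure; rewrite ?inE.
by rewrite prob_kernel ltry.
Qed.

Lemma measurable_law_prob (B : set nat) : measurable_fun setT (fun e => fine (p e B)).
Proof. by apply: measurableT_comp => //; exact: measurable_kernel. Qed.

Lemma measurable_law_mean (f : nat -> R) : (forall k, 0 <= f k) ->
  measurable_fun setT (law_mean f).
Proof.
move=> f0; apply: (@ge0_emeasurable_sum _ _ _ _ _ xpredT).
  by move=> k e _ _; rewrite lee_fin mulr_ge0// fine_ge0.
move=> k _; apply/measurable_EFinP; apply: measurable_funM => //.
exact: measurable_law_prob.
Qed.

Lemma law_mean_ge0 (f : nat -> R) (e : R) : (forall k, 0 <= f k) -> (0 <= law_mean f e)%E.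
Proof. by move=> f0; apply: nneseries_ge0 => k _ _; rewrite lee_fin mulr_ge0// fine_ge0. Qed.

Lemma law_mean_cst (c : R) (e : R) : 0 <= c -> law_mean (fun=> c) e = c%:E.
Proof.
move=> c0; rewrite /law_mean; under eq_eseriesr do rewrite EFinM fineK ?law_fin//.
rewrite nneseriesZl; last by move=> k _; exact: measure_ge0.
have <- : p e setT = (\sum_(0 <= k <oo) p e [set k])%E.
  have -> : [set: nat] = \bigcup_k [set k].
    by apply/seteqP; split => k //= _; exists k.
  rewrite measure_bigcup//=; last by move=> i j _ _ [x [/= -> ->]].
  by apply: eq_eseriesl => k; rewrite in_setT.
by rewrite prob_kernel mule1.
Qed.

Lemma le_law_mean (f g : nat -> R) (e : R) : (forall k, 0 <= f k) ->
  (forall k, f k * fine (p e [set k]) <= g k * fine (p e [set k])) ->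
  (law_mean f e <= law_mean g e)%E.
Proof.
move=> f0 fg; apply: lee_nneseries => k _; first by rewrite lee_fin mulr_ge0// fine_ge0.
by rewrite lee_fin fg.
Qed.

Lemma law_meanD (f g : nat -> R) (e : R) : (forall k, 0 <= f k) -> (forall k, 0 <= g k) ->
  law_mean (fun k => f k + g k) e = (law_mean f e + law_mean g e)%E.
Proof.
move=> f0 g0; rewrite -nneseriesD; [|by move=> k _ _; rewrite lee_fin mulr_ge0// fine_ge0..].
by apply: eq_eseriesr => k _; rewrite mulrDl EFinD.
Qed.

Lemma law_meanZ (c : R) (f : nat -> R) (e : R) : 0 <= c -> (forall k, 0 <= f k) ->
  law_mean (fun k => c * f k) e = (c%:E * law_mean f e)%E.
Proof.
move=> c0 f0; rewrite -nneseriesZl; last by move=> k _; rewrite lee_fin mulr_ge0// fine_ge0.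
by apply: eq_eseriesr => k _; rewrite -mulrA EFinM.
Qed.

End LawMean.

Section OneGeneration.
Context {d : measure_display} {T : measurableType d} {R : realType}.
Variable P : probability T R.
Variable xi : nat -> {RV P >-> (R * R)%type}.
Variable p : R.-pker R ~> nat.
Variable X : 'I_2 -> nat -> nat -> {RV P >-> nat}.
Hypothesis xi_iid : iid xi.
Hypothesis X_law : quenched_offspring xi p X.
Variable l : 'I_2.

Lemma measurable_component : measurable_fun setT (@component R l).
Proof.
rewrite /component; case: (l == proc1); [exact: measurable_fst|exact: measurable_snd].
Qed.

Lemma measurable_env n : measurable_fun setT (env xi l n).
Proof. exact: (measurableT_comp measurable_component). Qed.

Lemma env_preimage_sigma n (B : set R) : measurable B ->
  generated_sigma xi (env xi l n @^-1` B).
Proof.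
move=> mB; apply: sub_gen_smallest; exists n, (@component R l @^-1` B); split => //.
by rewrite -[X in measurable X]setTI; exact: measurable_component.
Qed.

Lemma measurable_env_law n B : measurable_fun setT (env_law xi p l n B).
Proof. exact: (measurableT_comp (measurable_law_prob p B) (measurable_env n)). Qed.

Let measurable_env_mean n (f : nat -> R) : (forall k, 0 <= f k) ->
  measurable_fun setT (fun w => law_mean p f (env xi l n w)).
Proof. by move=> f0; apply: measurableT_comp (measurable_law_mean p f0) (measurable_env n). Qed.

(** From point probabilities of [X] to conditional means of functions of [X]:
    sum over the values and apply monotone convergence. *)
Let quenched_sum n i (D C : set T) (q : T -> R) (f : nat -> R) :
  measurable D -> measurable C -> measurable_fun setT q -> (forall w, 0 <= q w) ->
  (forall k, 0 <= f k) ->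
  (forall k, P (D `&` C `&` X l n i @^-1` [set k]) =
    \int[P]_(w in D) (q w * env_law xi p l n [set k] w)%:E)%E ->
  (\int[P]_(w in D) (\1_C w * f (X l n i w))%:E =
   \int[P]_(w in D) ((q w)%:E * law_mean p f (env xi l n w)))%E.
Proof.
move=> mD mC mq q0 f0 h.
have mX k : measurable (X l n i @^-1` [set k]) by exact: measurable_funPTI.
transitivity (\int[P]_(w in D) \sum_(0 <= k <oo)
    ((f k)%:E * (\1_(C `&` X l n i @^-1` [set k]) w)%:E))%E.
  apply: eq_integral => w _.
  rewrite (@nneseriesD1 _ _ (X l n i w) xpredT)//; last first.
    by move=> k _; rewrite mule_ge0 ?lee_fin.
  rewrite eseries0 ?adde0; last first.
    move=> k _ /= /eqP kX; rewrite indicE in_setI (_ : (w \in X l n i @^-1` [set k]) = false).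
      by rewrite andbF mule0.
    by apply/memNset => /= Xk; apply: kX.
  rewrite -EFinM mulrC !indicE in_setI (_ : (w \in X l n i @^-1` [set X l n i w]) = true).
    by rewrite andbT.
  by apply/mem_set.
rewrite integral_nneseries//; last 2 first.
- move=> k; apply/measurable_funTS/measurable_EFinP; apply: measurable_funM => //.
  by apply: measurable_indic; exact: measurableI.
- by move=> k w _; rewrite mule_ge0 ?lee_fin.
transitivity (\sum_(0 <= k <oo) \int[P]_(w in D)
    ((q w)%:E * (f k * env_law xi p l n [set k] w)%:E))%E.
  apply: eq_eseriesr => k _; rewrite ge0_integralZl//.
  - rewrite integral_indic//; last exact: measurableI.
    rewrite [X in (_ * X)%E](_ : _ =
      \int[P]_(w in D) (q w * env_law xi p l n [set k] w)%:E)%E; last first.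
      by rewrite -h; congr (P _); rewrite setIC setIA.
    rewrite -ge0_integralZl//.
    + by apply: eq_integral => w _; rewrite -!EFinM; congr EFin; ring.
    + apply/measurable_funTS/measurable_EFinP; apply: measurable_funM => //.
      exact: measurable_env_law.
    + by move=> w _; rewrite lee_fin mulr_ge0// env_law_ge0.
    + by rewrite lee_fin.
  - by apply/measurable_funTS/measurable_EFinP; apply: measurable_indic; exact: measurableI.
  - by rewrite lee_fin.
rewrite -integral_nneseries//; last 2 first.
- move=> k; apply/measurable_funTS; apply: emeasurable_funM; apply/measurable_EFinP => //.
  by apply: measurable_funM => //; exact: measurable_env_law.
- by move=> k w _; rewrite mule_ge0 ?lee_fin ?mulr_ge0 ?env_law_ge0.
apply: eq_integral => w _; rewrite nneseriesZl// => k _.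
by rewrite lee_fin mulr_ge0// env_law_ge0.
Qed.

Let quenched_one n i (D : set T) k : generated_sigma xi D ->
  (P (D `&` X l n i @^-1` [set k]) =
    \int[P]_(w in D) (env_law xi p l n [set k] w)%:E)%E.
Proof.
move=> GD.
have := quenched_seq X_law (fun=> [set k]) (s := [:: (l, n, i)]) isT GD.
have -> : \bigcap_(j in [set j | j \in [:: (l, n, i)]]) (X j.1.1 j.1.2 j.2 @^-1` [set k])
   = X l n i @^-1` [set k].
  apply/seteqP; split => w; first by move=> /(_ (l, n, i)); apply; rewrite /= inE.
  by move=> h j; rewrite /= inE => /eqP ->.
by move=> ->; apply: eq_integral => w _; rewrite big_seq1.
Qed.

Let quenched_two n i i' (D : set T) k k' : i != i' -> generated_sigma xi D ->
  (P (D `&` X l n i' @^-1` [set k'] `&` X l n i @^-1` [set k]) =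
    \int[P]_(w in D) (env_law xi p l n [set k'] w * env_law xi p l n [set k] w)%:E)%E.
Proof.
move=> ii GD; have ii' : (i' == i) = false by rewrite eq_sym; exact/negbTE.
have us : uniq [:: (l, n, i'); (l, n, i)].
  by rewrite /= inE andbT; apply/eqP => -[/eqP]; rewrite ii'.
have := quenched_seq X_law (fun j => if j.2 == i then [set k] else [set k']) us GD.
have -> : \bigcap_(j in [set j | j \in [:: (l, n, i'); (l, n, i)]])
    (X j.1.1 j.1.2 j.2 @^-1` (if j.2 == i then [set k] else [set k']))
   = X l n i' @^-1` [set k'] `&` X l n i @^-1` [set k].
  apply/seteqP; split => w.
    move=> h; split; [have := h (l, n, i')|have := h (l, n, i)]; rewrite /= !inE eqxx ?orbT.
      by rewrite ii'; exact.
    by rewrite eqxx; exact.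
  move=> [h h'] j; rewrite /= !inE => /orP[|] /eqP -> /=.
    by rewrite ii'.
  by rewrite eqxx.
by rewrite setIA => ->; apply: eq_integral => w _; rewrite big_cons big_seq1/= eqxx ii'.
Qed.

Lemma generated_sigma_measurable : generated_sigma xi `<=` measurable.
Proof.
apply: smallest_sub; first exact: sigma_algebra_measurable.
by move=> _ [n [B [mB ->]]]; exact: measurable_funPTI.
Qed.

Let mfX n i (f : nat -> R) : measurable_fun setT (fun w => f (X l n i w)).
Proof. exact: (@measurableT_comp _ _ _ _ _ _ f _ (X l n i)). Qed.

Lemma quenched_mean n i (g : R -> R) (f : nat -> R) :
  measurable_fun setT g -> (forall e, 0 <= g e) -> (forall k, 0 <= f k) ->
  (\int[P]_w (g (env xi l n w) * f (X l n i w))%:E =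
   \int[P]_w ((g (env xi l n w))%:E * law_mean p f (env xi l n w)))%E.
Proof.
move=> mg g0 f0.
under eq_integral do rewrite EFinM.
apply: (@ge0_integral_weight _ _ _ _ _ _ (env xi l n)
  (fun w => (f (X l n i w))%:E) (fun w => law_mean p f (env xi l n w)) (fun e => (g e)%:E)).
- exact: measurable_env.
- by apply/measurable_EFinP; exact: mfX.
- exact: measurable_env_mean.
- exact/measurable_EFinP.
- by move=> w; rewrite lee_fin.
- by move=> w; exact: law_mean_ge0.
- by move=> w; rewrite lee_fin.
move=> B mB; set D := _ @^-1` B.
have GD : generated_sigma xi D by exact: env_preimage_sigma.
have mD := generated_sigma_measurable GD.
transitivity (\int[P]_(w in D) (\1_setT w * f (X l n i w))%:E)%E.
  by apply: eq_integral => w _; rewrite indicT mul1r.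
rewrite (@quenched_sum n i D setT (cst 1))//.
  by apply: eq_integral => w _; rewrite mul1e.
by move=> k; rewrite setIT quenched_one//; apply: eq_integral => w _; rewrite mul1r.
Qed.

(** Two individuals of one generation are conditionally independent. The
    value of the second one is frozen first, which reduces the claim to
    [quenched_sum] with its point probabilities as weights. *)
Lemma quenched_mean2 n i i' (g : R -> R) (f : nat -> R) : i != i' ->
  measurable_fun setT g -> (forall e, 0 <= g e) -> (forall k, 0 <= f k) ->
  (forall e, law_mean p f e \is a fin_num) ->
  (\int[P]_w (g (env xi l n w) * (f (X l n i w) * f (X l n i' w)))%:E =
   \int[P]_w ((g (env xi l n w))%:E *
     (law_mean p f (env xi l n w) * law_mean p f (env xi l n w))))%E.
Proof.
move=> ii mg g0 f0 f_fin.
under eq_integral do rewrite EFinM.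
have mm := measurable_env_mean n f0.
apply: (@ge0_integral_weight _ _ _ _ _ _ (env xi l n)
  (fun w => (f (X l n i w) * f (X l n i' w))%:E)
  (fun w => law_mean p f (env xi l n w) * law_mean p f (env xi l n w))%E (fun e => (g e)%:E)).
- exact: measurable_env.
- by apply/measurable_EFinP; apply: measurable_funM; exact: mfX.
- exact: emeasurable_funM.
- exact/measurable_EFinP.
- by move=> w; rewrite lee_fin mulr_ge0.
- by move=> w; rewrite mule_ge0// law_mean_ge0.
- by move=> w; rewrite lee_fin.
move=> B mB; set D := _ @^-1` B.
have GD : generated_sigma xi D by exact: env_preimage_sigma.
have mD := generated_sigma_measurable GD.
pose F w := (\1_D w * (f (X l n i w) * f (X l n i' w))).
have mF : measurable_fun setT F.
  by apply: measurable_funM; [exact: measurable_indic|apply: measurable_funM; exact: mfX].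
have F0 w : 0 <= F w by rewrite !mulr_ge0.
transitivity (\int[P]_w (F w)%:E)%E.
  rewrite integral_mkcond; apply: eq_integral => w _; rewrite patchE /F indicE.
  by case: (w \in D); rewrite ?mul1r ?mul0r.
rewrite (ge0_integral_partition P (Z := X l n i'))//.
transitivity (\sum_(0 <= k' <oo) \int[P]_(w in D)
    ((f k' * env_law xi p l n [set k'] w)%:E * law_mean p f (env xi l n w)))%E.
  apply: eq_eseriesr => k' _.
  transitivity (\int[P]_(w in D) (\1_(X l n i' @^-1` [set k']) w * (f k' * f (X l n i w)))%:E)%E.
    rewrite [RHS]integral_mkcond; apply: eq_integral => w _; rewrite patchE /F !indicE.
    case: (w \in D); last by rewrite mul0r mulr0.
    case: eqVneq => [Xk|Xk].
      by rewrite (mem_set (A := _ @^-1` _))//= !mul1r -Xk mulrC.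
    by rewrite (memNset (A := _ @^-1` _)) ?mul0r// => /= h; move: Xk; rewrite h eqxx.
  rewrite (@quenched_sum n i D (X l n i' @^-1` [set k']) (env_law xi p l n [set k'])
     (fun k => f k' * f k))//.
  - by apply: eq_integral => w _; rewrite law_meanZ// muleA -EFinM mulrC.
  - exact: measurable_funPTI.
  - exact: measurable_env_law.
  - by move=> w; exact: env_law_ge0.
  - by move=> k; rewrite mulr_ge0.
  - by move=> k; exact: quenched_two.
rewrite -integral_nneseries//; last 2 first.
- move=> k'; apply/measurable_funTS; apply: emeasurable_funM => //; apply/measurable_EFinP.
  by apply: measurable_funM => //; exact: measurable_env_law.
- by move=> k' w _; rewrite mule_ge0 ?law_mean_ge0// lee_fin mulr_ge0 ?env_law_ge0.
apply: eq_integral => w _.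
under eq_eseriesr do rewrite muleC -(fineK (f_fin _)).
rewrite nneseriesZl ?fineK// => k _.
by rewrite lee_fin mulr_ge0// env_law_ge0.
Qed.

Lemma env_law_invariant n (G : R * R -> \bar R) : measurable_fun setT G ->
  (forall e, 0 <= G e)%E -> (\int[P]_w G (xi n w) = \int[P]_w G (xi 0 w))%E.
Proof.
move=> mG G0.
rewrite -(ge0_integral_distribution (xi n) mG G0) -(ge0_integral_distribution (xi 0) mG G0).
by apply: eq_measure_integral => B mB _; rewrite /= /distribution /pushforward/= xi_iid.2.
Qed.

Lemma env_invariant n (G : R -> \bar R) : measurable_fun setT G ->
  (forall e, 0 <= G e)%E -> (\int[P]_w G (env xi l n w) = \int[P]_w G (env xi l 0 w))%E.
Proof.
move=> mG G0; rewrite /env.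
rewrite -[LHS]/(\int[P]_w (G \o @component R l) (xi n w))%E env_law_invariant//.
  exact: (measurableT_comp mG measurable_component).
by move=> e; exact: G0.
Qed.

End OneGeneration.

(** * One-step recursions for random sums *)

Section RandomSums.
Context {d : measure_display} {T : measurableType d} {R : realType}.
Variable P : probability T R.
Variable xi : nat -> {RV P >-> (R * R)%type}.
Variable p : R.-pker R ~> nat.
Variable X : 'I_2 -> nat -> nat -> {RV P >-> nat}.
Hypothesis xi_iid : iid xi.
Hypothesis X_law : quenched_offspring xi p X.
Variable l : 'I_2.
Variable n : nat.
Variables (Y : T -> R) (Zt : T -> nat).
Hypotheses (mY : mfun_of (past xi X n) Y) (mZ : mfun_of (past xi X n) Zt).
Hypothesis Y0 : forall w, 0 <= Y w.
Variables (g : R -> R) (f : nat -> R).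
Hypotheses (mg : measurable_fun setT g) (g0 : forall e, 0 <= g e).
Hypothesis f0 : forall k, 0 <= f k.

Notation G w := (g (env xi l n w)).
Notation F i w := (f (X l n i w)).

Let past_sub : past xi X n `<=` measurable := @cylinders_measurable _ _ _ P xi X _.
Let mY' : measurable_fun setT Y := mfun_of_measurable past_sub mY.
Let mZ' : measurable_fun setT Zt := mfun_of_measurable past_sub mZ.

Let Yz z w : R := (Zt w == z)%:R * Y w.

Let mYz z : mfun_of (past xi X n) (Yz z).
Proof.
apply: measurable_funM => //.
exact: (@measurableT_comp _ _ _ _ _ _ (fun u : nat => ((u == z)%:R : R)) _ _ _ mZ).
Qed.

Let Yz0 z w : 0 <= Yz z w. Proof. by rewrite /Yz mulr_ge0. Qed.

Let mYz' z : measurable_fun setT (Yz z) := mfun_of_measurable past_sub (mYz z).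

Let mG_present : mfun_of (present xi X n) (fun w => G w).
Proof.
apply: (measurableT_comp mg); apply: (measurableT_comp (@measurable_component R l)).
by apply: mfun_xi => /=; rewrite eqxx.
Qed.

Let mF_present i : mfun_of (present xi X n) (fun w => F i w).
Proof.
apply: (@measurableT_comp _ _ _ _ _ _ f); first by [].
by apply: mfun_X => /=; rewrite eqxx.
Qed.

Let present_sub : present xi X n `<=` measurable := @cylinders_measurable _ _ _ P xi X _.
Let mG' : measurable_fun setT (fun w => G w) := mfun_of_measurable present_sub mG_present.
Let mF' i : measurable_fun setT (fun w => F i w) := mfun_of_measurable present_sub (mF_present i).

Let m_of_Z (h : nat -> R) : measurable_fun setT (fun w => h (Zt w)).
Proof. exact: (@measurableT_comp _ _ _ _ _ _ h). Qed.

Let measurable_sumF (h : R -> R) : measurable_fun setT h ->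
  measurable_fun setT (fun w => h (\sum_(i < Zt w) f (X l n i w))).
Proof.
move=> mh _ B mB; rewrite setTI.
have -> : (fun w => h (\sum_(i < Zt w) f (X l n i w))) @^-1` B =
    \bigcup_z ((Zt @^-1` [set z]) `&` ((fun w => h (\sum_(i < z) f (X l n i w))) @^-1` B)).
  apply/seteqP; split => w; first by move=> /= hB; exists (Zt w).
  by move=> [z _ [/= -> ]].
apply: bigcupT_measurable => z; apply: measurableI; first exact: measurable_nat_preimage.
rewrite -[X in measurable X]setTI; apply: (measurableT_comp mh) => //.
exact: measurable_sum.
Qed.

Let sum_ge0 (z : nat) w : 0 <= \sum_(i < z) f (X l n i w).
Proof. by apply: sumr_ge0. Qed.

(** On the event that [Zt] takes a given value the sum has a fixed length, and
    the past factors out of each of its terms. *)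
Lemma integral_random_sum (c : R) : 0 <= c ->
  (forall i, \int[P]_w (G w * F i w)%:E = c%:E)%E ->
  (\int[P]_w (Y w * (G w * \sum_(i < Zt w) F i w))%:E =
   c%:E * \int[P]_w (Y w * (Zt w)%:R)%:E)%E.
Proof.
move=> c0 hc.
have mS : measurable_fun setT (fun w => \sum_(i < Zt w) f (X l n i w)).
  by apply: (measurable_sumF (h := id)); exact: measurable_id.
rewrite (ge0_integral_partition P (Z := Zt))//; last 2 first.
- by apply: measurable_funM => //; apply: measurable_funM.
- by move=> w; rewrite !mulr_ge0.
rewrite [in RHS](ge0_integral_partition P (Z := Zt))//; last 2 first.
- by apply: measurable_funM => //; exact: (m_of_Z (fun u => u%:R)).
- by move=> w; rewrite mulr_ge0.
rewrite -nneseriesZl; last first.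
  by move=> z _; apply: integral_ge0 => w _; rewrite lee_fin !mulr_ge0.
apply: eq_eseriesr => z _.
transitivity (\int[P]_w (\sum_(i < z) (Yz z w * (G w * F i w))%:E))%E.
  apply: eq_integral => w _; rewrite sumEFin; congr EFin; rewrite -mulr_sumr -mulr_sumr.
  by rewrite /Yz; case: eqVneq => [->|_]; rewrite ?mul1r// !mul0r.
rewrite ge0_integral_sum//; last 2 first.
- move=> i; apply/measurable_EFinP; apply: measurable_funM => //.
  by apply: measurable_funM.
- by move=> i w _; rewrite lee_fin !mulr_ge0.
transitivity (\sum_(i < z) (\int[P]_w (Yz z w)%:E * c%:E))%E.
  apply: eq_bigr => i _.
  rewrite (past_present_integralM xi_iid X_law (n := n))//.
  - by rewrite hc.
  - by apply: measurable_funM; [exact: mG_present|exact: mF_present].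
  - by move=> w; rewrite mulr_ge0.
have -> : (\int[P]_w ((Zt w == z)%:R * (Y w * (Zt w)%:R))%:E =
    z%:R%:E * \int[P]_w (Yz z w)%:E)%E.
  rewrite -ge0_integralZl//.
  - apply: eq_integral => w _; rewrite -EFinM; congr EFin; rewrite /Yz.
    by case: eqVneq => [->|_]; rewrite ?mul1r ?mul0r ?mulr0// mulrC.
  - exact/measurable_EFinP.
  - by move=> w _; rewrite lee_fin.
have -> : z%:R%:E = (\sum_(i < z) 1%:E)%E :> \bar R.
  by rewrite sumEFin sumr_const card_ord.
have I0 : (0 <= \int[P]_w (Yz z w)%:E)%E by apply: integral_ge0 => w _; rewrite lee_fin.
rewrite ge0_sume_distrl; last by move=> i _; rewrite lee_fin.
rewrite ge0_sume_distrr; last by move=> i _; rewrite mul1e.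
by apply: eq_bigr => i _; rewrite mul1e muleC.
Qed.

(** The square of a sum of [z] terms has [z] diagonal terms and at most
    [z ^+ 2] cross terms. *)
Lemma le_integral_random_sum_sqr (c1 c2 : R) : 0 <= c1 -> 0 <= c2 ->
  (forall i i', i != i' -> \int[P]_w (G w * (F i w * F i' w))%:E <= c1%:E)%E ->
  (forall i, \int[P]_w (G w * (F i w * F i w))%:E <= c2%:E)%E ->
  (\int[P]_w (Y w * (G w * (\sum_(i < Zt w) F i w) ^+ 2))%:E <=
   \int[P]_w (Y w * (c1 * (Zt w)%:R ^+ 2 + c2 * (Zt w)%:R))%:E)%E.
Proof.
move=> c10 c20 h1 h2.
have mS : measurable_fun setT (fun w => (\sum_(i < Zt w) f (X l n i w)) ^+ 2).
  by apply: (measurable_sumF (h := fun x => x ^+ 2)); exact: measurable_funX.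
rewrite (ge0_integral_partition P (Z := Zt))//; last 2 first.
- by apply: measurable_funM => //; apply: measurable_funM.
- by move=> w; rewrite !mulr_ge0// sqr_ge0.
rewrite [leRHS](ge0_integral_partition P (Z := Zt))//; last 2 first.
- apply: measurable_funM => //; exact: (m_of_Z (fun u => c1 * u%:R ^+ 2 + c2 * u%:R)).
- by move=> w; rewrite mulr_ge0// addr_ge0// mulr_ge0// sqr_ge0.
apply: lee_nneseries => z _.
  by move=> _; apply: integral_ge0 => w _; rewrite lee_fin !mulr_ge0// sqr_ge0.
pose K : R := c1 * z%:R ^+ 2 + c2 * z%:R.
have -> : (\int[P]_w ((Zt w == z)%:R * (Y w * (c1 * (Zt w)%:R ^+ 2 + c2 * (Zt w)%:R)))%:E =
    \int[P]_w (Yz z w)%:E * K%:E)%E.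
  rewrite -ge0_integralZr//.
  - apply: eq_integral => w _; rewrite -EFinM; congr EFin; rewrite /Yz /K.
    by case: eqVneq => [->|_]; rewrite ?mul1r ?mul0r.
  - exact/measurable_EFinP.
  - by move=> w _; rewrite lee_fin.
  - by rewrite lee_fin addr_ge0// mulr_ge0// sqr_ge0.
have -> : (\int[P]_w ((Zt w == z)%:R * (Y w * (G w * (\sum_(i < Zt w) F i w) ^+ 2)))%:E =
    \int[P]_w (Yz z w)%:E * \int[P]_w (G w * (\sum_(i < z) F i w) ^+ 2)%:E)%E.
  rewrite -(past_present_integralM xi_iid X_law (n := n))//.
  - apply: eq_integral => w _; congr EFin; rewrite /Yz.
    by case: eqVneq => [->|_]; rewrite ?mul1r ?mul0r.
  - apply: measurable_funM; first exact: mG_present.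
    apply: measurable_funX; apply: measurable_sum => i; exact: mF_present.
  - by move=> w; rewrite mulr_ge0// sqr_ge0.
apply: lee_pmul => //.
- by apply: integral_ge0 => w _; rewrite lee_fin.
- by apply: integral_ge0 => w _; rewrite lee_fin mulr_ge0// sqr_ge0.
have mGFF i i' : measurable_fun setT (fun w => (G w * (F i w * F i' w))%:E).
  by apply/measurable_EFinP; apply: measurable_funM => //; exact: measurable_funM.
have -> : (\int[P]_w (G w * (\sum_(i < z) F i w) ^+ 2)%:E =
    \sum_(i < z) \sum_(i' < z) \int[P]_w (G w * (F i w * F i' w))%:E)%E.
  have E1 (i : 'I_z) : (\sum_(i' < z) \int[P]_w (G w * (F i w * F i' w))%:E =
      \int[P]_w \sum_(i' < z) (G w * (F i w * F i' w))%:E)%E.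
    by rewrite ge0_integral_sum// => i' w _; rewrite lee_fin !mulr_ge0.
  under [RHS]eq_bigr => i _ do rewrite E1.
  rewrite -ge0_integral_sum//.
  - apply: eq_integral => w _.
    under [RHS]eq_bigr => i _ do rewrite sumEFin.
    rewrite sumEFin expr2 mulr_suml mulr_sumr; congr EFin; apply: eq_bigr => i _.
    by rewrite mulr_sumr mulr_sumr.
  - by move=> i; apply: emeasurable_sum.
  - by move=> i w _; apply: sume_ge0 => i' _; rewrite lee_fin !mulr_ge0.
apply: (@le_trans _ _ (\sum_(i < z) \sum_(i' < z) (c1 + (i == i')%:R * c2)%:E)%E).
  apply: lee_sum => i _; apply: lee_sum => i' _; case: eqVneq => [<-|ii].
    by rewrite mul1r (le_trans (h2 i))// lee_fin lerDr.
  by rewrite mul0r addr0; exact: h1.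
under eq_bigr => i _ do rewrite sumEFin.
rewrite sumEFin lee_fin /K.
have E (i : 'I_z) : \sum_(i' < z) (c1 + (i == i')%:R * c2) = c1 * z%:R + c2.
  rewrite big_split/= sumr_const card_ord mulr_natr; congr (_ + _).
  rewrite (bigD1 i)//= eqxx mul1r big1 ?addr0// => i' /negbTE ii.
  by rewrite eq_sym ii mul0r.
under eq_bigr => i _ do rewrite E.
by rewrite sumr_const card_ord -mulr_natr le_eqVlt; apply/orP; left; apply/eqP; ring.
Qed.

End RandomSums.

(** * Means and truncated means of the offspring laws *)

Section EnvironmentConstants.
Context {d : measure_display} {T : measurableType d} {R : realType}.
Variable P : probability T R.
Variable xi : nat -> {RV P >-> (R * R)%type}.
Variable p : R.-pker R ~> nat.
Hypothesis xi_iid : iid xi.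
Variable l : 'I_2.
Hypothesis m_finite : {ae P, forall w, (emean xi p l 0 w < +oo)%E}.
Hypothesis p0_eq0 : {ae P, forall w, p (env xi l 0 w) [set 0%N] = 0%E}.
Hypothesis var_pos : (0 < 'V_P[M xi p l 0])%E.

Definition offspring_mean (e : R) : R := fine (law_mean p (fun k => k%:R) e).

(** The maximum with one changes nothing for the laws without mass at zero,
    and makes the inverse bounded by one in every environment. *)
Definition trunc_mean (a : nat) (e : R) : R :=
  Num.max 1 (fine (law_mean p (fun k => (minn k a)%:R) e)).

Definition good_env (e : R) : Prop :=
  fine (p e [set 0%N]) = 0 /\ (law_mean p (fun k => k%:R) e < +oo)%E.

Lemma emean_law_mean n w : emean xi p l n w = law_mean p (fun k => k%:R) (env xi l n w).
Proof. by apply: eq_eseriesr => k _; rewrite EFinM fineK// law_fin. Qed.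

Lemma mean_offspring_mean n w : mean xi p l n w = offspring_mean (env xi l n w).
Proof. by rewrite /mean emean_law_mean. Qed.

Lemma measurable_offspring_mean : measurable_fun setT offspring_mean.
Proof. by apply: measurableT_comp => //; apply: measurable_law_mean. Qed.

Lemma measurable_trunc_mean a : measurable_fun setT (trunc_mean a).
Proof.
apply: measurable_maxr => //; apply: measurableT_comp => //.
exact: measurable_law_mean.
Qed.

Lemma good_env_measurable : measurable [set e | good_env e].
Proof.
have -> : [set e | good_env e] = ((fun e => fine (p e [set 0%N])) @^-1` [set 0]) `&`
    (law_mean p (fun k => k%:R) @^-1` [set x | (x < +oo)%E]).
  by apply/seteqP; split.
apply: measurableI.
  by rewrite -[X in measurable X]setTI; apply: measurable_law_prob.
rewrite -[X in measurable X]setTI.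
have mf : measurable_fun setT (law_mean p (fun k => k%:R)) by exact: measurable_law_mean.
exact: (measurable_lte measurableT mf (measurable_cst +oo%E)).
Qed.

Lemma ae_good_env n : {ae P, forall w, good_env (env xi l n w)}.
Proof.
have mB : measurable (~` [set e | good_env e]) by apply: measurableC; exact: good_env_measurable.
have mE k : measurable (env xi l k @^-1` (~` [set e | good_env e])).
  by rewrite -[X in measurable X]setTI; apply: measurable_env.
have bad0 : P (env xi l 0 @^-1` (~` [set e | good_env e])) = 0%E.
  apply: measure_negligible => //.
  have : {ae P, forall w, good_env (env xi l 0 w)}.
    apply: filterS2 m_finite p0_eq0 => w h h0; split; first by rewrite h0.
    by rewrite -emean_law_mean.
  by [].
exists (env xi l n @^-1` (~` [set e | good_env e])); split => //.
have comp_pre k B : env xi l k @^-1` B = xi k @^-1` (@component R l @^-1` B) by [].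
rewrite comp_pre xi_iid.2 -?comp_pre//.
rewrite -[X in measurable X]setTI; exact: measurable_component.
Qed.

Section Facts.
Variable e : R.

Lemma law_mean_trunc_le a : (law_mean p (fun k => (minn k a)%:R) e <= a%:R%:E)%E.
Proof.
rewrite -(law_mean_cst p e (ler0n R a)); apply: le_law_mean => // k.
by rewrite ler_wpM2r ?fine_ge0// ler_nat geq_minr.
Qed.

Lemma law_mean_trunc_fin a : law_mean p (fun k => (minn k a)%:R) e \is a fin_num.
Proof.
rewrite ge0_fin_numE; first by rewrite (le_lt_trans (law_mean_trunc_le a)) ?ltry.
exact: law_mean_ge0.
Qed.

Lemma trunc_mean_ge1 a : 1 <= trunc_mean a e.
Proof. by rewrite /trunc_mean le_max lexx. Qed.

Lemma trunc_mean_gt0 a : 0 < trunc_mean a e.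
Proof. exact: lt_le_trans (trunc_mean_ge1 a). Qed.

Hypothesis ge : good_env e.

Lemma law_mean_pos_ge1 (f : nat -> R) : (forall k, 0 <= f k) ->
  (forall k, (0 < k)%N -> 1 <= f k) -> (1%:E <= law_mean p f e)%E.
Proof.
move=> f0 f1; rewrite -(law_mean_cst p e ler01); apply: le_law_mean => // -[|k].
  by rewrite ge.1 !mulr0.
by rewrite ler_wpM2r ?fine_ge0// f1.
Qed.

Lemma offspring_mean_fin : law_mean p (fun k => k%:R) e \is a fin_num.
Proof. by rewrite ge0_fin_numE; [exact: ge.2|exact: law_mean_ge0]. Qed.

Lemma offspring_meanE : law_mean p (fun k => k%:R) e = (offspring_mean e)%:E.
Proof. by rewrite /offspring_mean fineK// offspring_mean_fin. Qed.

Lemma offspring_mean_ge1 : 1 <= offspring_mean e.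
Proof.
rewrite -lee_fin -offspring_meanE; apply: law_mean_pos_ge1 => // k k0.
by rewrite ler1n.
Qed.

Lemma trunc_meanE a : (0 < a)%N ->
  law_mean p (fun k => (minn k a)%:R) e = (trunc_mean a e)%:E.
Proof.
move=> a0; rewrite -(fineK (law_mean_trunc_fin a)); congr EFin.
rewrite /trunc_mean; apply/esym/max_idPr.
rewrite -lee_fin fineK ?law_mean_trunc_fin//; apply: law_mean_pos_ge1 => // k k0.
by rewrite ler1n leq_min k0.
Qed.

Lemma trunc_mean_le a a' : (0 < a)%N -> (a <= a')%N -> trunc_mean a e <= trunc_mean a' e.
Proof.
move=> a0 aa'; rewrite -lee_fin -!trunc_meanE// ?(leq_trans a0)//.
apply: le_law_mean => // k; rewrite ler_wpM2r ?fine_ge0// ler_nat.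
by rewrite leq_min geq_minl (leq_trans (geq_minr _ _)).
Qed.

Lemma trunc_mean2E : (trunc_mean 2 e)%:E = (1 + law_mean p (fun k => (1 < k)%N%:R) e)%E.
Proof.
rewrite -trunc_meanE// -(law_mean_cst p e ler01) -law_meanD//.
apply: eq_eseriesr => -[|k] _; first by rewrite ge.1 !mulr0.
rewrite (_ : minn k.+1 2 = (1 + (1 < k.+1))%N) ?natrD//.
by case: k => [|[|k]].
Qed.

Lemma mean_degenerate : law_mean p (fun k => (1 < k)%N%:R) e = 0%E -> offspring_mean e = 1.
Proof.
move=> h0.
have pk0 k : (1 < k)%N -> fine (p e [set k]) = 0.
  move=> k1; have : ((1 < k)%N%:R * fine (p e [set k]))%:E = 0%E :> \bar R.
    apply/eqP; rewrite eq_le; apply/andP; split; last by rewrite lee_fin mulr_ge0// fine_ge0.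
    rewrite -h0 /law_mean (@nneseriesD1 _ _ k xpredT)//.
    rewrite leeDl//; apply: nneseries_ge0 => i _ _.
    by rewrite lee_fin mulr_ge0// fine_ge0.
  by rewrite k1 mul1r => -[].
rewrite /offspring_mean -[RHS]/(fine 1%:E); congr fine.
rewrite -(law_mean_cst p e ler01); apply: eq_eseriesr => -[|[|k]] _.
- by rewrite ge.1 !mulr0.
- by [].
- by rewrite pk0// !mulr0.
Qed.

End Facts.

Lemma measurable_M n : measurable_fun setT (M xi p l n).
Proof.
have -> : M xi p l n = (fun e => ln (offspring_mean e)) \o env xi l n.
  by apply/funext => w; rewrite /M mean_offspring_mean.
apply: measurableT_comp (measurable_env xi l n).
by apply: measurableT_comp; [exact: measurable_ln|exact: measurable_offspring_mean].
Qed.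

(** Otherwise each individual has exactly one child, so the mean is one and
    [M] has no variance. *)
Lemma nondegenerate :
  ~ {ae P, forall w, law_mean p (fun k => (1 < k)%N%:R) (env xi l 0 w) = 0%E}.
Proof.
move=> h.
have M0 : ae_eq P setT (EFin \o M xi p l 0) (cst 0%E).
  apply: filterS2 h (ae_good_env 0) => w h1 gw _ /=.
  by rewrite /M mean_offspring_mean mean_degenerate// ln1.
have mM := measurable_M 0.
have EM : ('E_P[M xi p l 0] = 0)%E.
  rewrite unlock (ae_eq_integral (cst 0%E))// ?integral0//.
  exact/measurable_EFinP.
move: var_pos; rewrite /variance covariance.unlock EM expectation.unlock.
rewrite (ae_eq_integral (cst 0%E))//.
- by rewrite integral0 ltxx.
- by apply/measurable_EFinP; apply: measurable_funM; apply: measurable_funB.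
- apply: filterS M0 => w /(_ I) [Mw] _; congr EFin.
  by rewrite !fctE/= Mw subr0 mulr0.
Qed.

End EnvironmentConstants.

Section Comparisons.
Context {d : measure_display} {T : measurableType d} {R : realType}.
Implicit Types f g : T -> R.

Lemma measurable_lt_set f g : measurable_fun setT f -> measurable_fun setT g ->
  measurable [set w | f w < g w].
Proof.
move=> mf mg; rewrite -[X in measurable X]setTI.
exact: (measurable_fun_ltr mf mg measurableT).
Qed.

Lemma measurable_le_set f g : measurable_fun setT f -> measurable_fun setT g ->
  measurable [set w | f w <= g w].
Proof.
move=> mf mg; rewrite -[X in measurable X]setTI.
exact: (measurable_fun_ler mf mg measurableT).
Qed.

End Comparisons.

Section AlmostSure.
Context {d : measure_display} {T : measurableType d} {R : realType}.
Variable P : probability T R.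
Implicit Types f g : T -> R.

Lemma ae_le_integralE f g : measurable_fun setT f -> measurable_fun setT g ->
  (forall w, 0 <= f w) -> (forall w, 0 <= g w) -> {ae P, forall w, f w <= g w} ->
  (\int[P]_w (f w)%:E <= \int[P]_w (g w)%:E)%E.
Proof.
move=> mf mg f0 g0 fg; apply: ae_ge0_le_integral => //.
- by move=> w _; rewrite lee_fin.
- exact/measurable_EFinP.
- by move=> w _; rewrite lee_fin.
- exact/measurable_EFinP.
- by apply: filterS fg => w h _; rewrite lee_fin.
Qed.

Lemma ae_eq_integralE f g : measurable_fun setT f -> measurable_fun setT g ->
  {ae P, forall w, f w = g w} ->
  (\int[P]_w (f w)%:E = \int[P]_w (g w)%:E)%E.
Proof.
move=> mf mg fg; apply: ae_eq_integral => //.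
- exact/measurable_EFinP.
- exact/measurable_EFinP.
- by apply: filterS fg => w h _; rewrite h.
Qed.

Lemma integral_cstE (c : R) : (\int[P]_w c%:E = c%:E)%E.
Proof. by rewrite integral_cst//= probability_setT mule1. Qed.

Lemma integral_eq1_ae f : measurable_fun setT f -> (forall w, 0 <= f w <= 1) ->
  (\int[P]_w (f w)%:E = 1)%E -> {ae P, forall w, f w = 1}.
Proof.
move=> mf f01 If.
have m1f : measurable_fun setT (fun w => (1 - f w)%:E).
  by apply/measurable_EFinP; apply: measurable_funB.
have i1 : Pintegrable P f.
  apply: (@Pintegrable_bounded _ _ _ _ _ 1) => // w; have /andP[f0 f1] := f01 w.
  by rewrite ger0_norm.
have : (\int[P]_w `|(1 - f w)%:E| = 0)%E.
  under eq_integral => w _ do rewrite gee0_abs ?lee_fin ?subr_ge0 ?(andP (f01 w)).2// EFinB.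
  rewrite integralB//=.
  - by rewrite If integral_cstE subee.
  - exact: Pintegrable_cst.
move/(ae_eq_integral_abs P measurableT m1f); apply: filterS => w /(_ I) [] /eqP.
by rewrite subr_eq0 => /eqP.
Qed.

End AlmostSure.

Lemma measurable_inv_ge0 {d : measure_display} {T : measurableType d} {R : realType}
    (f : T -> R) : measurable_fun setT f -> (forall x, 0 <= f x) ->
  measurable_fun setT (fun x => (f x)^-1).
Proof.
move=> mf f0.
have -> : (fun x => (f x)^-1) = (fun x => if f x == 0 then 0 else expR (- ln (f x))).
  apply/funext => x; case: eqVneq => [->|fx0]; first by rewrite invr0.
  by rewrite expRN lnK// posrE lt_neqAle eq_sym fx0 f0.
apply: measurable_fun_ifT => //.
  exact: measurable_fun_eqr.
apply: measurableT_comp => //; apply: measurableT_comp => //.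
exact: (measurableT_comp (measurable_ln (R := R))).
Qed.

Section Growth.
Context {d : measure_display} {T : measurableType d} {R : realType}.
Variable P : probability T R.
Variable xi : nat -> {RV P >-> (R * R)%type}.
Variable p : R.-pker R ~> nat.
Variable X : 'I_2 -> nat -> nat -> {RV P >-> nat}.
Hypothesis xi_iid : iid xi.
Hypothesis X_law : quenched_offspring xi p X.
Variable l : 'I_2.
Hypothesis m_finite : {ae P, forall w, (emean xi p l 0 w < +oo)%E}.
Hypothesis p0_eq0 : {ae P, forall w, p (env xi l 0 w) [set 0%N] = 0%E}.
Hypothesis var_pos : (0 < 'V_P[M xi p l 0])%E.

Notation tm a n w := (trunc_mean p a (env xi l n w)).
Notation om n w := (offspring_mean p (env xi l n w)).
Notation Xt a n i w := ((minn (X l n i w) a)%:R : R).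

Let aeg n : {ae P, forall w, good_env p (env xi l n w)} :=
  ae_good_env xi_iid m_finite p0_eq0 n.

Lemma measurable_tm a n : measurable_fun setT (fun w => tm a n w).
Proof. exact: (measurableT_comp (measurable_trunc_mean p a) (measurable_env xi l n)). Qed.

Lemma measurable_offspring n i (f : nat -> R) : measurable_fun setT (fun w => f (X l n i w)).
Proof. exact: (@measurableT_comp _ _ _ _ _ _ f _ (X l n i)). Qed.

(** The factor by which one generation contracts the inverse of the
    conditional mean of the process truncated at two; higher truncations
    contract at least as much. *)
Definition inv_mean2 : R := fine (\int[P]_w ((tm 2 0 w)^-1)%:E).

Lemma measurable_inv_trunc a : measurable_fun setT (fun e => (trunc_mean p a e)^-1).
Proof.
apply: measurable_inv_ge0; first exact: measurable_trunc_mean.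
by move=> e; exact/ltW/trunc_mean_gt0.
Qed.

Lemma inv_trunc_itv a e : 0 <= (trunc_mean p a e)^-1 <= 1.
Proof.
by rewrite invr_ge0 ltW ?trunc_mean_gt0//= invf_le1 ?trunc_mean_ge1 ?trunc_mean_gt0.
Qed.

Lemma integral_inv_trunc2 n : (\int[P]_w ((tm 2 n w)^-1)%:E = inv_mean2%:E)%E.
Proof.
have mi : measurable_fun setT (fun e => ((trunc_mean p 2 e)^-1)%:E).
  by apply/measurable_EFinP; exact: measurable_inv_trunc.
rewrite (env_invariant xi_iid l n mi); last first.
  by move=> e; rewrite lee_fin; have /andP[] := inv_trunc_itv 2 e.
rewrite /inv_mean2 fineK// ge0_fin_numE; last first.
  by apply: integral_ge0 => w _; rewrite lee_fin; have /andP[] := inv_trunc_itv 2 (env xi l 0 w).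
apply: (@le_lt_trans _ _ 1%E); last by rewrite ltry.
rewrite -(integral_cstE P 1); apply: ge0_le_integral => //.
- by move=> w _; rewrite lee_fin; have /andP[] := inv_trunc_itv 2 (env xi l 0 w).
- exact: (measurableT_comp mi (measurable_env xi l 0)).
- by move=> w _; rewrite lee_fin; have /andP[] := inv_trunc_itv 2 (env xi l 0 w).
Qed.

Lemma inv_mean2_ge0 : 0 <= inv_mean2.
Proof.
rewrite -lee_fin -(integral_inv_trunc2 0); apply: integral_ge0 => w _; rewrite lee_fin.
by have /andP[] := inv_trunc_itv 2 (env xi l 0 w).
Qed.

(** The inverse is at most one, and it is not almost surely one because some
    individual may have two children. *)
Lemma inv_mean2_lt1 : inv_mean2 < 1.
Proof.
have mi : measurable_fun setT (fun w => (tm 2 0 w)^-1).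
  exact: (measurableT_comp (measurable_inv_trunc 2) (measurable_env xi l 0)).
rewrite lt_neqAle; apply/andP; split; last first.
  rewrite -lee_fin -(integral_inv_trunc2 0) -(integral_cstE P 1).
  apply: ge0_le_integral => //.
  - by move=> w _; rewrite lee_fin; have /andP[] := inv_trunc_itv 2 (env xi l 0 w).
  - exact/measurable_EFinP.
  - by move=> w _; rewrite lee_fin; have /andP[] := inv_trunc_itv 2 (env xi l 0 w).
apply/eqP => r1; apply: (nondegenerate xi_iid m_finite p0_eq0 var_pos).
have h : {ae P, forall w, (tm 2 0 w)^-1 = 1}.
  apply: (integral_eq1_ae mi) => [w|]; first exact: inv_trunc_itv.
  by rewrite integral_inv_trunc2 r1.
apply: filterS2 h (aeg 0) => w h1 gw.
have := trunc_mean2E gw; rewrite -[trunc_mean p 2 _]invrK h1 invr1.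
have f0 : (0 <= law_mean p (fun k => (1 < k)%N%:R) (env xi l 0 w))%E by exact: law_mean_ge0.
case: law_mean f0 => [x||]//= _ [] /eqP; rewrite -subr_eq0.
by move=> /eqP ?; congr EFin; lra.
Qed.

Lemma integral_inv_trunc a n : (2 <= a)%N ->
  (\int[P]_w ((tm a n w)^-1)%:E <= inv_mean2%:E)%E.
Proof.
move=> a2; rewrite -(integral_inv_trunc2 n); apply: ae_le_integralE.
- exact: (measurableT_comp (measurable_inv_trunc a) (measurable_env xi l n)).
- exact: (measurableT_comp (measurable_inv_trunc 2) (measurable_env xi l n)).
- by move=> w; have /andP[] := inv_trunc_itv a (env xi l n w).
- by move=> w; have /andP[] := inv_trunc_itv 2 (env xi l n w).
- apply: filterS (aeg n) => w gw; rewrite lef_pV2 ?posrE ?trunc_mean_gt0//.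
  exact: trunc_mean_le.
Qed.

Let normalise (g : R -> R) a n : (0 < a)%N -> measurable_fun setT g -> (forall e, 0 <= g e) ->
  (\int[P]_w ((g (env xi l n w))%:E * law_mean p (fun k => (minn k a)%:R) (env xi l n w)) =
   \int[P]_w (g (env xi l n w) * tm a n w)%:E)%E.
Proof.
move=> a0 mg g0.
have mgE : measurable_fun setT (fun w => g (env xi l n w)).
  exact: (measurableT_comp mg (measurable_env xi l n)).
apply: ae_eq_integral => //.
- apply: emeasurable_funM; first exact/measurable_EFinP.
  by apply: measurableT_comp (measurable_env xi l n); exact: measurable_law_mean.
- by apply/measurable_EFinP; apply: measurable_funM => //; exact: measurable_tm.
- by apply: filterS (aeg n) => w gw _; rewrite trunc_meanE.
Qed.

Lemma trunc_moment1 a n i : (0 < a)%N ->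
  (\int[P]_w ((tm a n w)^-1 * Xt a n i w)%:E = 1%:E)%E.
Proof.
move=> a0; have mi := measurable_inv_trunc a.
have i0 e : 0 <= (trunc_mean p a e)^-1 by have /andP[] := inv_trunc_itv a e.
rewrite (quenched_mean X_law l n i (f := fun k => (minn k a)%:R) mi i0)//.
rewrite (normalise n a0 mi i0).
under eq_integral do rewrite mulVf ?gt_eqF ?trunc_mean_gt0//.
exact: integral_cstE.
Qed.

Lemma trunc_moment_inv2E a n i : (0 < a)%N ->
  (\int[P]_w ((tm a n w) ^- 2 * Xt a n i w)%:E = \int[P]_w ((tm a n w)^-1)%:E)%E.
Proof.
move=> a0.
have mi : measurable_fun setT (fun e => trunc_mean p a e ^- 2).
  by under eq_fun do rewrite -exprVn; apply: measurable_funX; exact: measurable_inv_trunc.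
have i0 e : 0 <= trunc_mean p a e ^- 2 by rewrite invr_ge0 sqr_ge0.
rewrite (quenched_mean X_law l n i (f := fun k => (minn k a)%:R) mi i0)//.
rewrite (normalise n a0 mi i0); apply: eq_integral => w _; congr EFin.
by field; rewrite gt_eqF// trunc_mean_gt0.
Qed.

Lemma trunc_moment_inv2 a n i : (2 <= a)%N ->
  (\int[P]_w ((tm a n w) ^- 2 * Xt a n i w)%:E <= inv_mean2%:E)%E.
Proof.
move=> a2; rewrite trunc_moment_inv2E; first exact: integral_inv_trunc.
exact: ltn_trans a2.
Qed.

Lemma trunc_moment_cross a n i i' : (0 < a)%N -> i != i' ->
  (\int[P]_w ((tm a n w) ^- 2 * (Xt a n i w * Xt a n i' w))%:E <= 1%:E)%E.
Proof.
move=> a0 ii.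
have mi : measurable_fun setT (fun e => trunc_mean p a e ^- 2).
  by under eq_fun do rewrite -exprVn; apply: measurable_funX; exact: measurable_inv_trunc.
have i0 e : 0 <= trunc_mean p a e ^- 2 by rewrite invr_ge0 sqr_ge0.
rewrite (quenched_mean2 X_law l n (f := fun k => (minn k a)%:R) ii mi i0)//; last first.
  by move=> e; exact: law_mean_trunc_fin.
rewrite -[leRHS](integral_cstE P) le_eqVlt; apply/orP; left; apply/eqP.
have mE : measurable_fun setT (fun w => (tm a n w) ^- 2).
  exact: (measurableT_comp mi (measurable_env xi l n)).
have mL : measurable_fun setT (fun w => law_mean p (fun k => (minn k a)%:R) (env xi l n w)).
  by apply: measurableT_comp (measurable_env xi l n); exact: measurable_law_mean.
apply: ae_eq_integral => //.
- by apply: emeasurable_funM; [exact/measurable_EFinP|exact: emeasurable_funM].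
- apply: filterS (aeg n) => w gw _; rewrite trunc_meanE// -!EFinM; congr EFin.
  by field; rewrite gt_eqF// trunc_mean_gt0.
Qed.

(** Truncation bounds the square by [a] times the variable: one power of the
    threshold is the price of a second moment. *)
Lemma trunc_moment2 a n i : (2 <= a)%N ->
  (\int[P]_w ((tm a n w) ^- 2 * (Xt a n i w * Xt a n i w))%:E <= (a%:R * inv_mean2)%:E)%E.
Proof.
move=> a2.
have mE : measurable_fun setT (fun w => (tm a n w) ^- 2).
  under eq_fun do rewrite -exprVn; apply: measurable_funX.
  exact: (measurableT_comp (measurable_inv_trunc a) (measurable_env xi l n)).
have mX := measurable_offspring n i (fun k => (minn k a)%:R).
have i0 w : 0 <= (tm a n w) ^- 2 by rewrite invr_ge0 sqr_ge0.
apply: (@le_trans _ _ (\int[P]_w (a%:R%:E * ((tm a n w) ^- 2 * Xt a n i w)%:E))%E).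
  apply: ge0_le_integral => //.
  - by move=> w _; rewrite lee_fin !mulr_ge0.
  - by apply/measurable_EFinP; do 2! apply: measurable_funM => //.
  - by apply: measurable_funeM; apply/measurable_EFinP; apply: measurable_funM.
  - move=> w _; rewrite -EFinM lee_fin [leRHS]mulrCA.
    by apply: ler_wpM2l => //; apply: ler_wpM2r => //; rewrite ler_nat geq_minr.
rewrite ge0_integralZl//.
- by rewrite EFinM lee_wpmul2l ?lee_fin// trunc_moment_inv2.
- by apply/measurable_EFinP; apply: measurable_funM.
- by move=> w _; rewrite lee_fin mulr_ge0.
Qed.

Lemma offspring_mean_ge0 e : 0 <= offspring_mean p e.
Proof. by rewrite fine_ge0// law_mean_ge0. Qed.

Lemma measurable_inv_offspring : measurable_fun setT (fun e => (offspring_mean p e)^-1).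
Proof.
apply: measurable_inv_ge0; first exact: measurable_offspring_mean.
exact: offspring_mean_ge0.
Qed.

Lemma integral_normalised n i :
  (\int[P]_w ((om n w)^-1 * (X l n i w)%:R)%:E = 1%:E)%E.
Proof.
have i0 e : 0 <= (offspring_mean p e)^-1 by rewrite invr_ge0 offspring_mean_ge0.
rewrite (quenched_mean X_law l n i (f := fun k => k%:R) measurable_inv_offspring i0)//.
rewrite -[RHS](integral_cstE P); apply: ae_eq_integral => //.
- apply: emeasurable_funM.
    apply/measurable_EFinP.
    exact: (measurableT_comp measurable_inv_offspring (measurable_env xi l n)).
  by apply: measurableT_comp (measurable_env xi l n); exact: measurable_law_mean.
- apply: filterS (aeg n) => w gw _; rewrite offspring_meanE// -EFinM mulVf//.
  by rewrite gt_eqF// (lt_le_trans _ (offspring_mean_ge1 gw)).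
Qed.

Lemma ae_offspring_pos : {ae P, forall w, forall n i, (0 < X l n i w)%N}.
Proof.
apply: ae_foralln => n; apply: ae_foralln => i.
have m0 : measurable (X l n i @^-1` [set 0%N]) by exact: measurable_funPTI.
exists (X l n i @^-1` [set 0%N]); split => //; last first.
  by move=> w /= /negP; rewrite -leqNgt leqn0 => /eqP.
pose f (k : nat) : R := (k == 0%N)%:R.
transitivity (\int[P]_w (cst 1 (env xi l n w) * f (X l n i w))%:E)%E.
  transitivity (\int[P]_w (\1_(X l n i @^-1` [set 0%N]) w)%:E)%E.
    by rewrite integral_indic// setIT.
  apply: eq_integral => w _; rewrite mul1r /f.
  rewrite indicE; case: eqVneq => [h|/eqP h]; first by rewrite mem_set.
  by rewrite memNset.
rewrite (quenched_mean X_law l n i (f := f))//.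
rewrite -[RHS](integral_cstE P); apply: ae_eq_integral => //.
- apply: emeasurable_funM; first exact: (measurable_cst (1%:E : \bar R)).
  have f0 k : 0 <= f k by rewrite /f.
  exact: (measurableT_comp (measurable_law_mean p f0) (measurable_env xi l n)).
- apply: filterS (aeg n) => w gw _; rewrite mul1e /law_mean eseries0// => k _ _.
  by rewrite /f; case: eqVneq => [->|_]; rewrite ?gw.1 ?mulr0 ?mul0r.
Qed.

End Growth.

(** * Growth of the population size *)

Section PopulationSize.
Context {d : measure_display} {T : measurableType d} {R : realType}.
Variable P : probability T R.
Variable xi : nat -> {RV P >-> (R * R)%type}.
Variable p : R.-pker R ~> nat.
Variable X : 'I_2 -> nat -> nat -> {RV P >-> nat}.
Hypothesis xi_iid : iid xi.
Hypothesis X_law : quenched_offspring xi p X.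
Variable l : 'I_2.
Hypothesis m_finite : {ae P, forall w, (emean xi p l 0 w < +oo)%E}.
Hypothesis p0_eq0 : {ae P, forall w, p (env xi l 0 w) [set 0%N] = 0%E}.
Hypothesis var_pos : (0 < 'V_P[M xi p l 0])%E.

Lemma mfun_past_le n n' d' (S : measurableType d') (f : T -> S) : (n <= n')%N ->
  mfun_of (past xi X n) f -> mfun_of (past xi X n') f.
Proof.
move=> nn'; apply: mfun_of_le => A pA; apply: sub_gen_smallest; move: A pA.
by apply: cylinders_sub => i /leq_trans; exact.
Qed.

Lemma mfun_past n d' (S : measurableType d') (f : T -> S) :
  mfun_of (past xi X n) f -> measurable_fun setT f.
Proof. by apply: mfun_of_measurable; exact: cylinders_measurable. Qed.

Lemma mfun_Z n : mfun_of (past xi X n) (Z X l n).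
Proof.
elim: n => [|n IH]; first exact: measurable_cst.
apply: (@measurable_random_sum _ (g_sigma_algebraType (past xi X n.+1))
  (Z X l n) (fun i => X l n i)).
  exact: mfun_past_le IH.
by move=> i; apply: mfun_X.
Qed.

Arguments mfun_Z : clear implicits.

Lemma measurable_Z n : measurable_fun setT (Z X l n).
Proof. exact: (mfun_past (mfun_Z n)). Qed.

Lemma mfun_nat_comp (G : set (set T)) (N : T -> nat) (f : nat -> R) :
  mfun_of G N -> mfun_of G (fun w => f (N w)).
Proof. by move=> mN; apply: (@measurableT_comp _ _ _ _ _ _ f _ _ _ mN). Qed.

Lemma leq_sum_ge1 (n : nat) (f : nat -> nat) : (forall i, (0 < f i)%N) ->
  (n <= \sum_(i < n) f i)%N.
Proof.
move=> f0; rewrite -[X in (X <= _)%N](card_ord n) -sum1_card.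
by apply: leq_sum => i _; exact: f0.
Qed.

(** When nobody dies, the population grows by at least one in each generation
    in which the first individual has several children. *)
Lemma Z_increments w n : (forall n i, (0 < X l n i w)%N) ->
  ((\sum_(j < n) (1 < X l j 0 w)).+1 <= Z X l n w)%N.
Proof.
move=> X0; elim: n => [|n IH]; first by rewrite big_ord0.
rewrite big_ord_recr/= -addSn.
case: (Z X l n w) IH => [//|z] zn.
rewrite big_ord_recl/= addnC.
apply: (@leq_trans (1 + z + (1 < X l n 0 w))).
  by rewrite addnC leq_add2r (leq_trans zn).
rewrite addnAC; apply: leq_add; last first.
  by apply: leq_trans (leq_sum_ge1 z (f := fun i => X l n i.+1 w) _) _.
by have := X0 n 0; case: (X l n 0 w) => [|[|k]].
Qed.

Lemma ae_Z_gt0 : {ae P, forall w, forall n, (0 < Z X l n w)%N}.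
Proof.
apply: filterS (ae_offspring_pos xi_iid X_law m_finite p0_eq0) => w X0 n.
exact: leq_trans (Z_increments n X0).
Qed.

Let half (k : nat) : R := if (1 < k)%N then 2^-1 else 1.

Let half_ge0 k : 0 <= half k. Proof. by rewrite /half; case: ifP. Qed.
Let half_le1 k : half k <= 1.
Proof. by rewrite /half; case: ifP => // _; rewrite invf_le1// ler1n. Qed.

Let halfD k : half k + 2^-1 * (1 < k)%N%:R = 1.
Proof. by rewrite /half; case: ifP => _; rewrite ?mulr1 ?mulr0; field. Qed.

Let hb e := fine (law_mean p half e).

Let law_half_fin e : law_mean p half e \is a fin_num.
Proof.
rewrite ge0_fin_numE ?law_mean_ge0//; apply: (@le_lt_trans _ _ 1%E); last by rewrite ltry.
rewrite -(law_mean_cst p e ler01); apply: le_law_mean => // k.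
by rewrite ler_wpM2r ?fine_ge0.
Qed.

Let hb_itv e : 0 <= hb e <= 1.
Proof.
rewrite -!lee_fin fineK//; apply/andP; split; first exact: law_mean_ge0.
rewrite -(law_mean_cst p e ler01); apply: le_law_mean => // k.
by rewrite ler_wpM2r ?fine_ge0.
Qed.

Let measurable_hb : measurable_fun setT hb.
Proof. by apply: measurableT_comp => //; exact: measurable_law_mean. Qed.

Let s := fine (\int[P]_w (half (X l 0 0 w))%:E).

Let integral_half n : (\int[P]_w (half (X l n 0%N w))%:E = \int[P]_w (hb (env xi l 0 w))%:E)%E.
Proof.
transitivity (\int[P]_w (cst 1 (env xi l n w) * half (X l n 0%N w))%:E)%E.
  by apply: eq_integral => w _; rewrite mul1r.
rewrite (quenched_mean X_law l n 0 (f := half))//.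
transitivity (\int[P]_w (hb (env xi l n w))%:E)%E.
  by apply: eq_integral => w _; rewrite mul1e fineK.
apply: (env_invariant xi_iid l n (G := fun e => (hb e)%:E)).
  exact/measurable_EFinP.
by move=> e; rewrite lee_fin; have /andP[] := hb_itv e.
Qed.

Let sE n : (\int[P]_w (half (X l n 0%N w))%:E = s%:E)%E.
Proof.
rewrite integral_half /s integral_half fineK// ge0_fin_numE; last first.
  by apply: integral_ge0 => w _; rewrite lee_fin; have /andP[] := hb_itv (env xi l 0 w).
apply: (@le_lt_trans _ _ 1%E); last by rewrite ltry.
rewrite -(integral_cstE P 1); apply: ae_le_integralE => //.
- exact: (measurableT_comp measurable_hb (measurable_env xi l 0)).
- by move=> w; have /andP[] := hb_itv (env xi l 0 w).
- by apply: aeW => w; have /andP[] := hb_itv (env xi l 0 w).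
Qed.

Let s_ge0 : 0 <= s.
Proof. by rewrite -lee_fin -(sE 0); apply: integral_ge0 => w _; rewrite lee_fin. Qed.

Let s_lt1 : s < 1.
Proof.
have mh : measurable_fun setT (fun w => hb (env xi l 0 w)).
  exact: (measurableT_comp measurable_hb (measurable_env xi l 0)).
rewrite lt_neqAle; apply/andP; split; last first.
  rewrite -lee_fin -(sE 0) -(integral_cstE P 1); apply: ae_le_integralE => //.
  - exact: measurable_offspring.
  - exact: aeW.
apply/eqP => s1; apply: (nondegenerate xi_iid m_finite p0_eq0 var_pos).
have : {ae P, forall w, hb (env xi l 0 w) = 1}.
  apply: (integral_eq1_ae mh) => //.
  by rewrite -(integral_half 0) sE s1.
apply: filterS => w h1.
have : law_mean p (fun k => half k + 2^-1 * (1 < k)%N%:R) (env xi l 0 w) = 1%E.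
  rewrite -[RHS](law_mean_cst p (env xi l 0 w) ler01); congr law_mean.
  by apply/funext => k; rewrite halfD.
rewrite law_meanD; [|exact: half_ge0|by move=> k; rewrite mulr_ge0].
rewrite -[X in (X + _)%E]fineK//.
have : fine (law_mean p half (env xi l 0 w)) = 1 by exact: h1.
move=> ->; rewrite law_meanZ//.
have f0 : (0 <= law_mean p (fun k => (1 < k)%N%:R) (env xi l 0 w))%E by exact: law_mean_ge0.
case: law_mean f0 => [x||]//= _; last by rewrite mulry gtr0_sg ?mul1e.
by move=> [] h; congr EFin; lra.
Qed.

Let mfun_half n : mfun_of (present xi X n) (fun w => half (X l n 0%N w)).
Proof. by apply: (mfun_nat_comp half); apply: mfun_X => /=; rewrite eqxx. Qed.

Let mfun_prod_half n : mfun_of (past xi X n) (fun w => \prod_(j < n) half (X l j 0%N w)).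
Proof.
apply: measurable_prod => j _; apply: (mfun_nat_comp half).
by apply: mfun_X => /=.
Qed.

Let integral_prod_half n :
  (\int[P]_w (\prod_(j < n) half (X l j 0%N w))%:E = (s ^+ n)%:E)%E.
Proof.
elim: n => [|n IH].
  by under eq_integral do rewrite big_ord0; rewrite integral_cstE.
under eq_integral do rewrite big_ord_recr/=.
rewrite (past_present_integralM xi_iid X_law (@mfun_prod_half n) (@mfun_half n))//.
  by rewrite IH sE -EFinM exprSr.
by move=> w; apply: prodr_ge0.
Qed.

(** If the first individual had several children in fewer than [L]
    generations, the product of the factors [half] exceeds [2 ^- L]. *)
Lemma inv_Z_le w n L : (forall n i, (0 < X l n i w)%N) ->
  ((Z X l n w)%:R)^-1 <= (L.+1%:R)^-1 + 2 ^+ L * \prod_(j < n) half (X l j 0%N w).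
Proof.
move=> X0; set N := (\sum_(j < n) (1 < X l j 0 w))%N.
have NZ : (N.+1 <= Z X l n w)%N by exact: Z_increments.
have -> : \prod_(j < n) half (X l j 0%N w) = (2 ^+ N)^-1.
  rewrite /N; elim: (n) => [|k IH]; first by rewrite !big_ord0 invr1.
  rewrite !big_ord_recr/= IH exprD invfM; congr (_ * _); rewrite /half.
  by case: ifP; rewrite ?expr1 ?expr0 ?invr1.
have Z0 : (0 : R) < (Z X l n w)%:R by rewrite ltr0n (leq_trans _ NZ).
have [LN|NL] := leqP L N.
  apply: (@le_trans _ _ (L.+1%:R)^-1); last by rewrite lerDl mulr_ge0 ?invr_ge0 ?exprn_ge0.
  by rewrite lef_pV2 ?posrE// ?ltr0n// ler_nat (leq_trans _ NZ).
apply: (@le_trans _ _ 1).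
  by rewrite invf_le1// ler1n (leq_trans _ NZ).
apply: (@le_trans _ _ (2 ^+ L * (2 ^+ N)^-1)).
  by rewrite ler_pdivlMr ?exprn_gt0// mul1r ler_weXn2l ?ler1n// ltnW.
by rewrite lerDr invr_ge0.
Qed.

(** In each generation the first individual has several children with the
    same positive probability, independently of the past. Hence the number of
    such generations, which is a lower bound for the population, tends to
    infinity; the expected product of the factors [half] is its generating
    function at one half. *)
Lemma integral_inv_Z_small (e : R) : 0 < e ->
  exists k, (\int[P]_w ((Z X l k w)%:R^-1)%:E <= e%:E)%E.
Proof.
move=> e0.
have [L hL] : exists L : nat, L.+1%:R^-1 < e / 2.
  have : (fun n : nat => n.+1%:R^-1 : R) @ \oo --> (0 : R) by exact: cvg_harmonic.
  move/cvgrPdist_lt => /(_ (e / 2)); rewrite divr_gt0// => /(_ isT) [L _ h].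
  exists L; have := h L (leqnn L); rewrite sub0r normrN ger0_norm//.
have [k hk] : exists k : nat, s ^+ k < e / 2 / 2 ^+ L.
  have : (fun n => s ^+ n) @ \oo --> (0 : R) by apply: cvg_expr; rewrite ger0_norm.
  move/cvgrPdist_lt => /(_ (e / 2 / 2 ^+ L)); rewrite !divr_gt0 ?exprn_gt0//.
  move=> /(_ isT) [k _ h].
  by exists k; have := h k (leqnn k); rewrite sub0r normrN ger0_norm ?exprn_ge0.
exists k; have mprod := mfun_past (@mfun_prod_half k).
have p0 w : 0 <= \prod_(j < k) half (X l j 0%N w) by apply: prodr_ge0.
apply: (@le_trans _ _ (\int[P]_w (L.+1%:R^-1 + 2 ^+ L * \prod_(j < k) half (X l j 0%N w))%:E)%E).
  apply: ae_le_integralE => //.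
  - exact: (mfun_past (mfun_nat_comp (fun n => n%:R^-1) (mfun_Z k))).
  - by apply: measurable_funD => //; exact: measurable_funM.
  - by move=> w; rewrite addr_ge0// mulr_ge0// exprn_ge0.
  - apply: filterS (ae_offspring_pos xi_iid X_law m_finite p0_eq0) => w X0.
    exact: inv_Z_le.
under eq_integral do rewrite EFinD.
rewrite ge0_integralD//.
- rewrite integral_cstE; under eq_integral do rewrite EFinM.
  rewrite ge0_integralZl//.
  + rewrite integral_prod_half -EFinM -EFinD lee_fin [leRHS](splitr e).
    by apply: lerD; rewrite ltW// mulrC -ltr_pdivlMr// exprn_gt0.
  + exact/measurable_EFinP.
  + by move=> w _; rewrite lee_fin.
- by move=> w _; rewrite lee_fin mulr_ge0// exprn_ge0.
- by apply/measurable_EFinP; exact: measurable_funM.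
Qed.

End PopulationSize.

(** * The truncated process *)

Section TruncatedProcess.
Context {d : measure_display} {T : measurableType d} {R : realType}.
Variable P : probability T R.
Variable xi : nat -> {RV P >-> (R * R)%type}.
Variable p : R.-pker R ~> nat.
Variable X : 'I_2 -> nat -> nat -> {RV P >-> nat}.
Hypothesis xi_iid : iid xi.
Hypothesis X_law : quenched_offspring xi p X.
Variable l : 'I_2.
Hypothesis m_finite : {ae P, forall w, (emean xi p l 0 w < +oo)%E}.
Hypothesis p0_eq0 : {ae P, forall w, p (env xi l 0 w) [set 0%N] = 0%E}.
Variables (a : nat -> nat) (k : nat).
Hypothesis a2 : forall i, (2 <= a i)%N.

Notation tm a n w := (trunc_mean p a (env xi l n w)).
Notation r := (inv_mean2 xi p l).
Notation Zk w := ((Z X l k w)%:R : R).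

Let a0 i : (0 < a i)%N. Proof. by exact: ltn_trans (a2 i). Qed.

(** A lower bound for the process from generation [k] on; relative to
    generation [k] its second moments are finite. *)
Fixpoint Ztrunc (i : nat) (w : T) : nat :=
  if i is i'.+1 then (\sum_(j < Ztrunc i' w) minn (X l (k + i') j w) (a i'))%N else Z X l k w.

(** The inverse of the conditional mean of [Ztrunc] given the environments and
    generation [k]. *)
Definition inv_prod (i : nat) (w : T) : R :=
  (\prod_(j < i) (tm (a j) (k + j) w)^-1) * (Zk w)^-1.

Lemma inv_prod_ge0 i w : 0 <= inv_prod i w.
Proof.
rewrite mulr_ge0 ?invr_ge0//; apply: prodr_ge0 => j _.
by rewrite invr_ge0 ltW// trunc_mean_gt0.
Qed.

Lemma inv_prodS i w : inv_prod i.+1 w = inv_prod i w * (tm (a i) (k + i) w)^-1.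
Proof. by rewrite /inv_prod big_ord_recr/= mulrAC. Qed.

Lemma Ztrunc_le i w : (Ztrunc i w <= Z X l (k + i) w)%N.
Proof.
elim: i => [|i IH]; first by rewrite addn0.
rewrite addnS/=; apply: (@leq_trans (\sum_(j < Ztrunc i w) X l (k + i) j w)%N).
  by apply: leq_sum => j _; exact: geq_minl.
rewrite -!(big_mkord xpredT (fun j => X l (k + i)%N j w)).
by rewrite [leqRHS](big_cat_nat _ IH)//= leq_addr.
Qed.

Lemma mfun_Ztrunc i : mfun_of (past xi X (k + i)%N) (Ztrunc i).
Proof.
elim: i => [|i IH]; first by rewrite addn0; exact: mfun_Z.
rewrite addnS; apply: (@measurable_random_sum _ (g_sigma_algebraType (past xi X (k + i).+1))
  (Ztrunc i) (fun j w => minn (X l (k + i) j w) (a i))).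
  exact: mfun_past_le IH.
move=> j; apply: (@measurableT_comp _ _ _ _ _ _ (fun u => minn u (a i))); first by [].
by apply: mfun_X.
Qed.

Lemma mfun_inv_prod i : mfun_of (past xi X (k + i)%N) (inv_prod i).
Proof.
apply: measurable_funM.
  apply: measurable_prod => j _.
  apply: (measurableT_comp (measurable_inv_trunc p (a j))).
  apply: (measurableT_comp (@measurable_component R l)).
  by apply: mfun_xi; rewrite ltn_add2l.
apply: (mfun_nat_comp (fun n => n%:R^-1)).
by apply: (@mfun_past_le _ _ _ P xi X k); [exact: leq_addr|exact: mfun_Z].
Qed.

Let measurable_trunc_pow n b : measurable_fun setT (fun e => trunc_mean p b e ^- n).
Proof.
by under eq_fun do rewrite -exprVn; apply: measurable_funX; exact: measurable_inv_trunc.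
Qed.

Let trunc_pow_ge0 n b e : 0 <= trunc_mean p b e ^- n.
Proof. by rewrite invr_ge0 exprn_ge0// ltW// trunc_mean_gt0. Qed.

Let mfun_inv_prod_sqr i : mfun_of (past xi X (k + i)%N) (fun w => inv_prod i w ^+ 2).
Proof. by apply: measurable_funX; exact: mfun_inv_prod. Qed.

Let ZtruncSE i w : (Ztrunc i.+1 w)%:R = \sum_(j < Ztrunc i w) (minn (X l (k + i) j w) (a i))%:R :> R.
Proof. by rewrite /= natr_sum. Qed.

Lemma Ztrunc_moment1 i : (\int[P]_w (inv_prod i w * (Ztrunc i w)%:R)%:E = 1)%E.
Proof.
elim: i => [|i IH].
  rewrite -[RHS](integral_cstE P); apply: ae_eq_integralE => //.
  - apply: measurable_funM.
      by apply: mfun_past (@mfun_inv_prod 0).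
    by apply: (@mfun_past _ _ _ _ xi X (k + 0)); apply: (mfun_nat_comp (fun n => n%:R)); exact: (@mfun_Ztrunc 0).
  - apply: filterS (ae_Z_gt0 xi_iid X_law m_finite p0_eq0) => w Z0.
    by rewrite /inv_prod big_ord0 mul1r/= mulVf// pnatr_eq0 -lt0n.
transitivity (\int[P]_w (inv_prod i w * ((tm (a i) (k + i) w)^-1 *
    \sum_(j < Ztrunc i w) (minn (X l (k + i) j w) (a i))%:R))%:E)%E.
  by apply: eq_integral => w _; rewrite inv_prodS ZtruncSE mulrA.
rewrite (integral_random_sum xi_iid X_law (@mfun_inv_prod i) (@mfun_Ztrunc i)
  (inv_prod_ge0 i) (measurable_inv_trunc p (a i)) _ (f := fun u => (minn u (a i))%:R) _ (c := 1))//.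
- by rewrite IH mule1.
- by move=> e; have /andP[] := inv_trunc_itv p (a i) e.
- by move=> j; exact: (trunc_moment1 xi_iid X_law).
Qed.

(** Each generation divides by the square of the truncated mean and multiplies
    by the mean itself, which leaves the inverse of the truncated mean. *)
Lemma Ztrunc_inv_moment i : (\int[P]_w (inv_prod i w ^+ 2 * (Ztrunc i w)%:R)%:E <=
  (r ^+ i)%:E * \int[P]_w ((Zk w)^-1)%:E)%E.
Proof.
elim: i => [|i IH].
  rewrite expr0 mul1e le_eqVlt; apply/orP; left; apply/eqP; apply: eq_integral => w _.
  congr EFin; rewrite /inv_prod big_ord0 mul1r/=.
  have [->|Z0] := eqVneq (Zk w) 0; first by rewrite mulr0 invr0.
  by field.
have [c c0 [cr hc]] : exists2 c, 0 <= c & (c <= r) /\ forall j,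
    (\int[P]_w ((tm (a i) (k + i) w) ^- 2 * (minn (X l (k + i) j w) (a i))%:R)%:E = c%:E)%E.
  have I0 : (0 <= \int[P]_w ((tm (a i) (k + i) w)^-1)%:E)%E.
    by apply: integral_ge0 => w _; rewrite lee_fin; have /andP[] := inv_trunc_itv p (a i) (env xi l (k + i) w).
  have Ir := integral_inv_trunc xi_iid m_finite p0_eq0 (k + i) (a2 i).
  have cE : (\int[P]_w ((tm (a i) (k + i) w)^-1)%:E =
      (fine (\int[P]_w ((tm (a i) (k + i) w)^-1)%:E))%:E)%E.
    by rewrite fineK// ge0_fin_numE// (le_lt_trans Ir)// ltry.
  exists (fine (\int[P]_w ((tm (a i) (k + i) w)^-1)%:E)); first exact: fine_ge0.
  split; first by move: Ir; rewrite [leLHS]cE lee_fin.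
  by move=> j; rewrite -cE; exact: (trunc_moment_inv2E xi_iid X_law).
have -> : (\int[P]_w (inv_prod i.+1 w ^+ 2 * (Ztrunc i.+1 w)%:R)%:E =
    \int[P]_w (inv_prod i w ^+ 2 * ((tm (a i) (k + i) w) ^- 2 *
      \sum_(j < Ztrunc i w) (minn (X l (k + i) j w) (a i))%:R))%:E)%E.
  by apply: eq_integral => w _; rewrite inv_prodS ZtruncSE exprMn exprVn mulrA.
rewrite (integral_random_sum xi_iid X_law (@mfun_inv_prod_sqr i) (@mfun_Ztrunc i)
  (fun w => sqr_ge0 (inv_prod i w)) (measurable_trunc_pow 2 (a i)) (trunc_pow_ge0 2 (a i))
  (f := fun u => (minn u (a i))%:R) _ (c := c))//.
rewrite exprS EFinM -muleA; apply: lee_pmul => //.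
by apply: integral_ge0 => w _; rewrite lee_fin mulr_ge0// sqr_ge0.
Qed.

(** The cross terms reproduce the second moment, and the diagonal terms add
    the first moment times the threshold; the latter decays like [r ^+ j]. *)
Lemma Ztrunc_moment2 i : (\int[P]_w ((inv_prod i w * (Ztrunc i w)%:R) ^+ 2)%:E <=
  1 + (\sum_(j < i) (a j)%:R * r ^+ j.+1)%:E * \int[P]_w ((Zk w)^-1)%:E)%E.
Proof.
have r0 : 0 <= r by exact: inv_mean2_ge0.
have I0 : (0 <= \int[P]_w ((Zk w)^-1)%:E)%E by apply: integral_ge0 => w _; rewrite lee_fin.
have mU j : measurable_fun setT (fun w => inv_prod j w ^+ 2 * (Ztrunc j w)%:R).
  apply: (@mfun_past _ _ _ P xi X (k + j)).
  apply: measurable_funM; first exact: mfun_inv_prod_sqr.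
  by apply: (mfun_nat_comp (fun n => n%:R)); exact: mfun_Ztrunc.
have mU2 j : measurable_fun setT (fun w => inv_prod j w ^+ 2 * (Ztrunc j w)%:R ^+ 2).
  apply: (@mfun_past _ _ _ P xi X (k + j)).
  apply: measurable_funM; first exact: mfun_inv_prod_sqr.
  by apply: (mfun_nat_comp (fun n => n%:R ^+ 2)); exact: mfun_Ztrunc.
elim: i => [|i IH].
  rewrite big_ord0 mul0e adde0 -[leRHS](integral_cstE P).
  apply: ae_le_integralE => //.
  - by under eq_fun do rewrite exprMn; exact: (mU2 0).
  - by move=> w; exact: sqr_ge0.
  - apply: filterS (ae_Z_gt0 xi_iid X_law m_finite p0_eq0) => w Z0.
    by rewrite /inv_prod big_ord0 mul1r/= mulVf ?expr1n// pnatr_eq0 -lt0n.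
have -> : (\int[P]_w ((inv_prod i.+1 w * (Ztrunc i.+1 w)%:R) ^+ 2)%:E =
    \int[P]_w (inv_prod i w ^+ 2 * ((tm (a i) (k + i) w) ^- 2 *
      (\sum_(j < Ztrunc i w) (minn (X l (k + i) j w) (a i))%:R) ^+ 2))%:E)%E.
  apply: eq_integral => w _; rewrite inv_prodS ZtruncSE.
  by congr EFin; rewrite [LHS]exprMn [X in X * _]exprMn exprVn [RHS]mulrA.
apply: (le_trans (le_integral_random_sum_sqr xi_iid X_law (@mfun_inv_prod_sqr i) (@mfun_Ztrunc i)
  (fun w => sqr_ge0 (inv_prod i w)) (measurable_trunc_pow 2 (a i)) (trunc_pow_ge0 2 (a i))
  (f := fun u => (minn u (a i))%:R) _ (c1 := 1) (c2 := (a i)%:R * r) _ _ _ _)) => //.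
- by rewrite mulr_ge0.
- by move=> j j' jj; exact: (trunc_moment_cross xi_iid X_law).
- by move=> j; exact: (trunc_moment2 xi_iid X_law).
under eq_integral => w _ do rewrite mulrDr mul1r [X in _ + X]mulrCA EFinD.
rewrite ge0_integralD//; first last.
- by apply/measurable_EFinP; apply: measurable_funM => //; exact: mU.
- by move=> w _; rewrite lee_fin; apply: mulr_ge0; [exact: mulr_ge0|apply: mulr_ge0 => //; exact: sqr_ge0].
- by apply/measurable_EFinP; exact: mU2.
- by move=> w _; rewrite lee_fin mulr_ge0// sqr_ge0.
under [X in (_ + X)%E]eq_integral do rewrite EFinM.
rewrite ge0_integralZl//; first last.
- by rewrite lee_fin mulr_ge0.
- by move=> w _; rewrite lee_fin mulr_ge0// sqr_ge0.
- exact/measurable_EFinP.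
rewrite big_ord_recr/= EFinD ge0_muleDl ?lee_fin ?mulr_ge0 ?exprn_ge0//; last first.
  by apply: sumr_ge0 => j _; rewrite mulr_ge0// exprn_ge0.
rewrite addeA; apply: leeD.
  by under eq_integral do rewrite -exprMn.
rewrite exprS mulrA [in leRHS]EFinM -muleA; apply: lee_wpmul2l; first by rewrite lee_fin mulr_ge0.
exact: Ztrunc_inv_moment.
Qed.

(** Chebyshev's inequality: the normalised process has mean one, and falling
    below one half is a deviation by at least one half. *)
Lemma Ztrunc_small i : (P [set w | (inv_prod i w * (Ztrunc i w)%:R < 2^-1)%R] <=
  (4 * \sum_(j < i) (a j)%:R * r ^+ j.+1)%:E * \int[P]_w ((Zk w)^-1)%:E)%E.
Proof.
set U := fun w => inv_prod i w * (Ztrunc i w)%:R.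
set S := \sum_(j < i) _.
have S0 : 0 <= S by apply: sumr_ge0 => j _; rewrite mulr_ge0 ?exprn_ge0// inv_mean2_ge0.
have U0 w : 0 <= U w by rewrite mulr_ge0 ?inv_prod_ge0.
have mU : measurable_fun setT U.
  apply: (@mfun_past _ _ _ P xi X (k + i)).
  apply: measurable_funM; first exact: mfun_inv_prod.
  by apply: (mfun_nat_comp (fun n => n%:R)); exact: mfun_Ztrunc.
have Ik : (\int[P]_w ((Zk w)^-1)%:E <= 1)%E.
  rewrite -[leRHS](integral_cstE P); apply: ae_le_integralE => //.
    apply: (@mfun_past _ _ _ P xi X k).
    by apply: (mfun_nat_comp (fun n => n%:R^-1)); exact: mfun_Z.
  apply: aeW => w; case: (Z X l k w) => [|z]; first by rewrite invr0.
  by rewrite invf_le1 ?ltr0n// ler1n.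
have I0 : (0 <= \int[P]_w ((Zk w)^-1)%:E)%E by apply: integral_ge0 => w _; rewrite lee_fin.
have Ifin : (\int[P]_w ((Zk w)^-1)%:E)%E \is a fin_num.
  by rewrite ge0_fin_numE// (le_lt_trans Ik)// ltry.
have m2 := Ztrunc_moment2 i; rewrite -/S in m2.
have iU2 : Pintegrable P (fun w => U w ^+ 2).
  apply/integrableP; split; first by apply/measurable_EFinP; exact: measurable_funX.
  under eq_integral => w _ do rewrite /= ger0_norm ?sqr_ge0//.
  apply: (le_lt_trans m2); rewrite -(fineK Ifin) -EFinM -EFinD ltry//.
have iU : Pintegrable P U.
  apply/integrableP; split; first exact/measurable_EFinP.
  under eq_integral => w _ do rewrite /= ger0_norm//.
  by rewrite Ztrunc_moment1 ltry.
have EU : \int[P]_w U w = 1 by rewrite /Rintegral Ztrunc_moment1.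
have iD : Pintegrable P (fun w => (U w - 1) ^+ 2).
  have : Pintegrable P (fun w => (U w ^+ 2 + -2 * U w) + 1).
    by apply: PintegrableD; [apply: PintegrableD => //; exact: PintegrableZ|exact: Pintegrable_cst].
  by congr Pintegrable; apply/funext => w; ring.
have ED : \int[P]_w ((U w - 1) ^+ 2) <= S * fine (\int[P]_w ((Zk w)^-1)%:E)%E.
  have -> : \int[P]_w ((U w - 1) ^+ 2) = \int[P]_w ((U w ^+ 2 + -2 * U w) + 1).
    by apply: eq_Rintegral => w _; ring.
  rewrite PintegralD ?PintegralD ?PintegralZ ?Pintegral_cst ?EU//; first last.
  - exact: Pintegrable_cst.
  - by apply: PintegrableD => //; exact: PintegrableZ.
  - exact: PintegrableZ.
  have : \int[P]_w (U w ^+ 2) <= 1 + S * fine (\int[P]_w ((Zk w)^-1)%:E)%E.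
    rewrite -lee_fin /Rintegral fineK.
      by move: m2; rewrite -{1}(fineK Ifin).
    exact: integral_fune_fin_num.
  lra.
have mset : measurable [set w | U w < 2^-1].
  exact: measurable_lt_set.
apply: (@le_trans _ _ (\int[P]_w (4 * (U w - 1) ^+ 2)%:E)%E).
  rewrite -[X in P X]setIT -integral_indic//; apply: ae_le_integralE => //.
  - by apply: measurable_funM => //; apply: measurable_funX; exact: measurable_funB.
  - by move=> w; rewrite mulr_ge0// sqr_ge0.
  - apply: aeW => w; rewrite indicE; case: (boolP (w \in _)).
      rewrite inE => h; have h1 : 2^-1 <= 1 - U w.
        by have : U w < 2^-1 := h; lra.
      have h2 : 2^-1 ^+ 2 <= (1 - U w) ^+ 2.
        by rewrite lerXn2r// nnegrE; lra.
      rewrite -[leLHS](_ : 4 * 2^-1 ^+ 2 = 1); last by field.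
      by rewrite ler_wpM2l// -[leRHS]sqrrN opprB.
    by move=> _; apply: mulr_ge0 => //; exact: sqr_ge0.
under eq_integral do rewrite EFinM.
rewrite integralZl// -(fineK Ifin) -EFinM -(fineK (integral_fune_fin_num _ iD))//.
rewrite -EFinM lee_fin -mulrA ler_wpM2l//.
Qed.

End TruncatedProcess.

(** * Log-means and truncation losses *)

Section TailIntegral.
Context {d : measure_display} {T : measurableType d} {R : realType}.
Variable P : probability T R.

(** Dominated convergence along the levels of [N]. *)
Lemma tail_integral_small (h : T -> R) (N : T -> nat) (e : R) :
  measurable_fun setT h -> measurable_fun setT N -> (forall w, 0 <= h w) ->
  (\int[P]_w (h w)%:E < +oo)%E -> 0 < e ->
  exists A, forall A', (A <= A')%N -> (\int[P]_w (h w * (A' < N w)%N%:R)%:E <= e%:E)%E.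
Proof.
move=> mh mN h0 hfin e0.
have mf A : measurable_fun setT (fun w => (h w * (A < N w)%N%:R)%:E).
  apply/measurable_EFinP; apply: measurable_funM => //.
  exact: (@measurableT_comp _ _ _ _ _ _ (fun u : nat => ((A < u)%N%:R : R)) _ N).
have := @dominated_convergence _ _ _ P setT measurableT
  (fun A w => (h w * (A < N w)%N%:R)%:E) (cst 0%E) (fun w => (h w)%:E) mf.
case.
- exact: measurable_cst.
- apply: aeW => w _ /=; apply/cvg_EFin; first by apply: nearW.
  apply: cvg_near_cst; exists (N w) => // A /= NA.
  by rewrite ltnNge NA mulr0.
- apply/integrableP; split; first exact/measurable_EFinP.
  by under eq_integral => w _ do rewrite /= ger0_norm//.
- apply: aeW => w A _; rewrite lee_fin normrM ger0_norm// ger0_norm//.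
  by rewrite ler_piMr// lern1 leq_b1.
move=> _ _; rewrite integral0 => /fine_cvgP[fin] /cvgrPdist_le /(_ e e0) hc.
have [A _ hA] := filterI fin hc.
exists A => A' AA'; have [/= fA] := hA A' AA'.
rewrite sub0r normrN ger0_norm; last first.
  by apply: fine_ge0; apply: integral_ge0 => w _; rewrite lee_fin mulr_ge0.
by rewrite -lee_fin fineK.
Qed.

End TailIntegral.

Section LogMean.
Context {d : measure_display} {T : measurableType d} {R : realType}.
Variable P : probability T R.
Variable xi : nat -> {RV P >-> (R * R)%type}.
Variable p : R.-pker R ~> nat.
Hypothesis xi_iid : iid xi.
Variable l : 'I_2.
Hypothesis var_fin : ('V_P[M xi p l 0] < +oo)%E.

Definition centered n w := M xi p l n w - mu xi p l.

Lemma measurable_centered n : measurable_fun setT (centered n).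
Proof. by apply: measurable_funB => //; exact: measurable_M. Qed.

Lemma variance_centered : 'V_P[M xi p l 0] = (\int[P]_w (centered 0 w ^+ 2)%:E)%E.
Proof.
rewrite /variance covariance.unlock expectation.unlock; apply: eq_integral => w _.
by rewrite !fctE /= /centered /mu expectation.unlock.
Qed.

Lemma centered_sqr_integrable : Pintegrable P (fun w => centered 0 w ^+ 2).
Proof.
apply/integrableP; split.
  by apply/measurable_EFinP; apply: measurable_funX; exact: measurable_centered.
under eq_integral => w _ do rewrite /= ger0_norm ?sqr_ge0//.
by rewrite -variance_centered.
Qed.

(** A finite variance forces integrability, whatever the default value
    hidden in the definition of [mu] when the expectation is infinite. *)
Lemma centered_integrable : Pintegrable P (centered 0).
Proof.
apply: (Pintegrable_le (measurable_centered 0)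
  (PintegrableD (Pintegrable_cst P 1) centered_sqr_integrable)) => w.
rewrite -(real_normK (num_real (centered 0 w))); set x := `|_|.
have : 0 <= (x - 2^-1) ^+ 2 by exact: sqr_ge0.
rewrite sqrrB; lra.
Qed.

Lemma M_integrable : Pintegrable P (M xi p l 0).
Proof.
have := PintegrableD centered_integrable (Pintegrable_cst P (mu xi p l)).
by congr Pintegrable; apply/funext => w; rewrite /centered subrK.
Qed.

Lemma integral_centered : \int[P]_w centered 0 w = 0.
Proof.
have -> : \int[P]_w centered 0 w = \int[P]_w (M xi p l 0 w + - mu xi p l) by [].
rewrite PintegralD ?Pintegral_cst//; last 2 first.
- exact: M_integrable.
- exact: Pintegrable_cst.
by rewrite /mu expectation.unlock subrr.
Qed.

Lemma sigma_sqr : sigma xi p l ^+ 2 = \int[P]_w (centered 0 w ^+ 2).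
Proof.
rewrite /sigma sqr_sqrtr ?variance_centered//.
by apply: fine_ge0; apply: integral_ge0 => w _; rewrite lee_fin sqr_ge0.
Qed.

Lemma integral_norm_M n : (\int[P]_w `|M xi p l n w|%:E = \int[P]_w `|M xi p l 0 w|%:E)%E.
Proof.
have E k w : M xi p l k w = ln (offspring_mean p (env xi l k w)).
  by rewrite /M mean_offspring_mean.
under eq_integral do rewrite E.
under [RHS]eq_integral do rewrite E.
apply: (env_invariant xi_iid l n (G := fun e => `|ln (offspring_mean p e)|%:E)).
  apply/measurable_EFinP; apply: measurableT_comp; first exact: normr_measurable.
  by apply: measurableT_comp; [exact: measurable_ln|exact: measurable_offspring_mean].
by move=> e; rewrite lee_fin.
Qed.

End LogMean.

Section LogCount.
Context {R : realType}.

Lemma count_lt_le (t : R) I : 0 <= t -> \sum_(j < I) ((j : nat)%:R < t)%R%:R <= 1 + t.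
Proof.
move=> t0; have := truncn_itv t0; set N := Num.truncn t => /andP[Nt tN].
apply: (@le_trans _ _ (minn I N.+1)%:R); last first.
  rewrite (le_trans (y := N.+1%:R))//; first by rewrite ler_nat geq_minr.
  by rewrite -natr1 addrC lerD2l.
elim: I => [|I IH]; first by rewrite big_ord0.
rewrite big_ord_recr/=; case: (leqP I N) => IN.
  have -> : minn I.+1 N.+1 = (minn I N.+1 + 1)%N.
    by rewrite (minn_idPl _) ?(minn_idPl _) ?addn1//; exact: ltnW.
  by rewrite natrD lerD// lern1 leq_b1.
have -> : I%:R < t = false.
  by apply/negbTE; rewrite -leNgt (le_trans (ltW tN))// ler_nat.
rewrite addr0 (le_trans IH)// ler_nat leq_min geq_minr andbT.
by rewrite (leq_trans (geq_minl _ _)).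
Qed.

(** A threshold is exceeded only for about [ln x / ln b] indices, since the
    thresholds grow geometrically: this is where the logarithm in the moment
    assumption is spent. *)
Lemma sum_excess_le (b : R) (A I x : nat) : 1 < b ->
  \sum_(j < I) (x - (A + Num.truncn (b ^+ j)))%N%:R <=
  x%:R * (1 + (ln b)^-1 * lnplus x%:R) * (A < x)%N%:R :> R.
Proof.
move=> b1; have b0 : 0 < b by exact: lt_trans b1.
have lb : 0 < ln b by rewrite ln_gt0.
have [Ax|xA] := ltnP A x; last first.
  rewrite mulr0 big1// => j _; apply/eqP; rewrite pnatr_eq0 subn_eq0.
  by rewrite (leq_trans xA)// leq_addr.
rewrite mulr1; have lp0 : 0 <= lnplus (x%:R : R) by rewrite /lnplus le_max lexx orbT.
have x0 : (0 : R) < x%:R by rewrite ltr0n (leq_ltn_trans _ Ax).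
apply: (@le_trans _ _ (x%:R * \sum_(j < I) ((j : nat)%:R < (ln b)^-1 * lnplus (x%:R : R))%R%:R)).
  rewrite mulr_sumr; apply: ler_sum => j _.
  have [h|h] := ltP (j%:R : R); first by rewrite mulr1 ler_nat leq_subr.
  rewrite mulr0 (_ : (_ - _)%N = 0%N)//; apply/eqP; rewrite subn_eq0.
  apply: leq_trans (leq_addl _ _).
  rewrite truncn_ge_nat ?exprn_ge0 ?(ltW b0)//.
  rewrite -ler_ln ?posrE ?exprn_gt0// lnXn//.
  move: h; rewrite mulrC ler_pdivrMr// mulr_natl; apply: le_trans.
  by rewrite /lnplus le_max lexx.
by rewrite ler_pM2l// count_lt_le// mulr_ge0// invr_ge0 ltW.
Qed.
End LogCount.

(** Bernoulli's inequality with unequal factors. *)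
Lemma prod_one_minus {R : realDomainType} (x : nat -> R) n :
  (forall j, 0 <= x j <= 1) -> 1 - \sum_(j < n) x j <= \prod_(j < n) (1 - x j).
Proof.
move=> x01; have p01 k : 0 <= \prod_(j < k) (1 - x j) <= 1.
  apply/andP; split; [apply: prodr_ge0|apply: prodr_ile1] => j _; have /andP[h0 h1] := x01 j.
    by rewrite subr_ge0.
  by rewrite subr_ge0 h1 gerBl h0.
elim: n => [|n IH]; first by rewrite !big_ord0 subr0.
rewrite !big_ord_recr/= mulrBr mulr1 opprD addrA lerB//.
by have /andP[h0 h1] := p01 n; have /andP[g0 g1] := x01 n; rewrite ler_piMl.
Qed.

Lemma sum_geometric_le {R : realFieldType} (q : R) n : 0 <= q -> q < 1 ->
  \sum_(j < n) q ^+ j <= (1 - q)^-1.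
Proof.
move=> q0 q1; rewrite -[leRHS]mul1r ler_pdivlMr ?subr_gt0//.
rewrite -[1 - q]opprB mulrN mulrC -subrX1 opprB.
by rewrite gerBl exprn_ge0.
Qed.

Section TruncationLoss.
Context {d : measure_display} {T : measurableType d} {R : realType}.
Variable P : probability T R.
Variable xi : nat -> {RV P >-> (R * R)%type}.
Variable p : R.-pker R ~> nat.
Variable X : 'I_2 -> nat -> nat -> {RV P >-> nat}.
Hypothesis xi_iid : iid xi.
Hypothesis X_law : quenched_offspring xi p X.
Variable l : 'I_2.
Hypothesis m_finite : {ae P, forall w, (emean xi p l 0 w < +oo)%E}.
Hypothesis p0_eq0 : {ae P, forall w, p (env xi l 0 w) [set 0%N] = 0%E}.

Notation om n w := (offspring_mean p (env xi l n w)).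

Hypothesis log_moment :
  (\int[P]_w ((om 0 w)^-1 * (X l 0 0 w)%:R * lnplus (X l 0%N 0%N w)%:R)%:E < +oo)%E.

Let aeg n : {ae P, forall w, good_env p (env xi l n w)} :=
  ae_good_env xi_iid m_finite p0_eq0 n.

Definition log_growth n w := \sum_(j < n) M xi p l j w.

Lemma measurable_log_growth n : measurable_fun setT (log_growth n).
Proof. by apply: measurable_sum => j; exact: measurable_M. Qed.

(** In a good environment this is one minus the ratio of the
    truncated mean to the mean; written with the mean excess it is nonnegative
    in every environment. *)
Definition loss a (e : R) : R :=
  (offspring_mean p e)^-1 * fine (law_mean p (fun k => (k - a)%N%:R) e).

Lemma loss_ge0 a e : 0 <= loss a e.
Proof. by rewrite mulr_ge0 ?invr_ge0 ?offspring_mean_ge0// fine_ge0// law_mean_ge0. Qed.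

Lemma measurable_loss a : measurable_fun setT (loss a).
Proof.
apply: measurable_funM; first exact: measurable_inv_offspring.
by apply: measurableT_comp => //; apply: measurable_law_mean.
Qed.

Lemma measurable_loss_env a n : measurable_fun setT (fun w => loss a (env xi l n w)).
Proof. exact: (measurableT_comp (measurable_loss a) (measurable_env xi l n)). Qed.

Lemma law_mean_excess_fin a e : good_env p e -> law_mean p (fun k => (k - a)%N%:R) e \is a fin_num.
Proof.
move=> ge; rewrite ge0_fin_numE ?law_mean_ge0//; apply: le_lt_trans ge.2.
by apply: le_law_mean => // k; rewrite ler_wpM2r ?fine_ge0// ler_nat leq_subr.
Qed.

Lemma lossE a e : good_env p e -> (0 < a)%N ->
  trunc_mean p a e = offspring_mean p e * (1 - loss a e).
Proof.
move=> ge a0; have om0 : offspring_mean p e != 0.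
  by rewrite gt_eqF// (lt_le_trans _ (offspring_mean_ge1 ge)).
rewrite mulrBr mulr1 /loss mulVKf//.
apply/eqP; rewrite -subr_eq opprK eq_sym; apply/eqP.
apply: EFin_inj; rewrite EFinD [X in (_ + X)%E]fineK ?law_mean_excess_fin// -offspring_meanE//.
rewrite -trunc_meanE// -law_meanD//; apply: eq_eseriesr => k _; rewrite -natrD.
by congr (_%:R * _)%:E; rewrite minnE subnK// leq_subr.
Qed.

Lemma loss_itv a e : good_env p e -> (0 < a)%N -> 0 <= loss a e <= 1.
Proof.
move=> ge a0; rewrite loss_ge0/= -subr_ge0.
have om0 : 0 < offspring_mean p e by rewrite (lt_le_trans _ (offspring_mean_ge1 ge)).
by rewrite -(pmulr_rge0 _ om0) -lossE// ltW// trunc_mean_gt0.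
Qed.

Lemma integral_loss a n :
  (\int[P]_w (loss a (env xi l n w))%:E =
   \int[P]_w ((om 0 w)^-1 * (X l 0%N 0%N w - a)%N%:R)%:E)%E.
Proof.
rewrite (env_invariant xi_iid l n (G := fun e => (loss a e)%:E)); last 2 first.
- by apply/measurable_EFinP; exact: measurable_loss.
- by move=> e; rewrite lee_fin loss_ge0.
have i0 e : 0 <= (offspring_mean p e)^-1 by rewrite invr_ge0 offspring_mean_ge0.
rewrite (quenched_mean X_law l 0 0 (f := fun k => (k - a)%N%:R) (measurable_inv_offspring p) i0)//.
apply: ae_eq_integral => //.
- by apply/measurable_EFinP; exact: measurable_loss_env.
- apply: emeasurable_funM.
    apply/measurable_EFinP.
    exact: (measurableT_comp (measurable_inv_offspring p) (measurable_env xi l 0)).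
  by apply: measurableT_comp (measurable_env xi l 0); exact: measurable_law_mean.
- apply: filterS (aeg 0) => w gw _.
  by rewrite /loss EFinM fineK ?law_mean_excess_fin.
Qed.

(** The environments are identically distributed, so the expected losses can
    all be computed in generation zero, where they add up to the sum of
    excesses of one and the same variable. *)
Lemma total_loss_small (b e : R) : 1 < b -> 0 < e ->
  exists2 A, (2 <= A)%N & forall k I,
  (\sum_(j < I) \int[P]_w (loss (A + Num.truncn (b ^+ j)) (env xi l (k + j) w))%:E <= e%:E)%E.
Proof.
move=> b1 e0; have lb : 0 < ln b by rewrite ln_gt0.
have i0 w : 0 <= (om 0 w)^-1 by rewrite invr_ge0 offspring_mean_ge0.
have mi : measurable_fun setT (fun w => (om 0 w)^-1).
  exact: (measurableT_comp (measurable_inv_offspring p) (measurable_env xi l 0)).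
have lp0 (x : R) : 0 <= lnplus x by rewrite /lnplus le_max lexx orbT.
pose h w : R := (om 0 w)^-1 * ((X l 0%N 0%N w)%:R * (1 + (ln b)^-1 * lnplus (X l 0%N 0%N w)%:R)).
have mX (f : nat -> R) : measurable_fun setT (fun w => f (X l 0%N 0%N w)).
  exact: (measurable_offspring X l 0 0 f).
have mh : measurable_fun setT h.
  by apply: measurable_funM => //; exact: (mX (fun x => x%:R * (1 + (ln b)^-1 * lnplus x%:R))).
have h0 w : 0 <= h w.
  by rewrite mulr_ge0// mulr_ge0// addr_ge0// mulr_ge0// invr_ge0 ltW.
have hfin : (\int[P]_w (h w)%:E < +oo)%E.
  have -> : (\int[P]_w (h w)%:E = \int[P]_w (((om 0 w)^-1 * (X l 0%N 0%N w)%:R)%:E +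
    (ln b)^-1%:E * ((om 0 w)^-1 * (X l 0 0 w)%:R * lnplus (X l 0%N 0%N w)%:R)%:E))%E.
    by apply: eq_integral => w _; rewrite -EFinM -EFinD; congr EFin; rewrite /h; ring.
  rewrite ge0_integralD//; last 4 first.
  - by move=> w _; rewrite lee_fin mulr_ge0.
  - by apply/measurable_EFinP; apply: measurable_funM => //; exact: (mX (fun x => x%:R)).
  - by move=> w _; rewrite -EFinM lee_fin !mulr_ge0// invr_ge0 ltW.
  - apply: measurable_funeM; apply/measurable_EFinP; apply: measurable_funM.
      by apply: measurable_funM => //; exact: (mX (fun x => x%:R)).
    exact: (mX (fun x => lnplus x%:R)).
  rewrite (integral_normalised xi_iid X_law m_finite p0_eq0) ge0_integralZl//.
  - by rewrite lte_add_pinfty ?ltry// lte_mul_pinfty// lee_fin invr_ge0 ltW.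
  - apply/measurable_EFinP; apply: measurable_funM.
      by apply: measurable_funM => //; exact: (mX (fun x => x%:R)).
    exact: (mX (fun x => lnplus x%:R)).
  - by move=> w _; rewrite lee_fin !mulr_ge0.
  - by rewrite lee_fin invr_ge0 ltW.
have [A0 hA0] := tail_integral_small (N := X l 0%N 0%N) mh (measurable_funPT _) h0 hfin e0.
exists (maxn 2 A0); first exact: leq_maxl.
move=> k I; set A := maxn 2 A0.
under eq_bigr => j _ do rewrite integral_loss.
rewrite -ge0_integral_sum//; first last.
- by move=> j w _; rewrite lee_fin mulr_ge0.
- move=> j; apply/measurable_EFinP; apply: measurable_funM => //.
  exact: (mX (fun x => (x - _)%N%:R)).
apply: le_trans (hA0 A (leq_maxr _ _)); under eq_integral do rewrite sumEFin -mulr_sumr.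
apply: ae_le_integralE.
- by apply: measurable_funM => //; exact: (mX (fun x => \sum_(j < I) (x - _)%N%:R)).
- by apply: measurable_funM => //; exact: (mX (fun x => (A < x)%N%:R)).
- by move=> w; rewrite mulr_ge0// sumr_ge0.
- by move=> w; rewrite mulr_ge0.
- apply: aeW => w; rewrite /h -mulrA ler_wpM2l//.
  exact: sum_excess_le.
Qed.

End TruncationLoss.

(** * Tightness of the error *)

Section ErrorTails.
Context {d : measure_display} {T : measurableType d} {R : realType}.
Variable P : probability T R.
Variable xi : nat -> {RV P >-> (R * R)%type}.
Variable p : R.-pker R ~> nat.
Variable X : 'I_2 -> nat -> nat -> {RV P >-> nat}.
Hypothesis xi_iid : iid xi.
Hypothesis X_law : quenched_offspring xi p X.
Variable l : 'I_2.
Hypothesis m_finite : {ae P, forall w, (emean xi p l 0 w < +oo)%E}.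
Hypothesis p0_eq0 : {ae P, forall w, p (env xi l 0 w) [set 0%N] = 0%E}.
Hypothesis var_pos : (0 < 'V_P[M xi p l 0])%E.
Hypothesis var_fin : ('V_P[M xi p l 0] < +oo)%E.

Notation tm a n w := (trunc_mean p a (env xi l n w)).
Notation om n w := (offspring_mean p (env xi l n w)).
Notation r := (inv_mean2 xi p l).
Notation LG n w := (log_growth xi p l n w).
Notation lnZ n w := (ln (Z X l n w)%:R : R).

Hypothesis log_moment :
  (\int[P]_w ((om 0 w)^-1 * (X l 0 0 w)%:R * lnplus (X l 0%N 0%N w)%:R)%:E < +oo)%E.

Let ae_good : {ae P, forall w, forall n, good_env p (env xi l n w)}.
Proof. by apply: ae_foralln => n; exact: (ae_good_env xi_iid m_finite p0_eq0). Qed.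

Let om_pos w : (forall n, good_env p (env xi l n w)) -> forall n, 0 < om n w.
Proof. by move=> gw n; rewrite (lt_le_trans _ (offspring_mean_ge1 (gw n))). Qed.

Lemma exp_log_growth n w : (forall n, good_env p (env xi l n w)) ->
  expR (LG n w) = \prod_(j < n) om j w.
Proof.
move=> gw; rewrite /log_growth expR_sum; apply: eq_bigr => j _.
by rewrite /M mean_offspring_mean lnK// posrE om_pos.
Qed.

Lemma measurable_lnZ n : measurable_fun setT (fun w => lnZ n w).
Proof.
apply: (@measurableT_comp _ _ _ _ _ _ (fun u : nat => (ln u%:R : R)) _ (Z X l n)) => //.
exact: (measurable_Z xi).
Qed.

Let inv_growth n w := \prod_(j < n) (om j w)^-1.

Let inv_growth_ge0 n w : 0 <= inv_growth n w.
Proof. by apply: prodr_ge0 => j _; rewrite invr_ge0 offspring_mean_ge0. Qed.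

Let mfun_inv_growth n : mfun_of (past xi X n) (inv_growth n).
Proof.
apply: measurable_prod => j _.
apply: (measurableT_comp (measurable_inv_offspring p)).
by apply: (measurableT_comp (@measurable_component R l)); exact: mfun_xi.
Qed.

Lemma integral_normalised_Z n : (\int[P]_w (inv_growth n w * (Z X l n w)%:R)%:E = 1)%E.
Proof.
elim: n => [|n IH].
  by under eq_integral do rewrite /inv_growth big_ord0 mulr1; rewrite integral_cstE.
transitivity (\int[P]_w (inv_growth n w * ((om n w)^-1 *
    \sum_(j < Z X l n w) (X l n j w)%:R))%:E)%E.
  by apply: eq_integral => w _; rewrite /inv_growth big_ord_recr/= natr_sum mulrA.
rewrite (integral_random_sum xi_iid X_law (@mfun_inv_growth n) (@mfun_Z _ _ _ _ xi X l n)
  (inv_growth_ge0 n) (measurable_inv_offspring p) _ (f := fun u => u%:R) _ (c := 1))//.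
- by rewrite IH mule1.
- by move=> e; rewrite invr_ge0 offspring_mean_ge0.
- by move=> j; exact: (integral_normalised xi_iid X_law m_finite p0_eq0).
Qed.

(** Markov's inequality for the normalised population size. *)
Lemma upper_tail n t : (P [set w | (lnZ n w - LG n w > t)%R] <= (expR (- t))%:E)%E.
Proof.
set B := [set w | _].
have mB : measurable B.
  apply: (measurable_lt_set (f := cst t)) => //.
  by apply: measurable_funB; [exact: measurable_lnZ|exact: measurable_log_growth].
have mW : measurable_fun setT (fun w => inv_growth n w * (Z X l n w)%:R).
  apply: measurable_funM; first exact: (@mfun_past _ _ _ P xi X n _ _ _ (@mfun_inv_growth n)).
  apply: (@measurableT_comp _ _ _ _ _ _ (fun u : nat => (u%:R : R)) _ (Z X l n)) => //.
  exact: (measurable_Z xi).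
have W0 w : 0 <= inv_growth n w * (Z X l n w)%:R by rewrite mulr_ge0.
apply: (@le_trans _ _ (\int[P]_w (expR (- t) * (inv_growth n w * (Z X l n w)%:R))%:E)%E).
  rewrite -[X in P X]setIT -integral_indic//; apply: ae_le_integralE => //.
  - exact: measurable_funM.
  - by move=> w; rewrite mulr_ge0// expR_ge0.
  - apply: filterS2 ae_good (ae_Z_gt0 xi_iid X_law m_finite p0_eq0) => w gw Z0.
    rewrite indicE; case: (boolP (w \in B)) => [|_]; last by rewrite mulr_ge0// expR_ge0.
    rewrite inE /B /= => tB.
    have -> : inv_growth n w = expR (- LG n w).
      by rewrite expRN exp_log_growth// -prodfV.
    have -> : (Z X l n w)%:R = expR (lnZ n w) by rewrite lnK// posrE ltr0n.
    by rewrite -!expRD -[leLHS]expR0 ler_expR; lra.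
under eq_integral do rewrite EFinM.
rewrite ge0_integralZl//.
- by rewrite integral_normalised_Z mule1.
- exact/measurable_EFinP.
- by move=> w _; rewrite lee_fin.
Qed.

Section Thresholds.
Variables (a : nat -> nat) (k I : nat) (K : R).
Hypothesis a2 : forall i, (2 <= a i)%N.

Let U w := inv_prod xi p X l a k I w * (Ztrunc X l a k I w)%:R.
Let D w := \sum_(j < I) loss p (a j) (env xi l (k + j) w).
Let S w := \sum_(j < k) `|M xi p l j w|.

(** The population keeps a quarter of the product of the means of the later
    generations, one half being lost to the fluctuations and one half to the
    truncation; the first [k] environments account for [K]. *)
Lemma Z_lower_bound w : 2^-1 <= U w -> D w <= 2^-1 -> S w <= K ->
  (forall n, good_env p (env xi l n w)) -> (0 < Z X l k w)%N ->
  LG (k + I) w - (K + ln 4) <= lnZ (k + I) w.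
Proof.
move=> hU hD hS gw Zk.
have a0 i : (0 < a i)%N by exact: ltn_trans (a2 i).
have tmpos : 0 < \prod_(j < I) tm (a j) (k + j) w.
  by apply: prodr_gt0 => j _; exact: trunc_mean_gt0.
have ompos : 0 < \prod_(j < I) om (k + j) w by apply: prodr_gt0 => j _; exact: om_pos.
have Zt : 2^-1 * \prod_(j < I) tm (a j) (k + j) w <= (Ztrunc X l a k I w)%:R.
  have -> : (Ztrunc X l a k I w)%:R = U w * ((Z X l k w)%:R * \prod_(j < I) tm (a j) (k + j) w).
    rewrite /U /inv_prod prodfV; field.
    by rewrite pnatr_eq0 -lt0n Zk gt_eqF.
  apply: ler_pM => //; first by rewrite ltW.
  by rewrite ler_peMl ?(ltW tmpos)// ler1n.
have tmom : 2^-1 * \prod_(j < I) om (k + j) w <= \prod_(j < I) tm (a j) (k + j) w.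
  have -> : \prod_(j < I) tm (a j) (k + j) w =
      \prod_(j < I) om (k + j) w * \prod_(j < I) (1 - loss p (a j) (env xi l (k + j) w)).
    by rewrite -big_split/=; apply: eq_bigr => j _; rewrite lossE.
  rewrite mulrC ler_pM2l//.
  apply: le_trans (prod_one_minus I (x := fun j => loss p (a j) (env xi l (k + j) w)) _).
    by rewrite -/(D w); lra.
  by move=> j; exact: loss_itv.
have Zom : 4^-1 * \prod_(j < I) om (k + j) w <= (Z X l (k + I) w)%:R.
  have : (Ztrunc X l a k I w)%:R <= (Z X l (k + I) w)%:R :> R by rewrite ler_nat Ztrunc_le.
  lra.
have e4 : 4^-1 * \prod_(j < I) om (k + j) w =
    expR (- ln 4 + \sum_(j < I) M xi p l (k + j) w).
  rewrite expRD expRN lnK ?posrE//; congr (_ * _).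
  rewrite expR_sum; apply: eq_bigr => j _.
  by rewrite /M mean_offspring_mean lnK// posrE om_pos.
have Zpos : (0 : R) < (Z X l (k + I) w)%:R by rewrite (lt_le_trans _ Zom)// mulr_gt0.
have h : - ln 4 + \sum_(j < I) M xi p l (k + j) w <= lnZ (k + I) w.
  by rewrite -ler_expR -e4 lnK// posrE.
have : \sum_(j < k) M xi p l j w <= K.
  by apply: le_trans hS; apply: ler_sum => j _; exact: ler_norm.
have -> : LG (k + I) w = \sum_(j < k) M xi p l j w + \sum_(j < I) M xi p l (k + j) w.
  by rewrite /log_growth big_split_ord/=.
lra.
Qed.

(** The three ways in which [Z_lower_bound] can fail; the last two are
    estimated by Markov's inequality. *)
Lemma lower_tail_bound : 0 < K ->
  (P [set w | (lnZ (k + I) w < LG (k + I) w - (K + ln 4))%R] <=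
   P [set w | (U w < 2^-1)%R] +
   2%:E * (\sum_(j < I) \int[P]_w (loss p (a j) (env xi l (k + j) w))%:E) +
   K^-1%:E * (k%:R * fine (\int[P]_w `|M xi p l 0 w|%:E))%:E)%E.
Proof.
move=> K0; set A := [set w | (lnZ _ _ < _)%R]; set B := [set w | _].
have mU : measurable_fun setT U.
  apply: (@mfun_past _ _ _ P xi X (k + I)).
  apply: measurable_funM; first exact: mfun_inv_prod.
  by apply: (mfun_nat_comp (fun n => n%:R)); exact: mfun_Ztrunc.
have mA : measurable A.
  apply: measurable_lt_set; first exact: measurable_lnZ.
  by apply: measurable_funB => //; exact: measurable_log_growth.
have mB : measurable B.
  exact: measurable_lt_set.
have mD j : measurable_fun setT (fun w => loss p (a j) (env xi l (k + j) w)).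
  exact: measurable_loss_env.
have mN j : measurable_fun setT (fun w => `|M xi p l j w|).
  by apply: measurableT_comp; [exact: normr_measurable|exact: measurable_M].
have mS : measurable_fun setT S by exact: measurable_sum.
have mDs : measurable_fun setT D by exact: measurable_sum.
have D0 w : 0 <= D w by apply: sumr_ge0 => j _; exact: loss_ge0.
have S0 w : 0 <= S w by apply: sumr_ge0.
have Mfin : (\int[P]_w `|M xi p l 0 w|%:E)%E \is a fin_num.
  rewrite ge0_fin_numE; last by apply: integral_ge0 => w _; rewrite lee_fin.
  by have /integrableP[] := M_integrable var_fin.
apply: (@le_trans _ _ (\int[P]_w (\1_B w + 2 * D w + K^-1 * S w)%:E)%E).
  rewrite -[X in (P X <= _)%E]setIT -integral_indic//; apply: ae_le_integralE => //.
  - apply: measurable_funD; last exact: measurable_funM.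
    by apply: measurable_funD; [exact: measurable_indic|exact: measurable_funM].
  - by move=> w; rewrite !addr_ge0// mulr_ge0// invr_ge0 ltW.
  - apply: filterS2 ae_good (ae_Z_gt0 xi_iid X_law m_finite p0_eq0) => w gw Z0.
    have K1 : 0 <= K^-1 * S w by rewrite mulr_ge0// invr_ge0 ltW.
    have D1 : 0 <= 2 * D w by rewrite mulr_ge0.
    rewrite indicE; case: (boolP (w \in A)) => [|_]; last by rewrite !addr_ge0.
    rewrite inE /A /= => hA.
    have [Bw|NB] := boolP (w \in B).
      by rewrite indicE Bw -addrA lerDl addr_ge0.
    have [D2|D2] := leP (D w) 2^-1; last first.
      rewrite indicE (negbTE NB) add0r; apply: (@le_trans _ _ (2 * D w)).
        by rewrite /=; lra.
      by rewrite lerDl.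
    have [S2|S2] := leP (S w) K; last first.
      rewrite indicE (negbTE NB) add0r; apply: (@le_trans _ _ (K^-1 * S w)).
        by rewrite mulrC ler_pdivlMr// mul1r ltW.
      by rewrite lerDr.
    exfalso; have hU : 2^-1 <= U w.
      by rewrite leNgt; apply/negP => h; move/negP: NB; apply; rewrite inE.
    by have := Z_lower_bound hU D2 S2 gw (Z0 k); rewrite leNgt hA.
under eq_integral do rewrite EFinD EFinD.
rewrite ge0_integralD//; first last.
- by apply/measurable_EFinP; exact: measurable_funM.
- by move=> w _; rewrite lee_fin mulr_ge0// invr_ge0 ltW.
- apply: emeasurable_funD; first by apply/measurable_EFinP; exact: measurable_indic.
  by apply/measurable_EFinP; exact: measurable_funM.
- by move=> w _; rewrite -EFinD lee_fin addr_ge0// mulr_ge0.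
rewrite ge0_integralD//; first last.
- by apply/measurable_EFinP; exact: measurable_funM.
- by move=> w _; rewrite lee_fin mulr_ge0.
- by apply/measurable_EFinP; exact: measurable_indic.
rewrite integral_indic// setIT.
under [X in (_ + X + _)%E]eq_integral do rewrite EFinM.
under [X in (_ + _ + X)%E]eq_integral do rewrite EFinM.
rewrite !ge0_integralZl//; first last.
- by move=> w _; rewrite lee_fin.
- exact/measurable_EFinP.
- by rewrite lee_fin invr_ge0 ltW.
- by move=> w _; rewrite lee_fin.
- exact/measurable_EFinP.
apply: leeD; [apply: leeD => //|].
  under eq_integral do rewrite /D -sumEFin.
  rewrite ge0_integral_sum//.
    by move=> j; apply/measurable_EFinP.
  by move=> j w _; rewrite lee_fin loss_ge0.
apply: lee_wpmul2l; first by rewrite lee_fin invr_ge0 ltW.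
under eq_integral do rewrite /S -sumEFin.
rewrite ge0_integral_sum//; last by move=> j; apply/measurable_EFinP.
under eq_bigr => j _ do rewrite (integral_norm_M p xi_iid) -(fineK Mfin).
by rewrite sumEFin sumr_const card_ord mulr_natl.
Qed.

End Thresholds.

(** The order of the choices matters: the thresholds make the losses small
    whatever the starting generation, then a late starting generation makes
    the fluctuations small, and the finitely many environments before it are
    tight. *)
Lemma lower_tail (e : R) : 0 < e -> exists k K, forall n, (k <= n)%N ->
  (P [set w | (lnZ n w < LG n w - K)%R] <= e%:E)%E.
Proof.
move=> e0; have r0 : 0 <= r by exact: inv_mean2_ge0.
have r1 : r < 1 by exact: (inv_mean2_lt1 xi_iid m_finite p0_eq0 var_pos).
(* Any [b > 1] with [b * r < 1] will do. *)
pose b : R := 2 / (1 + r).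
have r2 : 0 < 1 + r by rewrite ltr_wpDr.
have b1 : 1 < b by rewrite /b ltr_pdivlMr// mul1r; lra.
have b0 : 0 < b by exact: lt_trans b1.
have q0 : 0 <= b * r by rewrite mulr_ge0// ltW.
have q1 : b * r < 1 by rewrite /b mulrAC ltr_pdivrMr// mul1r; lra.
have e3 : 0 < e / 6 by rewrite divr_gt0.
have [A A2 hA] := total_loss_small xi_iid X_law m_finite p0_eq0 log_moment b1 e3.
pose a j := (A + Num.truncn (b ^+ j))%N.
have a2 i : (2 <= a i)%N by rewrite (leq_trans A2)// leq_addr.
pose C : R := 4 * ((A%:R + 1) * (1 - b * r)^-1).
have A1 : 0 < A%:R + 1 :> R by rewrite ltr_wpDl.
have C0 : 0 < C by rewrite !mulr_gt0// invr_gt0 subr_gt0.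
have aC I : 4 * \sum_(j < I) (a j)%:R * r ^+ j.+1 <= C.
  rewrite /C ler_pM2l//.
  apply: (@le_trans _ _ ((A%:R + 1) * \sum_(j < I) (b * r) ^+ j)); last first.
    by rewrite (ler_pM2l A1); exact: sum_geometric_le.
  rewrite mulr_sumr; apply: ler_sum => j _.
  have bj : 1 <= b ^+ j by rewrite exprn_ege1// ltW.
  rewrite exprMn mulrA; apply: ler_pM => //.
  - exact: exprn_ge0.
  - rewrite /a natrD mulrDl mul1r; apply: lerD; first by rewrite ler_peMr.
    by rewrite truncn_le (le_trans _ bj).
  - by rewrite exprS ler_piMl ?exprn_ge0// ltW.
have [k hk] := integral_inv_Z_small xi_iid X_law m_finite p0_eq0 var_pos
  (divr_gt0 (divr_gt0 e0 (ltr0n R 3)) C0).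
pose m0 := fine (\int[P]_w `|M xi p l 0 w|%:E)%E.
have m00 : 0 <= m0 by apply: fine_ge0; apply: integral_ge0 => w _; rewrite lee_fin.
pose K : R := (k%:R * m0 + 1) / (e / 3).
have K0 : 0 < K by rewrite divr_gt0 ?divr_gt0// ltr_wpDl// mulr_ge0.
exists k, (K + ln 4) => n kn.
rewrite -(subnKC kn); set I := (n - k)%N.
apply: le_trans (lower_tail_bound k I a2 K0) _.
have -> : e%:E = (e / 3 + 2 * (e / 6) + e / 3)%:E by congr EFin; field.
rewrite [leRHS]EFinD [X in (_ <= X + _)%E]EFinD; apply: leeD; first apply: leeD.
- apply: le_trans (Ztrunc_small xi_iid X_law m_finite p0_eq0 k a2 I) _.
  have -> : (e / 3)%:E = (C%:E * (e / 3 / C)%:E)%E.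
    by rewrite -EFinM; congr EFin; field; rewrite gt_eqF.
  apply: lee_pmul => //.
  + rewrite lee_fin mulr_ge0// sumr_ge0// => j _.
    by rewrite mulr_ge0// exprn_ge0.
  + by apply: integral_ge0 => w _; rewrite lee_fin.
  + by rewrite lee_fin.
- by rewrite [leRHS]EFinM; apply: lee_wpmul2l => //; exact: hA.
- rewrite -EFinM lee_fin -/m0 ler_pdivrMl// /K divfK ?lerDl//.
  by rewrite gt_eqF// divr_gt0.
Qed.

(** The upper tail is controlled in every generation, the lower one from some
    generation on. *)
Lemma log_Z_tight (e : R) : 0 < e -> exists k K, 0 < K /\ forall n, (k <= n)%N ->
  (P [set w | (`|lnZ n w - LG n w| > K)%R] <= e%:E)%E.
Proof.
move=> e0; have e2 : 0 < e / 2 by rewrite divr_gt0.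
have [k [K hK]] := lower_tail e2.
pose K' := Num.max 1 (Num.max K (- ln (e / 2))).
have K1 : 1 <= K' by rewrite /K' le_max lexx.
have KK : K <= K' by rewrite /K' !le_max lexx orbT.
have KE : - ln (e / 2) <= K' by rewrite /K' !le_max lexx !orbT.
exists k, K'; split; first exact: lt_le_trans K1.
move=> n kn; have mL : measurable_fun setT (fun w => lnZ n w - LG n w).
  by apply: measurable_funB; [exact: measurable_lnZ|exact: measurable_log_growth].
have m1 : measurable [set w | (lnZ n w - LG n w > K')%R].
  exact: (measurable_lt_set (f := cst K')).
have m2 : measurable [set w | (lnZ n w < LG n w - K)%R].
  apply: measurable_lt_set; first exact: measurable_lnZ.
  by apply: measurable_funB => //; exact: measurable_log_growth.
have m3 : measurable [set w | (`|lnZ n w - LG n w| > K')%R].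
  apply: (measurable_lt_set (f := cst K')) => //.
  by apply: measurableT_comp => //; exact: normr_measurable.
apply: (@le_trans _ _ (P ([set w | (lnZ n w - LG n w > K')%R] `|`
    [set w | (lnZ n w < LG n w - K)%R]))).
  apply: le_measure; rewrite ?inE//; first exact: measurableU.
  move=> w /=; rewrite ltr_normr => /orP[h|h]; [by left|right].
  by rewrite /=; lra.
apply: (le_trans (measureU2 _ _ _)) => //.
rewrite [e]splitr EFinD; apply: leeD; last exact: hK.
apply: (le_trans (upper_tail n K')); rewrite lee_fin -[leRHS]lnK ?posrE//.
by rewrite ler_expR; lra.
Qed.

End ErrorTails.

(** * Independence for signed variables *)

Section SignedIndependence.
Context {d : measure_display} {T : measurableType d} {R : realType}.
Variable P : probability T R.
Variable xi : nat -> {RV P >-> (R * R)%type}.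
Variable p : R.-pker R ~> nat.
Variable X : 'I_2 -> nat -> nat -> {RV P >-> nat}.
Hypothesis xi_iid : iid xi.
Hypothesis X_law : quenched_offspring xi p X.
Variable n : nat.

Let past_sub : past xi X n `<=` measurable := @cylinders_measurable _ _ _ P xi X _.
Let present_sub : present xi X n `<=` measurable := @cylinders_measurable _ _ _ P xi X _.

Let nonneg_case (Y H : T -> R) (L : R) :
  mfun_of (past xi X n) Y -> mfun_of (present xi X n) H ->
  (forall w, 0 <= Y w <= L) -> (forall w, 0 <= H w) -> Pintegrable P H ->
  \int[P]_w (Y w * H w) = \int[P]_w Y w * \int[P]_w H w.
Proof.
move=> mY mH Y01 H0 iH; have Y0 w : 0 <= Y w by have /andP[] := Y01 w.
have iY : Pintegrable P Y.
  apply: (@Pintegrable_bounded _ _ _ _ _ L); first exact: mfun_of_measurable mY.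
  by move=> w; rewrite ger0_norm//; have /andP[] := Y01 w.
rewrite /Rintegral (past_present_integralM xi_iid X_law mY mH Y0 H0) fineM//.
- exact: integral_fune_fin_num iY.
- exact: integral_fune_fin_num iH.
Qed.

Let pos_part_mfun G (H : T -> R) : mfun_of G H -> mfun_of G (fun w => Num.max (H w) 0).
Proof. by move=> mH; apply: measurable_maxr => //; exact: measurable_cst. Qed.

Let neg_part_mfun G (H : T -> R) : mfun_of G H -> mfun_of G (fun w => Num.max (- H w) 0).
Proof.
move=> mH; apply: measurable_maxr; last exact: measurable_cst.
exact: measurableT_comp mH.
Qed.

Let partE (x : R) : x = Num.max x 0 + -1 * Num.max (- x) 0.
Proof.
case: (leP x 0) => x0.
  by rewrite max_l ?oppr_ge0// mulN1r opprK add0r.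
by rewrite max_r ?oppr_le0 ?ltW// mulr0 addr0.
Qed.

Let part_integrable (H : T -> R) (s : R) : Pintegrable P H -> measurable_fun setT H ->
  `|s| <= 1 -> Pintegrable P (fun w => Num.max (s * H w) 0).
Proof.
move=> iH mH s1; apply: (Pintegrable_le _ (integrable_norm iH)).
  by apply: measurable_maxr => //; exact: measurable_funM.
move=> w /=; rewrite ger0_norm ?le_max ?lexx ?orbT// ge_max normr_ge0 andbT.
by rewrite (le_trans (ler_norm _))// normrM ler_piMl.
Qed.

Let signed_case (Y H : T -> R) (L : R) :
  mfun_of (past xi X n) Y -> mfun_of (present xi X n) H ->
  (forall w, 0 <= Y w <= L) -> Pintegrable P H ->
  \int[P]_w (Y w * H w) = \int[P]_w Y w * \int[P]_w H w.
Proof.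
move=> mY mH Y01 iH.
have mH' : measurable_fun setT H := mfun_of_measurable present_sub mH.
have mY' : measurable_fun setT Y := mfun_of_measurable past_sub mY.
have YL w : `|Y w| <= L by have /andP[h0 h1] := Y01 w; rewrite ger0_norm.
have i1 : Pintegrable P (fun w => Num.max (H w) 0).
  have := part_integrable (s := 1) iH mH'; rewrite normr1 => /(_ (lexx _)).
  by under eq_fun do rewrite mul1r.
have i2 : Pintegrable P (fun w => Num.max (- H w) 0).
  have := part_integrable (s := -1) iH mH'; rewrite normrN1 => /(_ (lexx _)).
  by under eq_fun do rewrite mulN1r.
have j1 := PintegrableM mY' YL i1; have j2 := PintegrableM mY' YL i2.
transitivity (\int[P]_w (Y w * Num.max (H w) 0 + -1 * (Y w * Num.max (- H w) 0))).
  by apply: eq_Rintegral => w _; rewrite {1}(partE (H w)); ring.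
rewrite PintegralD ?PintegralZ//; last exact: PintegrableZ.
rewrite (nonneg_case (L := L) mY (pos_part_mfun mH))//; last by move=> w; rewrite le_max lexx orbT.
rewrite (nonneg_case (L := L) mY (neg_part_mfun mH))//; last by move=> w; rewrite le_max lexx orbT.
have -> : \int[P]_w H w = \int[P]_w (Num.max (H w) 0 + -1 * Num.max (- H w) 0).
  by apply: eq_Rintegral => w _; exact: partE.
rewrite PintegralD ?PintegralZ//; last exact: PintegrableZ.
by ring.
Qed.

(** The positive and negative parts of [H] are handled separately, and [Y] is
    made nonnegative by adding its bound. *)
Lemma past_present_PintegralM (Y H : T -> R) (L : R) :
  mfun_of (past xi X n) Y -> mfun_of (present xi X n) H ->
  (forall w, `|Y w| <= L) -> Pintegrable P H ->
  \int[P]_w (Y w * H w) = \int[P]_w Y w * \int[P]_w H w.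
Proof.
move=> mY mH YL iH.
have mY' : measurable_fun setT Y := mfun_of_measurable past_sub mY.
have iY : Pintegrable P Y by exact: Pintegrable_bounded YL.
have mYL : mfun_of (past xi X n) (fun w => Y w + L).
  by apply: measurable_funD => //; exact: measurable_cst.
have YL' w : 0 <= Y w + L <= L + L.
  by have := YL w; rewrite ler_norml => /andP[h1 h2]; rewrite lerD2r h2 andbT; lra.
have := signed_case mYL mH YL' iH.
have -> : \int[P]_w ((Y w + L) * H w) = \int[P]_w (Y w * H w + L * H w).
  by apply: eq_Rintegral => w _; rewrite mulrDl.
have iYH := PintegrableM mY' YL iH; have iLH := PintegrableZ L iH.
rewrite (PintegralD iYH iLH) (PintegralD iY (Pintegrable_cst P L)) PintegralZ//.
by rewrite Pintegral_cst mulrDl => /addIr.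
Qed.

End SignedIndependence.

Section EnvironmentFunctions.
Context {d : measure_display} {T : measurableType d} {R : realType}.
Variable P : probability T R.
Variable xi : nat -> {RV P >-> (R * R)%type}.
Hypothesis xi_iid : iid xi.
Variable G : R * R -> R.
Hypothesis mG : measurable_fun setT G.

(** The positive and negative parts of [G] have the same integrals in all
    generations. *)
Lemma Pintegral_env_invariant n :
  \int[P]_w G (xi n w) = \int[P]_w G (xi 0 w).
Proof.
have mGE : measurable_fun setT (EFin \o G) by exact/measurable_EFinP.
rewrite /Rintegral; congr fine; rewrite integralE [RHS]integralE.
congr (_ - _)%E.
  under eq_integral do rewrite funeposE; under [RHS]eq_integral do rewrite funeposE.
  apply: (env_law_invariant xi_iid n (G := (fun e => maxe (G e)%:E 0)%E)).
    by apply: measurable_maxe => //; exact: measurable_cst.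
  by move=> e; rewrite le_max lexx orbT.
under eq_integral do rewrite funenegE; under [RHS]eq_integral do rewrite funenegE.
apply: (env_law_invariant xi_iid n (G := (fun e => maxe (- (G e)%:E) 0)%E)).
  apply: measurable_maxe; last exact: measurable_cst.
  exact: measurableT_comp mGE.
by move=> e; rewrite le_max lexx orbT.
Qed.

Lemma Pintegrable_env_invariant n :
  Pintegrable P (fun w => G (xi 0 w)) -> Pintegrable P (fun w => G (xi n w)).
Proof.
move=> /integrableP[_ h]; apply/integrableP; split.
  by apply/measurable_EFinP; exact: measurableT_comp.
rewrite -[X in (X < _)%E]/(\int[P]_w (abse \o (EFin \o G)) (xi n w))%E (env_law_invariant xi_iid)//.
  by apply: measurableT_comp => //; exact/measurable_EFinP.
by move=> e; exact: abse_ge0.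
Qed.

End EnvironmentFunctions.

(** * Variance of a row *)

Section BoundBelow.
Context {R : realType}.

(** With [t] the smaller of [x] and [y], the cross term is at most a multiple
    of [t]. If the correlation is below one, it is dominated by the squares up
    to the factor [rh]; if it is one, the form is
    [(s1 - s2) ^+ 2 * t] plus a square times [`|x - y|]. *)
Lemma row_variance_ge (s1 s2 rh : R) : 0 < s1 -> 0 < s2 ->
  (-1 <= rh < 1) \/ (rh = 1 /\ s1 <> s2) ->
  exists2 c, 0 < c & forall x y, 0 <= x -> 0 <= y ->
    c * (x + y) <= s1 ^+ 2 * x + s2 ^+ 2 * y - 2 * rh * s1 * s2 * Num.min x y.
Proof.
move=> s10 s20 [/andP[_ rh1]|[-> s12]].
  pose c := Num.min 1 (1 - rh) * Num.min (s1 ^+ 2) (s2 ^+ 2).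
  have q1 : 0 < Num.min (s1 ^+ 2) (s2 ^+ 2) by rewrite lt_min !exprn_gt0.
  have q2 : 0 < Num.min 1 (1 - rh) by rewrite lt_min ltr01 subr_gt0.
  exists c; first by rewrite mulr_gt0.
  move=> x y x0 y0; set t := Num.min x y.
  have t0 : 0 <= t by rewrite le_min x0 y0.
  have tx : t <= x by rewrite ge_min lexx.
  have ty : t <= y by rewrite ge_min lexx orbT.
  set A := s1 ^+ 2 * x + s2 ^+ 2 * y.
  have B1 : 2 * s1 * s2 * t <= A.
    apply: (@le_trans _ _ ((s1 ^+ 2 + s2 ^+ 2) * t)).
      rewrite ler_wpM2r//; have := sqr_ge0 (s1 - s2); rewrite sqrrB -subr_ge0 => h.
      by apply: le_trans h _; rewrite le_eqVlt; apply/orP; left; apply/eqP; ring.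
    by rewrite mulrDl; apply: lerD; rewrite ler_wpM2l// sqr_ge0.
  have B0 : 0 <= 2 * s1 * s2 * t by rewrite !mulr_ge0// ltW.
  have A0 : 0 <= A by exact: le_trans B1.
  have cA : c * (x + y) <= Num.min 1 (1 - rh) * A.
    rewrite /c -mulrA ler_wpM2l ?(ltW q2)// mulrDr /A.
    by apply: lerD; rewrite ler_wpM2r// ge_min lexx ?orbT.
  apply: le_trans cA _.
  have -> : A - 2 * rh * s1 * s2 * t = A - rh * (2 * s1 * s2 * t) by ring.
  have [r0|r0] := leP 0 rh.
    apply: (@le_trans _ _ ((1 - rh) * A)).
      by rewrite ler_wpM2r// ge_min lexx orbT.
    by rewrite mulrBl mul1r lerB// ler_wpM2l.
  apply: (@le_trans _ _ A); first by rewrite ler_piMl// ge_min lexx.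
  by rewrite lerDl -mulNr mulr_ge0// oppr_ge0 ltW.
pose c := 2^-1 * Num.min ((s1 - s2) ^+ 2) (Num.min (s1 ^+ 2) (s2 ^+ 2)).
have d0 : 0 < (s1 - s2) ^+ 2.
  by rewrite exprn_even_gt0//= subr_eq0; apply/eqP.
exists c; first by rewrite mulr_gt0// ?invr_gt0// !lt_min d0 !exprn_gt0.
move=> x y x0 y0.
have key a b u v : 0 <= u -> u <= v -> 2 * c <= a -> 2 * c <= b ->
    c * (u + v) <= a * u + b * (v - u).
  move=> u0 uv ca cb.
  apply: (@le_trans _ _ (2 * c * u + 2 * c * (v - u))); last first.
    by apply: lerD; rewrite ler_wpM2r// subr_ge0.
  rewrite -subr_ge0.
  have -> : 2 * c * u + 2 * c * (v - u) - c * (u + v) = c * (v - u) by ring.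
  rewrite mulr_ge0 ?subr_ge0// mulr_ge0 ?invr_ge0// !le_min !sqr_ge0//.
have c2 : 2 * c = Num.min ((s1 - s2) ^+ 2) (Num.min (s1 ^+ 2) (s2 ^+ 2)).
  by rewrite /c mulrA divff ?mul1r.
have c2d : 2 * c <= (s1 - s2) ^+ 2 by rewrite c2 ge_min lexx.
have c21 : 2 * c <= s1 ^+ 2 by rewrite c2 !ge_min lexx orbT.
have c22 : 2 * c <= s2 ^+ 2 by rewrite c2 !ge_min lexx !orbT.
have [xy|yx] := leP x y.
  apply: (le_trans (key _ _ _ _ x0 xy c2d c22)).
  by rewrite le_eqVlt; apply/orP; left; apply/eqP; ring.
rewrite addrC; apply: (le_trans (key _ _ _ _ y0 (ltW yx) c2d c21)).
by rewrite le_eqVlt; apply/orP; left; apply/eqP; ring.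
Qed.

End BoundBelow.

Section Rows.
Context {d : measure_display} {T : measurableType d} {R : realType}.
Variable P : probability T R.
Variable xi : nat -> {RV P >-> (R * R)%type}.
Variable p : R.-pker R ~> nat.
Variable X : 'I_2 -> nat -> nat -> {RV P >-> nat}.
Hypothesis xi_iid : iid xi.
Hypothesis var_fin : forall l : 'I_2, ('V_P[M xi p l 0] < +oo)%E.

Notation C1 k w := (centered xi p proc1 k w).
Notation C2 k w := (centered xi p proc2 k w).

Definition env_dev l (e : R * R) : R := ln (offspring_mean p (component l e)) - mu xi p l.

Lemma centeredE l k w : centered xi p l k w = env_dev l (xi k w).
Proof. by rewrite /centered /M mean_offspring_mean. Qed.

Lemma measurable_env_dev l : measurable_fun setT (env_dev l).
Proof.
apply: measurable_funB => //; apply: measurableT_comp; first exact: measurable_ln.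
exact: (measurableT_comp (measurable_offspring_mean p) (@measurable_component R l)).
Qed.

Definition env_comb (a b : R) (e : R * R) : R := a * env_dev proc1 e - b * env_dev proc2 e.

Definition comb (a b : R) (k : nat) (w : T) : R := a * C1 k w - b * C2 k w.

Lemma combE a b k w : comb a b k w = env_comb a b (xi k w).
Proof. by rewrite /comb !centeredE. Qed.

Lemma measurable_env_comb a b : measurable_fun setT (env_comb a b).
Proof.
by apply: measurable_funB; apply: measurable_funM => //; exact: measurable_env_dev.
Qed.

Lemma measurable_comb a b k : measurable_fun setT (comb a b k).
Proof.
have -> : comb a b k = env_comb a b \o xi k by apply/funext => w; exact: combE.
exact: (measurableT_comp (measurable_env_comb a b)).
Qed.

Lemma mfun_comb (D : pred nat) a b k : D k -> mfun_of (cylinders xi X D) (comb a b k).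
Proof.
move=> Dk; have -> : comb a b k = env_comb a b \o xi k by apply/funext => w; exact: combE.
apply: (measurableT_comp (measurable_env_comb a b)); exact: mfun_xi.
Qed.

(** The two centred log-means are estimated together: the rows combine them
    with coefficients that depend on the row only. *)
Definition dev_norm (w : T) : R := `|C1 0 w| + `|C2 0 w|.

Lemma measurable_dev_norm : measurable_fun setT dev_norm.
Proof.
by apply: measurable_funD; apply: measurableT_comp; [exact: normr_measurable|
  exact: measurable_centered|exact: normr_measurable|exact: measurable_centered].
Qed.

Lemma dev_norm_ge0 w : 0 <= dev_norm w.
Proof. by rewrite addr_ge0. Qed.

Lemma dev_norm_sqr_integrable : Pintegrable P (fun w => dev_norm w ^+ 2).
Proof.
have i1 := centered_sqr_integrable (var_fin proc1).
have i2 := centered_sqr_integrable (var_fin proc2).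
apply: (Pintegrable_le _ (PintegrableD (PintegrableZ 2 i1) (PintegrableZ 2 i2))).
  by apply: measurable_funX; exact: measurable_dev_norm.
move=> w; rewrite ger0_norm ?sqr_ge0// /dev_norm.
rewrite -(real_normK (num_real (C1 0 w))) -(real_normK (num_real (C2 0 w))).
have := sqr_ge0 (`|C1 0 w| - `|C2 0 w|); rewrite -subr_ge0 => h.
rewrite -subr_ge0; apply: le_trans h _; rewrite le_eqVlt; apply/orP; left; apply/eqP; ring.
Qed.

Lemma comb_le a b (K : R) w : `|a| <= K -> `|b| <= K -> `|comb a b 0 w| <= K * dev_norm w.
Proof.
move=> aK bK; rewrite (le_trans (ler_normB _ _))// !normrM mulrDr.
by apply: lerD; rewrite ler_wpM2r.
Qed.

Lemma comb_sqr_le a b w : comb a b 0 w ^+ 2 <= 2 * (a ^+ 2 + b ^+ 2) * dev_norm w ^+ 2.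
Proof.
have h : `|comb a b 0 w| <= (`|a| + `|b|) * dev_norm w.
  by apply: comb_le; rewrite ?lerDl ?lerDr.
rewrite -(real_normK (num_real (comb a b 0 w))).
apply: (@le_trans _ _ (((`|a| + `|b|) * dev_norm w) ^+ 2)).
  by rewrite lerXn2r// nnegrE// mulr_ge0 ?addr_ge0// dev_norm_ge0.
rewrite exprMn ler_wpM2r ?sqr_ge0//.
rewrite -(real_normK (num_real a)) -(real_normK (num_real b)).
have := sqr_ge0 (`|a| - `|b|); rewrite -subr_ge0 => g.
rewrite -subr_ge0; apply: le_trans g _; rewrite le_eqVlt; apply/orP; left; apply/eqP; ring.
Qed.

Lemma comb_sqr_integrable a b k : Pintegrable P (fun w => comb a b k w ^+ 2).
Proof.
have m2 : measurable_fun setT (fun e => env_comb a b e ^+ 2).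
  by apply: measurable_funX; exact: measurable_env_comb.
under eq_fun do rewrite combE.
apply: (Pintegrable_env_invariant xi_iid m2).
apply: (Pintegrable_le _ (PintegrableZ (2 * (a ^+ 2 + b ^+ 2)) dev_norm_sqr_integrable)).
  exact: (measurableT_comp m2).
by move=> w; rewrite ger0_norm ?sqr_ge0// -combE; exact: comb_sqr_le.
Qed.

Lemma comb_integrable a b k : Pintegrable P (comb a b k).
Proof.
apply: (Pintegrable_le (measurable_comb a b k)
  (PintegrableD (Pintegrable_cst P 1) (comb_sqr_integrable a b k))) => w.
rewrite -(real_normK (num_real (comb a b k w))); set x := `|_|.
have : 0 <= (x - 2^-1) ^+ 2 by exact: sqr_ge0.
rewrite sqrrB; lra.
Qed.

Lemma integral_comb a b k : \int[P]_w comb a b k w = 0.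
Proof.
under eq_Rintegral do rewrite combE.
rewrite (Pintegral_env_invariant xi_iid (measurable_env_comb a b)).
have -> : \int[P]_w env_comb a b (xi 0 w) = \int[P]_w (a * C1 0 w + - b * C2 0 w).
  by apply: eq_Rintegral => w _; rewrite -combE /comb mulNr.
have i1 := centered_integrable (var_fin proc1).
have i2 := centered_integrable (var_fin proc2).
rewrite (PintegralD (PintegrableZ a i1) (PintegrableZ (- b) i2)) !PintegralZ//.
by rewrite !integral_centered// !mulr0 addr0.
Qed.

Lemma integral_product : sigma xi p proc1 != 0 -> sigma xi p proc2 != 0 ->
  \int[P]_w (C1 0 w * C2 0 w) = rho xi p * sigma xi p proc1 * sigma xi p proc2.
Proof.
move=> s1 s2; rewrite /rho -mulrA divfK ?mulf_neq0//.
rewrite covariance.unlock expectation.unlock; congr fine; apply: eq_integral => w _.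
by rewrite /centered /mu expectation.unlock.
Qed.

Lemma integral_comb_sqr a b k : sigma xi p proc1 != 0 -> sigma xi p proc2 != 0 ->
  \int[P]_w (comb a b k w ^+ 2) =
  a ^+ 2 * sigma xi p proc1 ^+ 2 + b ^+ 2 * sigma xi p proc2 ^+ 2
  - 2 * a * b * (rho xi p * sigma xi p proc1 * sigma xi p proc2).
Proof.
move=> s1 s2; under eq_Rintegral do rewrite combE.
have m2 : measurable_fun setT (fun e => env_comb a b e ^+ 2).
  by apply: measurable_funX; exact: measurable_env_comb.
rewrite (Pintegral_env_invariant xi_iid m2).
have i1 := centered_sqr_integrable (var_fin proc1).
have i2 := centered_sqr_integrable (var_fin proc2).
have i12 : Pintegrable P (fun w => C1 0 w * C2 0 w).
  apply: (Pintegrable_le _ (PintegrableD i1 i2)).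
    by apply: measurable_funM; exact: measurable_centered.
  move=> w; rewrite normrM -(real_normK (num_real (C1 0 w))) -(real_normK (num_real (C2 0 w))).
  have := sqr_ge0 (`|C1 0 w| - `|C2 0 w|); rewrite sqrrB.
  have : 0 <= `|C1 0 w| * `|C2 0 w| by rewrite mulr_ge0.
  lra.
have -> : \int[P]_w (env_comb a b (xi 0 w) ^+ 2) =
    \int[P]_w ((a ^+ 2 * C1 0 w ^+ 2 + b ^+ 2 * C2 0 w ^+ 2) + (- (2 * a * b)) * (C1 0 w * C2 0 w)).
  by apply: eq_Rintegral => w _; rewrite -combE /comb; ring.
have j1 := PintegrableZ (a ^+ 2) i1; have j2 := PintegrableZ (b ^+ 2) i2.
have j12 := PintegrableZ (- (2 * a * b)) i12.
rewrite (PintegralD (PintegrableD j1 j2) j12) (PintegralD j1 j2) !PintegralZ//.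
by rewrite -!sigma_sqr integral_product// mulNr.
Qed.

End Rows.

(** * Central limit theorem for the random walks *)

Section SumBelow.
Context {R : comPzRingType}.

Lemma sum_below (n N : nat) (c : nat -> R) : (n <= N)%N ->
  \sum_(k < N) (if (k < n)%N then c k else 0) = \sum_(k < n) c k.
Proof.
move=> nN; rewrite -(big_mkord xpredT (fun k => if (k < n)%N then c k else 0)).
rewrite (@big_cat_nat _ _ _ n)//= [X in _ + X]big1_seq ?addr0; last first.
  by move=> k /andP[_]; rewrite mem_index_iota => /andP[nk _]; rewrite ltnNge nk.
by rewrite big_mkord; apply: eq_bigr => k _; rewrite ltn_ord.
Qed.

Lemma sum_below_cst (n N : nat) (c : R) : (n <= N)%N ->
  \sum_(k < N) (if (k < n)%N then c else 0) = n%:R * c.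
Proof. by move=> nN; rewrite (sum_below (fun=> c))// sumr_const card_ord mulr_natl. Qed.

End SumBelow.

Section RowCLT.
Context {d : measure_display} {T : measurableType d} {R : realType}.
Variable P : probability T R.
Variable xi : nat -> {RV P >-> (R * R)%type}.
Variable p : R.-pker R ~> nat.
Variable X : 'I_2 -> nat -> nat -> {RV P >-> nat}.
Hypothesis xi_iid : iid xi.
Hypothesis X_law : quenched_offspring xi p X.
Hypothesis var_pos : forall l : 'I_2, (0 < 'V_P[M xi p l 0])%E.
Hypothesis var_fin : forall l : 'I_2, ('V_P[M xi p l 0] < +oo)%E.

Notation comb := (comb xi p).
Notation W := (dev_norm xi p).

Lemma sigma_gt0 l : 0 < sigma xi p l.
Proof. by rewrite /sigma sqrtr_gt0 fine_gt0// var_pos var_fin. Qed.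

Let W2 := \int[P]_w (W w ^+ 2).

Let W2_ge0 : 0 <= W2.
Proof. by apply: Rintegral_ge0 => w _; exact: sqr_ge0. Qed.

Definition dev_tail (B : nat) := \int[P]_w (W w ^+ 2 * (B < Num.truncn (W w))%N%:R).

Lemma dev_tail_ge0 B : 0 <= dev_tail B.
Proof. by apply: Rintegral_ge0 => w _; rewrite mulr_ge0// sqr_ge0. Qed.

Let measurable_truncW : measurable_fun setT (fun w => Num.truncn (W w)).
Proof.
apply: measurable_to_nat => z; have mW := measurable_dev_norm xi p.
have -> : (fun w => Num.truncn (W w)) @^-1` [set z] =
    [set w | z%:R <= W w] `&` [set w | W w < z.+1%:R].
  apply/seteqP; split => w /=.
    by move=> <-; have /andP[] := truncn_itv (dev_norm_ge0 xi p w).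
  by move=> [h1 h2]; apply: truncn_def; rewrite h1.
apply: measurableI; [apply: measurable_le_set|apply: measurable_lt_set] => //.
Qed.

Let measurable_tail_ind B : measurable_fun setT (fun w => (B < Num.truncn (W w))%N%:R : R).
Proof.
exact: (@measurableT_comp _ _ _ _ _ _ (fun u : nat => ((B < u)%N%:R : R)) _
  (fun w => Num.truncn (W w))).
Qed.

Let measurable_W2 : measurable_fun setT (fun w => W w ^+ 2).
Proof. by apply: measurable_funX; exact: measurable_dev_norm. Qed.

Let tail_integrable B : Pintegrable P (fun w => W w ^+ 2 * (B < Num.truncn (W w))%N%:R).
Proof.
apply: (Pintegrable_le _ (dev_norm_sqr_integrable var_fin)).
  by apply: measurable_funM.
move=> w; rewrite ger0_norm; last by apply: mulr_ge0 => //; exact: sqr_ge0.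
rewrite ler_piMr ?sqr_ge0//.
by rewrite lern1 leq_b1.
Qed.

Lemma dev_tail_small (e : R) : 0 < e -> exists B, dev_tail B <= e.
Proof.
move=> e0; have i := dev_norm_sqr_integrable var_fin.
have fin : (\int[P]_w (W w ^+ 2)%:E < +oo)%E.
  have /integrableP[_] := i.
  by under eq_integral => w _ do rewrite /= ger0_norm ?sqr_ge0//.
have [B hB] := tail_integral_small measurable_W2 measurable_truncW
  (fun w => sqr_ge0 (W w)) fin e0.
exists B; rewrite -lee_fin /dev_tail /Rintegral fineK; first exact: hB.
exact: integral_fune_fin_num (tail_integrable B).
Qed.

(** Where [dev_norm] is at most [B + 1] the summand is at most [K * (B + 1)],
    which gains one power; elsewhere the quadratic bound and the tail of
    [dev_norm ^+ 2] are used. *)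
Lemma comb_lindeberg (a b K : R) (B k : nat) : 0 <= K -> `|a| <= K -> `|b| <= K ->
  \int[P]_w lindeberg_min (comb a b k) w <=
  2 * (a ^+ 2 + b ^+ 2) * (dev_tail B + K * B.+1%:R * W2).
Proof.
move=> K0 aK bK.
pose G e : R := Num.min (env_comb xi p a b e ^+ 2) (`|env_comb xi p a b e| ^+ 3).
have mG : measurable_fun setT G.
  apply: measurable_minr; first by apply: measurable_funX; exact: measurable_env_comb.
  apply: measurable_funX; apply: measurableT_comp; first exact: normr_measurable.
  exact: measurable_env_comb.
have -> : \int[P]_w lindeberg_min (comb a b k) w = \int[P]_w G (xi k w).
  by apply: eq_Rintegral => w _; rewrite /lindeberg_min combE.
rewrite (Pintegral_env_invariant xi_iid mG).
have -> : \int[P]_w G (xi 0 w) = \int[P]_w lindeberg_min (comb a b 0) w.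
  by apply: eq_Rintegral => w _; rewrite /lindeberg_min combE.
have iW := dev_norm_sqr_integrable var_fin.
have iT := tail_integrable B.
set c := 2 * (a ^+ 2 + b ^+ 2).
have c0 : 0 <= c by rewrite mulr_ge0// addr_ge0 ?sqr_ge0.
have -> : c * (dev_tail B + K * B.+1%:R * W2) =
    \int[P]_w (c * (W w ^+ 2 * (B < Num.truncn (W w))%N%:R + K * B.+1%:R * W w ^+ 2)).
  rewrite PintegralZ; last by apply: PintegrableD => //; exact: PintegrableZ.
  by rewrite (PintegralD iT (PintegrableZ _ iW)) PintegralZ.
apply: le_Pintegral.
- apply: Pintegrable_lindeberg_min; first exact: measurable_comb.
  exact: comb_sqr_integrable.
- by apply: PintegrableZ; apply: PintegrableD => //; exact: PintegrableZ.
move=> w; have x2 := comb_sqr_le xi p a b w; rewrite -/c in x2.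
rewrite /lindeberg_min mulrDr; have W0 := dev_norm_ge0 xi p w.
have [BW|WB] := ltnP B (Num.truncn (W w)).
  rewrite mulr1 (le_trans (y := comb a b 0 w ^+ 2))//; first by rewrite ge_min lexx.
  rewrite (le_trans x2)// lerDl; apply: mulr_ge0 => //.
  by apply: mulr_ge0; [exact: mulr_ge0|exact: sqr_ge0].
rewrite mulr0 mulr0 add0r ge_min; apply/orP; right.
have WB1 : W w <= B.+1%:R.
  by have /andP[_ /ltW h] := truncn_itv W0; rewrite (le_trans h)// ler_nat ltnS.
rewrite exprS [leRHS]mulrCA; apply: ler_pM => //.
  rewrite (le_trans (comb_le xi p w aK bK))// ler_wpM2l//.
by rewrite real_normK ?num_real.
Qed.

Lemma comb_sqr_small (a b K : R) k : 0 <= K -> `|a| <= K -> `|b| <= K ->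
  \int[P]_w (comb a b k w ^+ 2) <= K ^+ 2 * W2.
Proof.
move=> K0 aK bK.
pose G e : R := env_comb xi p a b e ^+ 2.
have mG : measurable_fun setT G by apply: measurable_funX; exact: measurable_env_comb.
have -> : \int[P]_w (comb a b k w ^+ 2) = \int[P]_w G (xi k w).
  by apply: eq_Rintegral => w _; rewrite combE.
rewrite (Pintegral_env_invariant xi_iid mG).
rewrite -PintegralZ; last exact: dev_norm_sqr_integrable.
apply: le_Pintegral.
- have := comb_sqr_integrable xi_iid var_fin a b 0.
  by under eq_fun do rewrite combE.
- by apply: PintegrableZ; exact: dev_norm_sqr_integrable.
move=> w; rewrite /G -combE -(real_normK (num_real (comb a b 0 w))) -exprMn.
rewrite lerXn2r// ?nnegrE ?mulr_ge0 ?dev_norm_ge0//.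
exact: comb_le.
Qed.

Section Coefficients.
Variables (a b : nat -> R).

Let eta k w := comb (a k) (b k) k w.
Let s k := Num.sqrt (\int[P]_w (eta k w ^+ 2)).

Lemma mfun_row_sum k : mfun_of (past xi X k) (row_sum eta k).
Proof. by apply: measurable_sum => j; apply: mfun_comb. Qed.

(** The partial sum depends on the environments of the earlier generations,
    hence is independent of the next summand. *)
Lemma matches_row k : matches P (s k) (row_sum eta k) (eta k).
Proof.
move=> L g gL gb; have mg := lipschitz_measurable gL.
have mY : mfun_of (past xi X k) (fun w => g (row_sum eta k w)).
  exact: (measurableT_comp mg (@mfun_row_sum k)).
have mH : mfun_of (present xi X k) (eta k) by apply: mfun_comb => /=.
have Yb w : `|g (row_sum eta k w)| <= L by exact: gb.
split.
  rewrite (past_present_PintegralM xi_iid X_law mY mH Yb); last exact: comb_integrable.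
  by rewrite integral_comb// mulr0.
have mH2 : mfun_of (present xi X k) (fun w => eta k w ^+ 2) by apply: measurable_funX.
rewrite (past_present_PintegralM xi_iid X_law mY mH2 Yb); last exact: comb_sqr_integrable.
rewrite mulrC /s sqr_sqrtr//; apply: Rintegral_ge0 => w _; exact: sqr_ge0.
Qed.

(** The cubes of the standard deviations are bounded by their maximum times
    the total variance one. *)
Lemma row_cdf (N : nat) (K x e : R) (B : nat) : 0 <= K ->
  (forall k, `|a k| <= K) -> (forall k, `|b k| <= K) ->
  \sum_(k < N) \int[P]_w (eta k w ^+ 2) = 1 -> 0 < e -> e <= 1 ->
  `|fine (P [set w | row_sum eta N w <= x]) - Phi x| <= 3 * normal_peak 1 * e +
  49 / e ^+ 3 * (2 * (\sum_(k < N) (a k ^+ 2 + b k ^+ 2)) *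
     (dev_tail B + K * B.+1%:R * W2) + normal_cube_bound * (K * Num.sqrt W2)).
Proof.
move=> K0 aK bK s1 e0 e1.
have s2 k : s k ^+ 2 = \int[P]_w (eta k w ^+ 2).
  by rewrite /s sqr_sqrtr//; apply: Rintegral_ge0 => w _; exact: sqr_ge0.
have cb0 : 0 <= normal_cube_bound :> R by rewrite mulr_ge0// expR_ge0.
apply: le_trans (lindeberg_cdf x (s := s) (X := eta) _ _ _ matches_row _ e0 e1) _.
- by move=> k; exact: sqrtr_ge0.
- by move=> k; exact: measurable_comb.
- by move=> k; exact: comb_sqr_integrable.
- by rewrite -[RHS]s1; apply: eq_bigr => k _.
rewrite lerD2l ler_wpM2l ?divr_ge0 ?exprn_ge0 ?(ltW e0)//.
rewrite big_split/=; apply: lerD.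
  rewrite mulr_sumr mulr_suml; apply: ler_sum => k _; exact: comb_lindeberg.
rewrite -mulr_sumr ler_wpM2l//.
apply: (@le_trans _ _ (\sum_(k < N) K * Num.sqrt W2 * s k ^+ 2)); last first.
  by rewrite -mulr_sumr -[leRHS]mulr1 -s1; under eq_bigr do rewrite s2.
apply: ler_sum => k _; rewrite exprS ler_wpM2r ?sqr_ge0//.
rewrite /s -[K](ger0_norm K0) -sqrtr_sqr -sqrtrM ?sqr_ge0// ler_wsqrtr//.
exact: comb_sqr_small.
Qed.

End Coefficients.

End RowCLT.

Section RandomWalks.
Context {d : measure_display} {T : measurableType d} {R : realType}.
Variable P : probability T R.
Variable xi : nat -> {RV P >-> (R * R)%type}.
Variable p : R.-pker R ~> nat.
Variable X : 'I_2 -> nat -> nat -> {RV P >-> nat}.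
Hypothesis xi_iid : iid xi.
Hypothesis X_law : quenched_offspring xi p X.
Hypothesis var_pos : forall l : 'I_2, (0 < 'V_P[M xi p l 0])%E.
Hypothesis var_fin : forall l : 'I_2, ('V_P[M xi p l 0] < +oo)%E.
Hypothesis rho_cond : (-1 <= rho xi p < 1) \/
                (rho xi p = 1 /\ sigma xi p proc1 <> sigma xi p proc2).

Notation s1 := (sigma xi p proc1).
Notation s2 := (sigma xi p proc2).
Notation rh := (rho xi p).
Notation LG l n w := (log_growth xi p l n w).
Notation Vmn m n := (V xi p m n).

Let s10 : 0 < s1. Proof. exact: sigma_gt0. Qed.
Let s20 : 0 < s2. Proof. exact: sigma_gt0. Qed.

Lemma minn_div m n : (0 < m)%N -> (0 < n)%N ->
  (minn m n)%:R / (m%:R * n%:R) = Num.min (n%:R^-1) (m%:R^-1) :> R.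
Proof.
move=> m0 n0; have m0' : (m%:R : R) != 0 by rewrite pnatr_eq0 -lt0n.
have n0' : (n%:R : R) != 0 by rewrite pnatr_eq0 -lt0n.
have pm : (0 : R) < m%:R by rewrite ltr0n.
have pn : (0 : R) < n%:R by rewrite ltr0n.
have [mn|nm] := leqP m n.
  rewrite min_l; first by field; rewrite n0' m0'.
  by rewrite lef_pV2 ?posrE// ler_nat.
rewrite min_r; first by field; rewrite n0' m0'.
by rewrite lef_pV2 ?posrE// ler_nat ltnW.
Qed.

Lemma V_sqr_ge : exists2 c, 0 < c & forall m n, (0 < m)%N -> (0 < n)%N ->
  Vmn m n ^+ 2 = s1 ^+ 2 / n%:R + s2 ^+ 2 / m%:R
    - 2 * rh * s1 * s2 * ((minn m n)%:R / (m%:R * n%:R)) /\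
  c * (n%:R^-1 + m%:R^-1) <= Vmn m n ^+ 2.
Proof.
have [c c0 h] := row_variance_ge s10 s20 rho_cond.
exists c => // m n m0 n0.
have g : c * (n%:R^-1 + m%:R^-1) <= s1 ^+ 2 / n%:R + s2 ^+ 2 / m%:R
    - 2 * rh * s1 * s2 * ((minn m n)%:R / (m%:R * n%:R)).
  by rewrite minn_div//; apply: h; rewrite invr_ge0.
have VE : Vmn m n ^+ 2 = s1 ^+ 2 / n%:R + s2 ^+ 2 / m%:R
    - 2 * rh * s1 * s2 * ((minn m n)%:R / (m%:R * n%:R)).
  rewrite /V sqr_sqrtr//; apply: le_trans g.
  by rewrite mulr_ge0 ?(ltW c0)// addr_ge0// invr_ge0.
by split => //; rewrite VE.
Qed.

(** [Rstat] with the random walks of the log-means in place of [ln Z]. *)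
Definition walk_stat m n w : R :=
  (LG proc1 n w / n%:R - LG proc2 m w / m%:R - (mu xi p proc1 - mu xi p proc2)) / Vmn m n.

Lemma measurable_walk_stat m n : measurable_fun setT (walk_stat m n).
Proof.
apply: measurable_funM => //; apply: measurable_funB => //.
by apply: measurable_funB; apply: measurable_funM => //; exact: measurable_log_growth.
Qed.

Section Row.
Variables (m n : nat) (c : R).
Hypotheses (m0 : (0 < m)%N) (n0 : (0 < n)%N) (c0 : 0 < c).
Hypothesis VE : Vmn m n ^+ 2 = s1 ^+ 2 / n%:R + s2 ^+ 2 / m%:R
    - 2 * rh * s1 * s2 * ((minn m n)%:R / (m%:R * n%:R)).
Hypothesis Vc : c * (n%:R^-1 + m%:R^-1) <= Vmn m n ^+ 2.

Let pm : (0 : R) < m%:R. Proof. by rewrite ltr0n. Qed.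
Let pn : (0 : R) < n%:R. Proof. by rewrite ltr0n. Qed.

Lemma V_gt0 : 0 < Vmn m n.
Proof.
rewrite lt_neqAle sqrtr_ge0 andbT eq_sym; apply/eqP => V0.
move: Vc; rewrite V0 expr0n/= leNgt => /negP; apply.
by rewrite mulr_gt0// addr_gt0// invr_gt0.
Qed.

Let a k : R := if (k < n)%N then (n%:R * Vmn m n)^-1 else 0.
Let b k : R := if (k < m)%N then (m%:R * Vmn m n)^-1 else 0.
Let N := maxn m n.
Let nN : (n <= N)%N. Proof. exact: leq_maxr. Qed.
Let mN : (m <= N)%N. Proof. exact: leq_maxl. Qed.

(** The coefficients vanish beyond the lengths of the two walks, so one row of
    length [maxn m n] accounts for both. *)
Lemma row_sum_walk w :
  row_sum (fun k w => comb xi p (a k) (b k) k w) N w = walk_stat m n w.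
Proof.
have V0 := V_gt0.
rewrite /row_sum /comb sumrB.
have -> : \sum_(k < N) a k * centered xi p proc1 k w =
    (n%:R * Vmn m n)^-1 * (LG proc1 n w - n%:R * mu xi p proc1).
  transitivity (\sum_(k < N) (if (k < n)%N then
      (n%:R * Vmn m n)^-1 * centered xi p proc1 k w else 0)).
    by apply: eq_bigr => k _; rewrite /a; case: ifP; rewrite ?mul0r.
  rewrite (sum_below (fun k => (n%:R * Vmn m n)^-1 * centered xi p proc1 k w))//.
  by rewrite -mulr_sumr /centered sumrB sumr_const card_ord -[mu _ _ _ *+ _]mulr_natl.
have -> : \sum_(k < N) b k * centered xi p proc2 k w =
    (m%:R * Vmn m n)^-1 * (LG proc2 m w - m%:R * mu xi p proc2).
  transitivity (\sum_(k < N) (if (k < m)%N then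
      (m%:R * Vmn m n)^-1 * centered xi p proc2 k w else 0)).
    by apply: eq_bigr => k _; rewrite /b; case: ifP; rewrite ?mul0r.
  rewrite (sum_below (fun k => (m%:R * Vmn m n)^-1 * centered xi p proc2 k w))//.
  by rewrite -mulr_sumr /centered sumrB sumr_const card_ord -[mu _ _ _ *+ _]mulr_natl.
rewrite /walk_stat; field.
by rewrite !gt_eqF.
Qed.

Let sum_a2 : \sum_(k < N) a k ^+ 2 = (n%:R * Vmn m n ^+ 2)^-1.
Proof.
have V0 := V_gt0.
transitivity (\sum_(k < N) (if (k < n)%N then (n%:R * Vmn m n)^-1 ^+ 2 else 0)).
  by apply: eq_bigr => k _; rewrite /a; case: ifP => // _; rewrite expr0n.
by rewrite sum_below_cst//; field; rewrite !gt_eqF.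
Qed.

Let sum_b2 : \sum_(k < N) b k ^+ 2 = (m%:R * Vmn m n ^+ 2)^-1.
Proof.
have V0 := V_gt0.
transitivity (\sum_(k < N) (if (k < m)%N then (m%:R * Vmn m n)^-1 ^+ 2 else 0)).
  by apply: eq_bigr => k _; rewrite /b; case: ifP => // _; rewrite expr0n.
by rewrite sum_below_cst//; field; rewrite !gt_eqF.
Qed.

Let sum_ab : \sum_(k < N) a k * b k = (minn m n)%:R / (m%:R * n%:R) / Vmn m n ^+ 2.
Proof.
have V0 := V_gt0.
transitivity (\sum_(k < N) (if (k < minn m n)%N then
    (n%:R * Vmn m n)^-1 * (m%:R * Vmn m n)^-1 else 0)).
  apply: eq_bigr => k _; rewrite /a /b leq_min.
  by case: (k < n)%N; case: (k < m)%N; rewrite ?mulr0 ?mul0r.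
rewrite sum_below_cst; last by rewrite geq_min mN.
by field; rewrite !gt_eqF.
Qed.

Lemma row_variance1 :
  \sum_(k < N) \int[P]_w (comb xi p (a k) (b k) k w ^+ 2) = 1.
Proof.
have V0 := V_gt0; have s1n : s1 != 0 by rewrite gt_eqF.
have s2n : s2 != 0 by rewrite gt_eqF.
under eq_bigr => k _ do rewrite integral_comb_sqr//.
have -> : \sum_(k < N) (a k ^+ 2 * s1 ^+ 2 + b k ^+ 2 * s2 ^+ 2 - 2 * a k * b k * (rh * s1 * s2)) =
    (\sum_(k < N) a k ^+ 2) * s1 ^+ 2 + (\sum_(k < N) b k ^+ 2) * s2 ^+ 2 -
    2 * (\sum_(k < N) a k * b k) * (rh * s1 * s2).
  rewrite !mulr_suml mulr_sumr mulr_suml -big_split/= -sumrB.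
  by apply: eq_bigr => k _; ring.
rewrite sum_a2 sum_b2 sum_ab.
have V2 : Vmn m n ^+ 2 != 0 by rewrite sqrf_eq0 gt_eqF.
apply: (mulIf V2); rewrite mul1r [RHS]VE; field.
by rewrite !gt_eqF.
Qed.

Lemma row_sum_coef2 : \sum_(k < N) (a k ^+ 2 + b k ^+ 2) <= c^-1.
Proof.
have V0 := V_gt0; have V2 : 0 < Vmn m n ^+ 2 by rewrite exprn_gt0.
rewrite big_split/= sum_a2 sum_b2 -[leRHS]mul1r ler_pdivlMr//.
have -> : ((n%:R * Vmn m n ^+ 2)^-1 + (m%:R * Vmn m n ^+ 2)^-1) * c =
    (c * (n%:R^-1 + m%:R^-1)) / Vmn m n ^+ 2.
  by field; rewrite !gt_eqF.
by rewrite ler_pdivrMr// mul1r.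
Qed.

(** A coefficient is the inverse of [j * V], and [V ^+ 2] is at least
    [c / j]. *)
Lemma coef_le (L : nat) : (0 < L)%N -> (L <= m)%N -> (L <= n)%N ->
  (forall k, `|a k| <= (Num.sqrt (c * L%:R))^-1) /\
  (forall k, `|b k| <= (Num.sqrt (c * L%:R))^-1).
Proof.
move=> L0 Lm Ln; have V0 := V_gt0.
have cL : 0 < c * L%:R by rewrite mulr_gt0// ltr0n.
have key j : (L <= j)%N -> c / j%:R <= Vmn m n ^+ 2 ->
    (j%:R * Vmn m n)^-1 <= (Num.sqrt (c * L%:R))^-1.
  move=> Lj cj; have j0 : (0 : R) < j%:R by rewrite ltr0n (leq_trans L0).
  have jV : 0 < j%:R * Vmn m n by rewrite mulr_gt0.
  rewrite lef_pV2 ?posrE ?sqrtr_gt0//.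
  rewrite -[leRHS](ger0_norm (ltW jV)) -sqrtr_sqr ler_wsqrtr//.
  apply: (@le_trans _ _ (c * j%:R)); first by rewrite ler_pM2l// ler_nat.
  rewrite exprMn; apply: (@le_trans _ _ (j%:R ^+ 2 * (c / j%:R))).
    by rewrite le_eqVlt; apply/orP; left; apply/eqP; field; rewrite gt_eqF.
  by rewrite ler_wpM2l// sqr_ge0.
have cn : c / n%:R <= Vmn m n ^+ 2.
  by apply: le_trans Vc; rewrite mulrDr lerDl mulr_ge0 ?invr_ge0// ltW.
have cm : c / m%:R <= Vmn m n ^+ 2.
  by apply: le_trans Vc; rewrite mulrDr lerDr mulr_ge0 ?invr_ge0// ltW.
split => k; rewrite /a /b; case: ifP => _; rewrite ?normr0 ?invr_ge0 ?sqrtr_ge0//.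
  by rewrite ger0_norm ?key// invr_ge0 mulr_ge0 ?ltW.
by rewrite ger0_norm ?key// invr_ge0 mulr_ge0 ?ltW.
Qed.

Lemma walk_cdf (x e : R) (B L : nat) : (0 < L)%N -> (L <= m)%N -> (L <= n)%N ->
  0 < e -> e <= 1 ->
  `|fine (P [set w | walk_stat m n w <= x]) - Phi x| <= 3 * normal_peak 1 * e +
  49 / e ^+ 3 * (2 * c^-1 * (dev_tail xi p B +
      (Num.sqrt (c * L%:R))^-1 * B.+1%:R * \int[P]_w (dev_norm xi p w ^+ 2)) +
    normal_cube_bound * ((Num.sqrt (c * L%:R))^-1 *
      Num.sqrt (\int[P]_w (dev_norm xi p w ^+ 2)))).
Proof.
move=> L0 Lm Ln e0 e1; have [aK bK] := coef_le L0 Lm Ln.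
set K := (Num.sqrt _)^-1 in aK bK *.
have K0 : 0 <= K by rewrite invr_ge0 sqrtr_ge0.
have := row_cdf xi_iid X_law var_fin x B K0 aK bK row_variance1 e0 e1.
have -> : [set w | row_sum (fun k w => comb xi p (a k) (b k) k w) N w <= x] =
    [set w | walk_stat m n w <= x].
  by apply/seteqP; split => w /=; rewrite row_sum_walk.
move=> h; apply: le_trans h _; rewrite lerD2l ler_wpM2l ?divr_ge0 ?exprn_ge0 ?(ltW e0)//.
rewrite lerD2r ler_wpM2r//.
  rewrite addr_ge0 ?dev_tail_ge0// !mulr_ge0//; apply: Rintegral_ge0 => w _; exact: sqr_ge0.
by rewrite ler_wpM2l//; exact: row_sum_coef2.
Qed.

End Row.

(** The constants are chosen one after the other: the width of the smooth
    step, then the level [B] of the tail, then the length of the walks, which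
    bounds the coefficients. *)
Lemma walk_clt (x e : R) : 0 < e -> exists2 L, (0 < L)%N & forall m n,
  (L <= m)%N -> (L <= n)%N ->
  `|fine (P [set w | walk_stat m n w <= x]) - Phi x| <= e.
Proof.
move=> e0; have [c c0 hV] := V_sqr_ge.
have pk0 : 0 <= normal_peak 1 :> R by exact: normal_peak_ge0.
pose q := 3 * normal_peak 1 : R.
have q0 : 0 <= q by rewrite mulr_ge0.
pose h := Num.min 1 (e / 2 / (q + 1)).
have q1 : 0 < q + 1 by rewrite ltr_wpDl.
have h0 : 0 < h by rewrite lt_min ltr01/= divr_gt0// divr_gt0.
have h1 : h <= 1 by rewrite ge_min lexx.
have qh : q * h <= e / 2.
  apply: (@le_trans _ _ ((q + 1) * h)); first by rewrite ler_wpM2r ?lerDl// ltW.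
  by rewrite mulrC -ler_pdivlMr// ge_min lexx orbT.
pose A := 49 / h ^+ 3.
have A0 : 0 < A by rewrite divr_gt0// exprn_gt0.
have t0 : 0 < e / 4 / (A * (2 * c^-1)).
  by rewrite !divr_gt0// mulr_gt0// mulr_gt0// invr_gt0.
have [B hB] := dev_tail_small var_fin t0.
pose W2 := \int[P]_w (dev_norm xi p w ^+ 2).
have W20 : 0 <= W2 by apply: Rintegral_ge0 => w _; exact: sqr_ge0.
pose D := A * (2 * c^-1 * (B.+1%:R * W2) + normal_cube_bound * Num.sqrt W2).
have D0 : 0 <= D.
  rewrite mulr_ge0 ?(ltW A0)// addr_ge0//.
    by rewrite !mulr_ge0// invr_ge0 ltW.
  by rewrite mulr_ge0 ?sqrtr_ge0// mulr_ge0// expR_ge0.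
pose k0 := e / 4 / (D + 1).
have D1 : 0 < D + 1 by rewrite ltr_wpDl.
have k00 : 0 < k0 by rewrite !divr_gt0.
(* From this length on, the coefficients are at most [k0]. *)
pose L := (Num.truncn (c^-1 * k0 ^- 2)).+1.
exists L => // m n Lm Ln.
have m0 : (0 < m)%N by exact: leq_trans Lm.
have n0 : (0 < n)%N by exact: leq_trans Ln.
have [VE Vc] := hV m n m0 n0.
have := walk_cdf m0 n0 c0 VE Vc x B (isT : (0 < L)%N) Lm Ln h0 h1.
set K := (Num.sqrt _)^-1; rewrite -/W2 -/A -/q => H.
have K0 : 0 <= K by rewrite invr_ge0 sqrtr_ge0.
have Kk : K <= k0.
  have cL : k0 ^- 2 <= c * L%:R.
    rewrite mulrC -ler_pdivrMr// mulrC; apply/ltW; exact: truncnS_gt.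
  rewrite /K -[k0]invrK lef_pV2 ?posrE ?invr_gt0//; last first.
    by rewrite sqrtr_gt0 mulr_gt0// ltr0n.
  have kV : 0 <= k0^-1 by rewrite invr_ge0 ltW.
  by rewrite -[leLHS](ger0_norm kV) -sqrtr_sqr ler_wsqrtr// exprVn.
apply: (le_trans H).
have -> : q * h + A * (2 * c^-1 * (dev_tail xi p B + K * B.+1%:R * W2) +
    normal_cube_bound * (K * Num.sqrt W2)) =
    q * h + (A * (2 * c^-1) * dev_tail xi p B + K * D) by rewrite /D; ring.
rewrite [e in leRHS](_ : e = e / 2 + (e / 4 + e / 4)); last by field.
apply: lerD => //; apply: lerD.
  by rewrite mulrC -ler_pdivlMr// mulr_gt0// mulr_gt0// invr_gt0.
apply: (@le_trans _ _ (k0 * (D + 1))).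
  by apply: ler_pM => //; rewrite lerDl.
by rewrite /k0 divfK// gt_eqF.
Qed.

End RandomWalks.

(** * Conclusion *)

Section Slutsky.
Context {d : measure_display} {T : measurableType d} {R : realType}.
Variable P : probability T R.

(** The quantitative form of Slutsky's argument. *)
Lemma cdf_perturb (f g : T -> R) (E : set T) (x h e : R) :
  measurable_fun setT f -> measurable_fun setT g -> measurable E ->
  (P E <= e%:E)%E -> (forall w, ~ E w -> `|f w - g w| <= h) ->
  fine (P [set w | g w <= x - h]) - e <= fine (P [set w | f w <= x]) <=
  fine (P [set w | g w <= x + h]) + e.
Proof.
move=> mf mg mE PE fg.
have mS (u : T -> R) y : measurable_fun setT u -> measurable [set w | u w <= y].
  by move=> mu; apply: measurable_le_set.
have fin A : measurable A -> P A \is a fin_num by move=> mA; exact: fin_num_measure.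
have step (u v : T -> R) y z : measurable_fun setT u -> measurable_fun setT v ->
    (forall w, ~ E w -> u w <= y -> v w <= z) ->
    fine (P [set w | u w <= y]) <= fine (P [set w | v w <= z]) + e.
  move=> mu mv uv; rewrite -lee_fin EFinD !fineK ?fin//; [|exact: mS|exact: mS].
  apply: (@le_trans _ _ (P ([set w | v w <= z] `|` E))).
    apply: le_measure; rewrite ?inE//; [exact: mS|by apply: measurableU => //; exact: mS|].
    move=> w /= uw; have [Ew|Ew] := pselect (E w); first by right.
    by left; exact: uv.
  apply: (le_trans (measureU2 _ _ _)) => //; first exact: mS.
  by apply: leeD.
apply/andP; split.
  rewrite lerBlDr; apply: step => // w Ew.
  by have := fg w Ew; rewrite ler_distl => /andP[h1 h2] h3; lra.
apply: step => // w Ew; have := fg w Ew; rewrite ler_distl => /andP[h1 h2] h3; lra.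
Qed.

End Slutsky.

Theorem theorem2p1 (d : measure_display) (T : measurableType d)
    (R : realType) (P : probability T R)
    (xi : nat -> {RV P >-> (R * R)%type})
    (p : R.-pker R ~> nat)
    (X : 'I_2 -> nat -> nat -> {RV P >-> nat})
    (xi_iid : iid xi)
    (X_law : quenched_offspring xi p X)
    (m_finite : forall l : 'I_2, {ae P, forall w, (emean xi p l 0 w < +oo)%E})
    (sigma_pos_finite :
      forall l : 'I_2, (0 < 'V_P[M xi p l 0])%E /\ ('V_P[M xi p l 0] < +oo)%E)
    (Z_log_moment :
      ('E_P[fun w =>
          ((Z X proc1 1 w)%:R / mean xi p proc1 0 w * lnplus (Z X proc1 1 w)%:R
         + (Z X proc2 1 w)%:R / mean xi p proc2 0 w * lnplus (Z X proc2 1 w)%:R)%R]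
       < +oo)%E)
    (p0_eq0 :
      forall l : 'I_2, {ae P, forall w, p (env xi l 0 w) [set 0%N] = 0%E})
    (rho_cond : (-1 <= rho xi p < 1) \/
                (rho xi p = 1 /\ sigma xi p proc1 <> sigma xi p proc2)) :
  forall x : R,
    (fun mn : nat * nat => P [set w | Rstat xi p X mn.1 mn.2 w <= x])
      @ min_infty --> normal_prob (0 : R) 1 `]-oo, x].
Proof.
move=> x.
have var_pos l : (0 < 'V_P[M xi p l 0])%E by have [] := sigma_pos_finite l.
have var_fin l : ('V_P[M xi p l 0] < +oo)%E by have [] := sigma_pos_finite l.
pose LM l w : R := (offspring_mean p (env xi l 0 w))^-1 * (X l 0%N 0%N w)%:R *
  lnplus (X l 0%N 0%N w)%:R.
have LM0 l w : 0 <= LM l w.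
  by rewrite !mulr_ge0 ?invr_ge0 ?offspring_mean_ge0// /lnplus le_max lexx orbT.
have mLM l : measurable_fun setT (LM l).
  apply: measurable_funM; last exact: (measurable_offspring X l 0 0 (fun k => lnplus k%:R)).
  apply: measurable_funM; last exact: (measurable_offspring X l 0 0 (fun k => k%:R)).
  exact: (measurableT_comp (measurable_inv_offspring p) (measurable_env xi l 0)).
have LMfin : (\int[P]_w (LM proc1 w + LM proc2 w)%:E < +oo)%E.
  move: Z_log_moment; rewrite expectation.unlock; congr (_ < _)%E.
  apply: eq_integral => w _; congr EFin.
  by rewrite /= !big_ord1 !mean_offspring_mean /LM; congr (_ * _ + _ * _); rewrite mulrC.
have log_moment l : l = proc1 \/ l = proc2 -> (\int[P]_w (LM l w)%:E < +oo)%E.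
  move=> ll; apply: le_lt_trans LMfin; apply: ae_le_integralE => //.
  - exact: measurable_funD.
  - by move=> w; rewrite addr_ge0.
  - by apply: aeW => w; case: ll => ->; rewrite ?lerDl ?lerDr.
have tight l : l = proc1 \/ l = proc2 -> forall e : R, 0 < e ->
    exists k K, 0 < K /\ forall n, (k <= n)%N ->
    (P [set w | (`|ln (Z X l n w)%:R - log_growth xi p l n w| > K)%R] <= e%:E)%E.
  move=> ll e e0; apply: (log_Z_tight xi_iid X_law) => //.
  exact: log_moment.
have mlnZ l n : measurable_fun setT (fun w => ln (Z X l n w)%:R : R).
  exact: (measurable_lnZ xi).
have mRstat m n : measurable_fun setT (Rstat xi p X m n).
  apply: measurable_funM => //; apply: measurable_funB => //.
  by apply: measurable_funB; apply: measurable_funM.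
have -> : normal_prob (0 : R) 1 `]-oo, x] = (Phi x)%:E.
  by rewrite /Phi fineK// fin_num_measure.
apply/cvg_EFin; first by apply: nearW => mn; apply: fin_num_measure; exact: measurable_le_set.
apply/cvgrPdist_le => e e0.
have [c c0 hV] := V_sqr_ge var_pos var_fin rho_cond.
have e8 : 0 < e / 8 by rewrite divr_gt0.
have e4 : 0 < e / 4 by rewrite divr_gt0.
have [k1 [K1 [K10 h1]]] := tight proc1 (or_introl erefl) _ e8.
have [k2 [K2 [K20 h2]]] := tight proc2 (or_intror erefl) _ e8.
pose K := Num.max K1 K2.
have K0 : 0 < K by rewrite /K lt_max K10.
have pk0 : 0 <= normal_peak 1 :> R by exact: normal_peak_ge0.
have pk1 : 0 < normal_peak 1 + 1 :> R by rewrite ltr_wpDl.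
pose h := e / 4 / (normal_peak 1 + 1) : R.
have h0 : 0 < h by rewrite divr_gt0.
have ph : normal_peak 1 * h <= e / 4.
  by rewrite /h mulrCA ler_piMr ?(ltW e4)// ler_pdivrMr// mul1r lerDl.
have [L1 L10 hL1] := walk_clt xi_iid X_law var_pos var_fin rho_cond (x - h) e4.
have [L2 L20 hL2] := walk_clt xi_iid X_law var_pos var_fin rho_cond (x + h) e4.
pose L0 := (Num.truncn (2 * K ^+ 2 / (c * h ^+ 2))).+1.
pose L := maxn (maxn k1 k2) (maxn (maxn L1 L2) L0).
exists L => // -[m n] /=; rewrite leq_min => /andP[Lm Ln].
have below j : (j <= L)%N -> (j <= m)%N /\ (j <= n)%N.
  by move=> jL; split; [exact: leq_trans Lm|exact: leq_trans Ln].
have [km2 kn2] := below k2 (leq_trans (leq_maxr _ _) (leq_maxl _ _)).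
have [km1 kn1] := below k1 (leq_trans (leq_maxl _ _) (leq_maxl _ _)).
have [Lm1 Ln1] := below L1 (leq_trans (leq_trans (leq_maxl _ _) (leq_maxl _ _)) (leq_maxr _ _)).
have [Lm2 Ln2] := below L2 (leq_trans (leq_trans (leq_maxr _ _) (leq_maxl _ _)) (leq_maxr _ _)).
have [Lm0 Ln0] := below L0 (leq_trans (leq_maxr _ _) (leq_maxr _ _)).
have m0 : (0 < m)%N by exact: leq_trans Lm1.
have n0 : (0 < n)%N by exact: leq_trans Ln1.
have pm : (0 : R) < m%:R by rewrite ltr0n.
have pn : (0 : R) < n%:R by rewrite ltr0n.
have [VE Vc] := hV m n m0 n0.
have V0 := V_gt0 m0 n0 c0 Vc.
set v := V xi p m n in VE Vc V0.
pose u : R := n%:R^-1 + m%:R^-1.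
have u0 : 0 < u by rewrite addr_gt0// invr_gt0.
(* The normalisation [v] is at least of order [sqrt u], so that a tight error, divided
   by [n * v] or [m * v], is at most of order [sqrt u]. *)
have uv : K * u / v <= h.
  have L00 : (0 : R) < L0%:R by rewrite ltr0n.
  have uL : u <= 2 / L0%:R.
    have -> : 2 / L0%:R = L0%:R^-1 + L0%:R^-1 :> R by field; rewrite gt_eqF.
    by apply: lerD; rewrite lef_pV2 ?posrE// ler_nat.
  have uh : K ^+ 2 * u <= c * h ^+ 2.
    have ch : 0 < c * h ^+ 2 by rewrite mulr_gt0// exprn_gt0.
    have : 2 * K ^+ 2 / (c * h ^+ 2) <= L0%:R by apply/ltW; exact: truncnS_gt.
    rewrite ler_pdivrMr// => g.
    apply: (@le_trans _ _ (K ^+ 2 * (2 / L0%:R))); first by rewrite ler_wpM2l// sqr_ge0.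
    have -> : K ^+ 2 * (2 / L0%:R) = 2 * K ^+ 2 / L0%:R by field; rewrite gt_eqF.
    by rewrite ler_pdivrMr// [leRHS]mulrC.
  have hv : 0 <= h * v by exact/ltW/mulr_gt0.
  have Ku : 0 <= K * u by exact/ltW/mulr_gt0.
  rewrite ler_pdivrMr// -(@ler_pXn2r _ 2)//.
  rewrite (exprMn 2 K) (exprMn 2 h); apply: (@le_trans _ _ (h ^+ 2 * (c * u))); last first.
    by apply: ler_wpM2l => //; exact: sqr_ge0.
  have -> : h ^+ 2 * (c * u) = c * h ^+ 2 * u by ring.
  by rewrite [X in _ * X]expr2 mulrA ler_wpM2r// ltW.
pose E := [set w | `|ln (Z X proc1 n w)%:R - log_growth xi p proc1 n w| > K1] `|`
  [set w | `|ln (Z X proc2 m w)%:R - log_growth xi p proc2 m w| > K2].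
have mbad l j (K' : R) : measurable [set w | `|ln (Z X l j w)%:R - log_growth xi p l j w| > K'].
  apply: (measurable_lt_set (f := cst K')) => //.
  apply: measurableT_comp; first exact: normr_measurable.
  by apply: measurable_funB => //; exact: measurable_log_growth.
have mE : measurable E by apply: measurableU; exact: mbad.
have PE : (P E <= (e / 4)%:E)%E.
  apply: (le_trans (measureU2 _ (mbad _ _ _) (mbad _ _ _))).
  have -> : (e / 4)%:E = (e / 8 + e / 8)%:E by congr EFin; field.
  by rewrite EFinD; apply: leeD; [exact: h1|exact: h2].
have close w : ~ E w -> `|Rstat xi p X m n w - walk_stat xi p m n w| <= h.
  move=> /not_orP[/negP g1 /negP g2]; rewrite -leNgt in g1; rewrite -leNgt in g2.
  apply: le_trans uv; rewrite /Rstat /walk_stat -/v -mulrBl normrM.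
  rewrite [X in _ * X]ger0_norm ?invr_ge0 ?(ltW V0)// ler_wpM2r ?invr_ge0 ?(ltW V0)//.
  set z1 := ln _ in g1 *; set z2 := ln _ in g2 *.
  set l1 := log_growth _ _ _ _ _ in g1 *; set l2 := log_growth _ _ _ _ _ in g2 *.
  have -> : z1 / n%:R - z2 / m%:R - (mu xi p proc1 - mu xi p proc2) -
      (l1 / n%:R - l2 / m%:R - (mu xi p proc1 - mu xi p proc2)) =
      (z1 - l1) / n%:R - (z2 - l2) / m%:R by ring.
  rewrite (le_trans (ler_normB _ _))// !normrM /u mulrDr.
  apply: lerD; rewrite [X in _ * X <= _]ger0_norm ?invr_ge0// ler_wpM2r ?invr_ge0//.
    by rewrite (le_trans g1)// /K le_max lexx.
  by rewrite (le_trans g2)// /K le_max lexx orbT.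
have mW := measurable_walk_stat xi p m n.
have /andP[lo hi] := cdf_perturb x (mRstat m n) mW mE PE close.
have := hL1 m n Lm1 Ln1; have := hL2 m n Lm2 Ln2.
rewrite !ler_distl => /andP[_ a2] /andP[a1 _].
have p1 : Phi x - Phi (x - h) <= e / 4.
  by apply: le_trans (Phi_lip _) _; [rewrite gerBl ltW|rewrite opprB addrC subrK].
have p2 : Phi (x + h) - Phi x <= e / 4.
  by apply: le_trans (Phi_lip _) _; [rewrite lerDl ltW|rewrite addrAC subrr add0r].
by apply/andP; split; lra.
Qed.
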